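(* Let $\mathcal{M}^{\mathrm{weh}}_{I^3}$ be the set of weakly equivariant homeomorphism classes of quasitoric manifolds over $I^3$, let $\Xi_3$ be the set of characteristic squares on $I^3$, and let $\phi\colon\Xi_3\to\mathcal{M}^{\mathrm{weh}}_{I^3}$ be the map sending $\xi$ to the class of $M(\xi)$. Then $$\mathcal{M}^{\mathrm{weh}}_{I^3}=\phi\bigl(A_1\cup A_2\cup A_3\cup\{\chi_1,\chi_5,\chi_6,\chi_{10}\}\bigr),$$ where $$A_1=\left\{\begin{pmatrix}1&x_1&x_2\\ 0&1&x_3\\ 0&0&1\end{pmatrix}: x_1,x_2,x_3\in\mathbb{Z}\right\},\quad A_2=\left\{\begin{pmatrix}1&s&t\\ 0&1&2\\ 0&1&1\end{pmatrix}: s,t\in\mathbb{Z}\right\},\quad A_3=\left\{\begin{pmatrix}1&0&0\\ s&1&2\\ t&1&1\end{pmatrix}: s,t\in\mathbb{Z}\right\},$$ $$\chi_1=\begin{pmatrix}1&0&2\\ 1&1&2\\ 0&1&1\end{pmatrix},\quad \chi_5=\begin{pmatrix}1&2&1\\ 0&1&1\\ 2&2&1\end{pmatrix},\quad \chi_6=\begin{pmatrix}1&1&1\\ 0&1&2\\ 2&1&1\end{pmatrix},\quad \chi_{10}=\begin{pmatrix}1&2&2\\ 0&1&2\\ 1&1&1\end{pmatrix}.$$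
   Context: $T^n=(S^1)^n=\mathbb{R}^n/\mathbb{Z}^n$. A map $f\colon X\to Y$ of $T^n$-spaces is weakly equivariant if there is $\psi\in\mathrm{Aut}(T^n)$ with $f(tx)=\psi(t)f(x)$ for all $t,x$. A smooth $T^n$-action on a $2n$-dimensional smooth manifold is locally standard if each point has a $T^n$-invariant open neighbourhood weakly equivariantly diffeomorphic to a $T^n$-invariant open subset of $\mathbb{C}^n$ with the standard action. A quasitoric manifold over a simple $n$-polytope $P$ is a pair $(M,\pi)$ of a $2n$-dimensional smooth manifold $M$ with a locally standard $T^n$-action and a continuous surjection $\pi\colon M\to P$ descending to a homeomorphism $M/T^n\to P$ of manifolds with corners (preserving the depth). Label the facets of $I^n$ by $F_i=\{x_i=0\}$, $F_{n+i}=\{x_i=1\}$ ($1\le i\le n$). A characteristic square on $I^n$ is an $n\times n$ integer matrix $\xi$ with all diagonal entries equal to $1$ such that the $n\times 2n$ matrix $\lambda=(E_n\ \xi)$ is a characteristic matrix on $I^n$, i.e. whenever $F_{i_1},\dots,F_{i_n}$ meet at a vertex, the columns satisfy $\det(\lambda_{i_1},\dots,\lambda_{i_n})=\pm1$. The quasitoric manifold $M(\xi)$ over $I^n$ is $(T^n\times I^n)/\!\sim$, where $(t_1,q_1)\sim(t_2,q_2)$ iff $q_1=q_2$ and $t_1t_2^{-1}$ lies in the subtorus that is the image of $(\lambda_{i_1},\dots,\lambda_{i_k})\colon T^k\to T^n$, where $F_{i_1},\dots,F_{i_k}$ are the facets containing $q_1$; $T^n$ acts by multiplication on the first factor. *)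

(* Defs.v *)
From HB Require Import structures.
From mathcomp Require Import all_boot all_order all_algebra.
From mathcomp Require Import all_classical all_reals all_analysis.

Set Implicit Arguments.
Unset Strict Implicit.
Unset Printing Implicit Defensive.

Import Order.TTheory GRing.Theory Num.Theory.
Import numFieldNormedType.Exports.
Import Quotient.Exports.

Local Open Scope classical_set_scope.
Local Open Scope quotient_scope.
Local Open Scope ring_scope.

Lemma rV_nbhs_compact (R : realType) (n : nat) (v : 'rV[R]_n)
    (A : set 'rV[R]_n) :
  nbhs v A -> exists K, [/\ compact K, nbhs v K & K `<=` A].
Proof.
move=> /nbhs_closedballP[r rA]; exists (closed_ball v r%:num); split=> //.
- apply: bounded_closed_compact; last exact: closed_ball_closed.
  exists (`|v| + r%:num); split; first exact: num_real.
  move=> M ltM w; rewrite closed_ballE // /closed_ball_ /= => vw.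
  apply: le_trans (ltW ltM); rewrite -lerBlDl.
  by apply: le_trans vw; rewrite distrC lerB_dist.
- by apply/nbhs_closedballP; exists r.
Qed.

Definition homeo (X Y : topologicalType) (f : X -> Y) : Prop :=
  continuous f /\ exists g : Y -> X, [/\ continuous g, cancel f g & cancel g f].

Fixpoint Ck (R : realType) (V W : normedModType R) (k : nat)
    (f : V -> W) (U : set V) : Prop :=
  match k with
  | 0 => forall x, U x -> {for x, continuous f}
  | k'.+1 => (forall x, U x -> differentiable f x) /\
             forall v, Ck k' (fun x => 'D_v f x) U
  end.

(* Meant for open U only. *)
Definition smooth (R : realType) (V W : normedModType R)
    (f : V -> W) (U : set V) : Prop := forall k, Ck k f U.

Definition int_lattice (R : realType) (n : nat) : {pred 'rV[R]_n} :=
  fun v => v \is a mxOver Num.int.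
Arguments int_lattice : clear implicits.

Fact int_lattice_zmod_closed (R : realType) (n : nat) :
  zmod_closed (int_lattice R n).
Proof.
split=> [|u v Lu Lv]; first exact: (@mxOver0 _ _ _ _ (rpred0 _)).
apply/mxOverP=> i j; move/mxOverP: Lu => Lu; move/mxOverP: Lv => Lv.
by rewrite !mxE rpredB.
Qed.

HB.instance Definition _ (R : realType) (n : nat) :=
  GRing.isZmodClosed.Build 'rV[R]_n (int_lattice R n)
    (@int_lattice_zmod_closed R n).

(* R^n / Z^n, written additively. *)
Definition torus (R : realType) (n : nat) : Type :=
  quotient_topology (Quotient.quot (int_lattice R n)).

Section Torus.
Variables (R : realType) (n : nat).
Local Notation T := (torus R n).

HB.instance Definition _ := Topological.on T.
HB.instance Definition _ := Quotient.on T.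
HB.instance Definition _ :=
  GRing.Zmodule.copy T (Quotient.quot (int_lattice R n)).

Lemma torus_piD : {morph \pi_T : u v / u + v}.
Proof. exact: (@Quotient.pi_add _ (int_lattice R n)). Qed.

Lemma torus_pi_eq (u v : 'rV[R]_n) :
  \pi_T u = \pi_T v <-> u - v \is a mxOver Num.int.
Proof.
have E := @Quotient.idealrBE _ (int_lattice R n) u v.
split=> [uv|Luv].
  by suff : u - v \in int_lattice R n by []; rewrite E; apply/eqP.
by have : u - v \in int_lattice R n by []; rewrite E => /eqP.
Qed.

Lemma torus_pi_open (U : set 'rV[R]_n) : open U -> open (\pi_T @` U).
Proof.
move=> oU; rewrite /open /= /quotient_open.
have -> : \pi_T @^-1` (\pi_T @` U) =
      \bigcup_(w in [set w : 'rV[R]_n | w \is a mxOver Num.int])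
        ((fun v => v + w) @^-1` U).
  apply/seteqP; split=> [v [u Uu /torus_pi_eq uv]|v [w /= Lw Uvw]].
    by exists (u - v) => //=; rewrite addrCA subrr addr0.
  exists (v + w) => //; apply/torus_pi_eq; by rewrite addrAC subrr add0r.
apply: bigcup_open => w _; apply: open_comp => // v _.
exact: (cvgD cvg_id (cvg_cst w)).
Qed.

Lemma torus_pi_nbhs (u : 'rV[R]_n) (U : set 'rV[R]_n) :
  nbhs u U -> nbhs (\pi_T u) (\pi_T @` U).
Proof.
rewrite nbhsE => -[V [oV Vu] VU]; rewrite nbhsE; exists (\pi_T @` V).
  by split; [exact: torus_pi_open | exists u].
exact: image_subset.
Qed.

Lemma torus_add_continuous : continuous (fun p : T * T => p.1 + p.2).
Proof.
move=> [s t] W /=; rewrite -[s]reprK -[t]reprK.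
set u := repr s; set v := repr t.
rewrite -torus_piD => nW.
have nuv : nbhs (u + v) (\pi_T @^-1` W) by exact: (pi_continuous nW).
have [[A B] /= [nA nB] AB] :=
  @add_continuous 'rV[R]_n (u, v) _ nuv.
exists (\pi_T @` A, \pi_T @` B); first by split; exact: torus_pi_nbhs.
move=> [_ _] /= [[a Aa <-] [b Bb <-]]; rewrite -torus_piD.
exact: (AB (a, b)).
Qed.
End Torus.

(* C^n as the real normed space R^n * R^n of real and imaginary parts. *)
Definition Cn (R : realType) (n : nat) : normedModType R :=
  ('rV[R]_n * 'rV[R]_n)%type.

(* The standard action t . z = (exp(2 i pi t_j) z_j)_j; the choice of the
   representative of t in R^n is irrelevant. *)
Definition std_act (R : realType) (n : nat) (t : torus R n) (z : Cn R n) :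
    Cn R n :=
  let th j := 2 * pi * (repr t : 'rV[R]_n) 0 j in
  (\row_j (cos (th j) * z.1 0 j - sin (th j) * z.2 0 j),
   \row_j (sin (th j) * z.1 0 j + cos (th j) * z.2 0 j)).

(* Automorphisms of T^n as a topological (equivalently, Lie) group. *)
Definition torus_aut (R : realType) (n : nat) (psi : torus R n -> torus R n) :
    Prop :=
  {morph psi : s t / s + t} /\ homeo psi.

Record tspace (R : realType) (n : nat) := TSpace {
  tcarrier :> topologicalType;
  tact : torus R n -> tcarrier -> tcarrier;
  tact_continuous : continuous (fun p : torus R n * tcarrier => tact p.1 p.2);
  tact0 : forall x, tact 0 x = x;
  tactD : forall s t x, tact (s + t) x = tact s (tact t x)
}.

Definition weq_homeomorphic (R : realType) (n : nat) (X Y : tspace R n) : Prop :=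
  exists (f : X -> Y) (psi : torus R n -> torus R n),
    [/\ homeo f, torus_aut psi &
      forall t x, f (tact t x) = tact (psi t) (f x)].

(* The type tspace R n is too large for the universe of the library's set, so
   sets of T^n-spaces and sets of classes are bare predicates. *)
Definition weh_class (R : realType) (n : nat) (X : tspace R n) :
  tspace R n -> Prop := fun Y => weq_homeomorphic X Y.

Section OrbitSpace.
Variables (R : realType) (n : nat) (X : tspace R n).

Definition orbit_rel (x y : X) : bool := `[< exists t, y = tact t x >].

Lemma orbit_rel_equiv : equiv_class_of orbit_rel.
Proof.
split=> [x|x y|y x z]; first by apply/asboolP; exists 0; rewrite tact0.
  apply/asboolP/asboolP => -[t ->]; exists (- t); rewrite -tactD addNr tact0 //.
move=> /asboolP[s ->] /asboolP[t ->]; apply/asboolP.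
by exists (t + s); rewrite tactD.
Qed.

Canonical orbit_rel_equivRel := EquivRelPack orbit_rel_equiv.

Definition orbit_space : Type := quotient_topology {eq_quot orbit_rel}.

HB.instance Definition _ := Topological.on orbit_space.
HB.instance Definition _ := Quotient.on orbit_space.
End OrbitSpace.

(* A chart of a 2n-manifold, with model space C^n. *)
Record chart (R : realType) (n : nat) (M : topologicalType) := Chart {
  chart_dom : set M;
  chart_map :> M -> Cn R n;
  chart_inv : Cn R n -> M;
  chart_dom_open : open chart_dom;
  chart_img_open : open (chart_map @` chart_dom);
  chart_mapK : {in chart_dom, cancel chart_map chart_inv};
  chart_map_continuous :
    forall x, chart_dom x -> {for x, continuous chart_map};
  chart_inv_continuous :
    forall z, (chart_map @` chart_dom) z -> {for z, continuous chart_inv}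
}.

Definition chart_img (R : realType) (n : nat) (M : topologicalType)
  (c : chart R n M) : set (Cn R n) := c @` chart_dom c.

Definition compatible (R : realType) (n : nat) (M : topologicalType)
    (c d : chart R n M) : Prop :=
  smooth (d \o chart_inv c) (c @` (chart_dom c `&` chart_dom d)) /\
  smooth (c \o chart_inv d) (d @` (chart_dom c `&` chart_dom d)).

Definition smooth_atlas (R : realType) (n : nat) (M : topologicalType)
    (A : set (chart R n M)) : Prop :=
  (forall x, exists2 c, A c & chart_dom c x) /\
  (forall c d, A c -> A d -> compatible c d).

(* The action map T^n * X -> X is smooth: it is read in charts of X and in the
   local inverses of the covering R^n -> T^n, which are the charts of T^n. *)
Definition smooth_action (R : realType) (n : nat) (X : tspace R n)
    (A : set (chart R n X)) : Prop :=
  forall c d, A c -> A d ->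
    smooth (fun p : 'rV[R]_n * Cn R n =>
              d (tact (\pi_(torus R n) p.1) (chart_inv c p.2)))
           [set p | chart_img c p.2 /\
              chart_dom d (tact (\pi_(torus R n) p.1) (chart_inv c p.2))].

(* A weakly equivariant diffeomorphism from a T^n-invariant open subset of X
   onto a T^n-invariant open subset of C^n with the standard action. *)
Definition standard_chart (R : realType) (n : nat) (X : tspace R n)
    (A : set (chart R n X)) (c : chart R n X) : Prop :=
  [/\ forall t x, chart_dom c x -> chart_dom c (tact t x),
      forall t z, chart_img c z -> chart_img c (std_act t z),
      forall d, A d -> compatible c d &
      exists2 psi, torus_aut psi &
        forall t x, chart_dom c x -> c (tact t x) = std_act (psi t) (c x)].

Definition locally_standard (R : realType) (n : nat) (X : tspace R n)
    (A : set (chart R n X)) : Prop :=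
  forall x, exists2 c, standard_chart A c & chart_dom c x.

Definition cube (R : realType) (n : nat) : set 'rV[R]_n :=
  [set q | forall j, 0 <= q 0 j <= 1].
Arguments cube : clear implicits.

(* The facets x_i = 0 come first, followed by the facets x_i = 1. *)
Definition facet (R : realType) (n : nat) (k : 'I_(n + n)) (q : 'rV[R]_n) :
    bool :=
  match fintype.split k with
  | inl i => q 0 i == 0
  | inr i => q 0 i == 1
  end.

Definition cube_depth (R : realType) (n : nat) (q : 'rV[R]_n) : nat :=
  #|[pred k : 'I_(n + n) | facet k q]|.

(* C^n / T^n is the orthant [0, +oo)^n through z |-> (|z_j|)_j; this is the
   depth there of the orbit of z. *)
Definition Cn_depth (R : realType) (n : nat) (z : Cn R n) : nat :=
  #|[pred j : 'I_n | (z.1 0 j == 0) && (z.2 0 j == 0)]|.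

Record quasitoric (R : realType) (n : nat) := Quasitoric {
  qt_space :> tspace R n;
  qt_hausdorff : hausdorff_space qt_space;
  qt_second_countable : @second_countable qt_space;
  qt_atlas : set (chart R n qt_space);
  qt_smooth_atlas : smooth_atlas qt_atlas;
  qt_smooth_action : smooth_action qt_atlas;
  qt_locally_standard : locally_standard qt_atlas;
  qt_proj : qt_space -> cube R n;
  qt_proj_continuous : continuous qt_proj;
  qt_proj_surj : forall q, exists x, qt_proj x = q;
  qt_proj_homeo : exists2 h : orbit_space qt_space -> cube R n,
    homeo h & forall x, h (\pi_(orbit_space qt_space) x) = qt_proj x;
  (* The charts of the manifold with corners M / T^n are those induced by the
     standard charts of M. *)
  qt_proj_depth : forall c, standard_chart qt_atlas c ->
    forall x, chart_dom c x ->
      Cn_depth (c x) = cube_depth (set_val (qt_proj x))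
}.

Definition Mweh (R : realType) (n : nat) : (tspace R n -> Prop) -> Prop :=
  fun C => exists M : quasitoric R n, C = weh_class M.
Arguments Mweh : clear implicits.

Definition char_mx (n : nat) (xi : 'M[int]_n) : 'M[int]_(n, n + n) :=
  row_mx 1%:M xi.

(* n distinct facets of I^n with a common point meet at a vertex. *)
Definition char_square (R : realType) (n : nat) : set 'M[int]_n :=
  [set xi : 'M[int]_n | (forall i, xi i i = 1) /\
    forall f : 'I_n -> 'I_(n + n), injective f ->
      (exists2 q, cube R n q & forall j, facet (f j) q) ->
      \det (colsub f (char_mx xi)) = 1 \/ \det (colsub f (char_mx xi)) = -1].
Arguments char_square : clear implicits.

Section CharSquareManifold.
Variables (R : realType) (n : nat) (xi : 'M[int]_n).
Local Notation T := (torus R n).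

(* The homomorphism T^k -> T^n given by the columns of the k facets through q
   is covered by the linear map R^k -> R^n with the same matrix. *)
Definition subtorus (q : 'rV[R]_n) : set T :=
  [set t | exists s : 'I_(n + n) -> R,
     t = \pi_T (\sum_(k | facet k q)
                  s k *: \row_i (char_mx xi i k)%:~R)].

(* t1 t2^-1 is t1 - t2 in additive notation. *)
Definition qt_rel (p1 p2 : T * cube R n) : bool :=
  `[< p1.2 = p2.2 /\ subtorus (set_val p1.2) (p1.1 - p2.1) >].

Lemma subtorus0 q : subtorus q 0.
Proof.
exists (fun=> 0); rewrite big1 => [|k _]; last by rewrite scale0r.
by apply: (addrI (\pi_T 0)); rewrite -torus_piD !addr0.
Qed.

Lemma subtorusB q s t : subtorus q s -> subtorus q t -> subtorus q (s - t).
Proof.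
move=> [a ->] [b ->]; exists (fun k => a k - b k).
apply: (canLR (addrK _)); rewrite -torus_piD -big_split /=; congr (\pi_T _).
by apply: eq_bigr => k _; rewrite -scalerDl subrK.
Qed.

Lemma subtorusN q t : subtorus q t -> subtorus q (- t).
Proof. by move=> ?; rewrite -sub0r; apply: subtorusB (subtorus0 q) _. Qed.

Lemma subtorusD q s t : subtorus q s -> subtorus q t -> subtorus q (s + t).
Proof.
by move=> ? ?; rewrite -[t]opprK; apply: subtorusB => //; exact: subtorusN.
Qed.

Lemma qt_rel_equiv : equiv_class_of qt_rel.
Proof.
have sym p1 p2 : qt_rel p1 p2 -> qt_rel p2 p1.
  move=> /asboolP[e h]; apply/asboolP; split=> //.
  by rewrite -e -opprB; exact: subtorusN.
split=> [p|p1 p2|p2 p1 p3].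
- by apply/asboolP; split=> //; rewrite subrr; exact: subtorus0.
- by apply/idP/idP; exact: sym.
- move=> /asboolP[e1 h1] /asboolP[e2 h2]; apply/asboolP.
  split; first by rewrite e1.
  have -> : p1.1 - p3.1 = (p1.1 - p2.1) + (p2.1 - p3.1) by rewrite addrA subrK.
  by apply: subtorusD => //; rewrite e1.
Qed.

Canonical qt_rel_equivRel := EquivRelPack qt_rel_equiv.

Definition qt_model : Type := quotient_topology {eq_quot qt_rel}.

HB.instance Definition _ := Topological.on qt_model.
HB.instance Definition _ := Quotient.on qt_model.

Definition qt_model_act (t : T) (x : qt_model) : qt_model :=
  \pi_qt_model (t + (repr x).1, (repr x).2).

Lemma qt_model_actE t (s : T) (q : cube R n) :
  qt_model_act t (\pi_qt_model (s, q)) = \pi_qt_model (t + s, q).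
Proof.
rewrite /qt_model_act; case: piP => -[s' q'] /= /eqmodP /asboolP[/= <- h].
apply/eqmodP/asboolP; split=> //=.
by rewrite opprD addrACA subrr add0r -opprB; exact: subtorusN.
Qed.

Lemma qt_model_act0 x : qt_model_act 0 x = x.
Proof.
by rewrite -[x]reprK; case: (repr x) => s q; rewrite qt_model_actE add0r.
Qed.

Lemma qt_model_actD s t x :
  qt_model_act (s + t) x = qt_model_act s (qt_model_act t x).
Proof.
rewrite -[x]reprK; case: (repr x) => r q.
rewrite (qt_model_actE t) (qt_model_actE s) (qt_model_actE (s + t)).
exact: (congr1 (fun u => \pi_qt_model (u, q)) (esym (addrA s t r))).
Qed.

Lemma qt_model_act_continuous :
  continuous (fun p : T * qt_model => qt_model_act p.1 p.2).
Proof.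
move=> [t x] W0; rewrite nbhsE => -[W [oW Wtx] WW0].
suff : nbhs (t, x) [set p : T * qt_model | W (qt_model_act p.1 p.2)].
  by apply: filterS => p /WW0.
pose g (p : 'rV[R]_n * (T * cube R n)) : qt_model :=
  qt_model_act (\pi_T p.1) (\pi_qt_model p.2).
have g_cont : continuous g.
  have -> : g = (\pi_qt_model : T * cube R n -> qt_model) \o
      (fun p => (\pi_T p.1 + p.2.1, p.2.2)).
    by apply/funext => -[v [s q]]; rewrite /g /= qt_model_actE.
  have c1 : continuous (fun p : 'rV[R]_n * (T * cube R n) => \pi_T p.1).
    move=> p; apply: (@continuous_comp _ _ _ fst (\pi_T)); first exact: cvg_fst.
    exact: pi_continuous.
  have c2 : continuous (fun p : 'rV[R]_n * (T * cube R n) => p.2.1).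
    by move=> p; apply: (@continuous_comp _ _ _ snd fst);
      [exact: cvg_snd | exact: cvg_fst].
  have c3 : continuous (fun p : 'rV[R]_n * (T * cube R n) => p.2.2).
    by move=> p; apply: (@continuous_comp _ _ _ snd snd); exact: cvg_snd.
  have c4 : continuous
      (fun p : 'rV[R]_n * (T * cube R n) => \pi_T p.1 + p.2.1).
    move=> p; apply: (@continuous_comp _ _ _ (fun p => (\pi_T p.1, p.2.1))
                        (fun p : T * T => p.1 + p.2)).
      exact: (cvg_pair (c1 p) (c2 p)).
    exact: torus_add_continuous.
  move=> p; apply: continuous_comp; last exact: pi_continuous.
  exact: (cvg_pair (c4 p) (c3 p)).
have gW p : W (g p) -> nbhs p (g @^-1` W).
  by move=> Wp; apply: g_cont; exact: open_nbhs_nbhs.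
have [K [cK nK KW]] : exists K, [/\ compact K, nbhs (repr t : 'rV[R]_n) K &
    forall v, K v -> W (g (v, repr x))].
  have Wg : W (g (repr t : 'rV[R]_n, repr x)) by rewrite /g /= !reprK.
  have [[A B] /= [nA nB] AB] := gW _ Wg.
  have [K [cK nK KA]] := rV_nbhs_compact nA.
  exists K; split=> // v Kv; apply: (AB (v, repr x)); split; first exact: KA.
  exact: nbhs_singleton.
pose V : set qt_model :=
  [set y | K `<=` [set v | W (qt_model_act (\pi_T v) y)]].
have oV : open V.
  rewrite /open /= /quotient_open openE => z Vz; rewrite /interior.
  move/compact_near_coveringP : cK => /(_ _ (nbhs z)
    (fun z v => W (g (v, z)))); apply => v Kv.
  have [[A B] /= [nA nB] AB] := gW (v, z) (Vz v Kv).
  by exists (A, B).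
exists (\pi_T @` K, V); first split => /=.
- by rewrite -[t]reprK; exact: torus_pi_nbhs.
- by apply: open_nbhs_nbhs; split=> // v /KW; rewrite /g /= reprK.
- by move=> [_ y] /= [[v Kv <-] Vy]; exact: Vy.
Qed.

Definition qt_of_square : tspace R n :=
  TSpace qt_model_act_continuous qt_model_act0 qt_model_actD.
End CharSquareManifold.

Definition phi (R : realType) (n : nat) (xi : 'M[int]_n) :
    tspace R n -> Prop :=
  weh_class (qt_of_square R xi).
Arguments phi : clear implicits.

Definition mx3 (s : seq (seq int)) : 'M[int]_3 :=
  \matrix_(i, j) nth 0 (nth [::] s i) j.

Definition A1 : set 'M[int]_3 :=
  [set xi | exists x1 x2 x3 : int,
    xi = mx3 [:: [:: 1; x1; x2]; [:: 0; 1; x3]; [:: 0; 0; 1]]].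

Definition A2 : set 'M[int]_3 :=
  [set xi | exists s t : int,
    xi = mx3 [:: [:: 1; s; t]; [:: 0; 1; 2]; [:: 0; 1; 1]]].

Definition A3 : set 'M[int]_3 :=
  [set xi | exists s t : int,
    xi = mx3 [:: [:: 1; 0; 0]; [:: s; 1; 2]; [:: t; 1; 1]]].

Definition chi1 := mx3 [:: [:: 1; 0; 2]; [:: 1; 1; 2]; [:: 0; 1; 1]].
Definition chi5 := mx3 [:: [:: 1; 2; 1]; [:: 0; 1; 1]; [:: 2; 2; 1]].
Definition chi6 := mx3 [:: [:: 1; 1; 1]; [:: 0; 1; 2]; [:: 2; 1; 1]].
Definition chi10 := mx3 [:: [:: 1; 2; 2]; [:: 0; 1; 2]; [:: 1; 1; 1]].

(* Main.v *)
From HB Require Import structures.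
Require Import Defs.
From mathcomp Require Import all_boot all_order all_algebra.
From mathcomp Require Import all_classical all_reals all_analysis.
From mathcomp Require Import ring lra zify perm.

(** The statement has two halves.

    Every listed square gives a quasitoric manifold. Around a vertex v of the
    cube the matrix of the n characteristic vectors of the facets through v is
    invertible over Z, so it identifies the part of M(xi) lying over the points
    away from the facets that miss v with C^n: the torus coordinate becomes the
    arguments, and the height h in [0, 1[ over each facet through v becomes the
    modulus sqrt(h / (1 - h)) ([vchart], [vinv]). Passing to the opposite facet
    replaces h by 1 - h, that is, the modulus r by 1 / r, and twists the
    arguments by integer combinations; both operations are smooth away from the
    zeros of the coordinates involved ([smooth_transition]). The depth of a
    point in a standard chart is the rank of its isotropy group, so it is the
    same in all standard charts ([standard_charts_depth]).

    Conversely, let M be quasitoric over the cube. The argument is the classical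
    one of Davis and Januszkiewicz. Automorphisms of the torus are unimodular
    integer matrices ([torus_aut_tlin]), so a standard chart shows that near an
    orbit the isotropy groups are the subtori spanned by part of a basis of
    Z^n ([local_model]). They are constant over the interior of a facet by
    connectedness, which attaches to each facet a primitive vector, and these
    vectors form a basis at each vertex ([characteristic_vectors]). The orbit
    map has a continuous section, because sections given locally by charts can
    be glued along hyperplanes ([transversal_glue], [continuous_section]).
    Spreading the section by the torus identifies M with the model built from
    its characteristic vectors ([recognition]); symmetries of the cube, changes
    of basis of Z^n and signs of the vectors do not affect the class.

    What remains is the classification, up to these operations, of the 6 x 3
    integer matrices that are unimodular at the vertices. A basis at one vertex
    normalises the matrix to a square with unit diagonal, all of whose principal
    minors are 1 or -1. If some row or column of it has no nonzero entry off the
    diagonal, a permutation and signs lead to one of the three infinite families.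
    Otherwise the determinant bounds every entry by 4 ([mixing_small]), and a
    finite search through permutations, signs and changes of base vertex reaches
    a listed square in each case ([small_reducible]). *)

Set Implicit Arguments.
Unset Strict Implicit.
Unset Printing Implicit Defensive.

Import Order.TTheory GRing.Theory Num.Theory.
Import numFieldNormedType.Exports.

Local Open Scope classical_set_scope.
Local Open Scope quotient_scope.
Local Open Scope ring_scope.

(** * Topological preliminaries *)

Lemma coincidence_closed (X Y : topologicalType) (f g : X -> Y) :
  hausdorff_space Y -> continuous f -> continuous g ->
  closed [set x | f x = g x].
Proof.
move=> hY cf cg x clx; apply: hY => A B nA nB.
have nx : nbhs x (f @^-1` A `&` g @^-1` B).
  by apply: filterI; [exact: cf | exact: cg].
have [y [/= yE [Ay By]]] := clx _ nx.
by exists (f y); split=> //; rewrite yE.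
Qed.

(** A continuous map on a compact set is closed, so its inverse is continuous
    wherever the image is a neighbourhood. It supplies the continuity of the
    inverse maps built below by choice. *)
Lemma compact_cancel_continuous (X Y : topologicalType) (K : set X)
    (c : X -> Y) (d : Y -> X) (z : Y) :
  hausdorff_space Y -> compact K -> {within K, continuous c} ->
  (forall x, K x -> d (c x) = x) -> nbhs z (c @` K) -> {for z, continuous d}.
Proof.
move=> hY cK cc dc nz W0; rewrite nbhsE => -[W [oW Wz] WW0].
have cKW : compact (c @` (K `&` ~` W)).
  apply: continuous_compact; last exact: compact_closedI cK (open_closedC oW).
  exact: continuous_subspaceW cc.
have nKW : nbhs z (~` (c @` (K `&` ~` W))).
  apply: open_nbhs_nbhs; split; first exact/closed_openC/(compact_closed hY).
  by move=> [x [Kx Wx] xz]; apply: Wx; rewrite -(dc _ Kx) xz.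
suff : nbhs z (d @^-1` W0) by [].
apply: filterS (filterI nz nKW) => y [[x Kx xy] ny]; apply: WW0.
rewrite -xy dc //; apply: contrapT => nWx; apply: ny; exists x => //.
Qed.

Lemma comp_continuous (X Y Z : topologicalType) (f : X -> Y) (g : Y -> Z) :
  continuous f -> continuous g -> continuous (g \o f).
Proof. by move=> cf cg x; apply: continuous_comp; [exact: cf | exact: cg]. Qed.

Lemma near_forall (X : topologicalType) (I : finType) (P : I -> X -> Prop)
    (x : X) :
  (forall i, \forall y \near x, P i y) -> \forall y \near x, forall i, P i y.
Proof. by move=> h; apply: filter_forall. Qed.

Lemma continuous_row (R : realType) (n : nat) (X : topologicalType)
    (f : X -> 'rV[R]_n) (x : X) :
  (forall j, {for x, continuous (fun y => f y 0 j)}) -> {for x, continuous f}.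
Proof.
move=> cf; apply/cvg_ballP => e e0.
have : \forall y \near x, forall j, ball (f x 0 j) e (f y 0 j).
  apply: filter_forall => j; have /cvg_ballP := cf j; exact.
apply: filterS => y yB; split=> // i j; rewrite ord1; exact: yB.
Qed.

Lemma continuous_mkrow (R : realType) (n : nat) (X : topologicalType)
    (f : 'I_n -> X -> R) (x : X) :
  (forall j, {for x, continuous (f j)}) ->
  {for x, continuous (fun y => (\row_j f j y : 'rV[R]_n))}.
Proof.
move=> cf; apply: continuous_row => j.
have -> : (fun y => (\row_j f j y : 'rV[R]_n) 0 j) = f j.
  by apply/funext => y; rewrite mxE.
exact: cf.
Qed.

Lemma continuous_pair (X Y Z : topologicalType) (f : X -> Y) (g : X -> Z) x :
  {for x, continuous f} -> {for x, continuous g} ->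
  {for x, continuous (fun y => (f y, g y))}.
Proof. by move=> cf cg; exact: (cvg_pair cf cg). Qed.

Lemma continuous_sum (R : realType) (I : Type) (s : seq I) (X : topologicalType)
    (f : I -> X -> R) x :
  (forall k, {for x, continuous (f k)}) ->
  {for x, continuous (fun y => \sum_(k <- s) f k y)}.
Proof.
move=> cf; apply: cvg_big => [|k _]; first exact: add_continuous.
exact: cf.
Qed.

Lemma coord_row_continuous (R : realType) (n : nat) (j : 'I_n) :
  continuous (fun v : 'rV[R]_n => v 0 j).
Proof. exact: coord_continuous. Qed.

(** Connectedness of [0, 1], in the form used for propagation: a property that
    is locally constant along the segment passes from one end to the other. *)
Lemma locally_constant_segment (R : realType) (B : R -> Prop) :
  (forall s : R, 0 <= s <= 1 -> exists2 e : R, 0 < e &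
     forall s' : R, 0 <= s' <= 1 -> `|s' - s| < e -> (B s <-> B s')) ->
  B 0 -> B 1.
Proof.
move=> lB B0; pose I := [set s : R | 0 <= s <= 1].
have /choice[e eP] : forall s, exists e, I s -> 0 < e /\
   forall s', I s' -> `|s' - s| < e -> (B s <-> B s').
  move=> s; have [Is|nIs] := pselect (I s); last by exists 0.
  by have [e e0 he] := lB s Is; exists e.
have cI : connected I.
  apply/connected_intervalP => a b /andP[a0 _] /andP[_ b1] c /andP[ac cb].
  by rewrite /I /=; apply/andP; split; [exact: le_trans ac|exact: le_trans b1].
pose O P := \bigcup_(s in [set s | I s /\ P s]) ball s (e s).
have oO P : open (O P).
  by apply: bigcup_open => s [Is _]; apply: ball_open; have [] := eP s Is.
have I01 : I 0 /\ I 1 by rewrite /I /= lexx ler01 lexx.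
have IO P s : I s -> P s -> O P s.
  by move=> Is Ps; exists s => //; apply: ballxx; have [] := eP s Is.
suff : I `&` B = I by move=> /seteqP[_ /(_ 1 I01.2)[]].
apply: cI; first by exists 0; split=> //; exact: I01.1.
- exists (O B) => //; apply/seteqP; split=> [s [Is Bs]|s [Is [s' [Is' Bs']]]].
    by split=> //; exact: IO.
  move=> b; split=> //; apply/((eP s' Is').2 _ Is) => //.
  by move: b; rewrite /ball /= distrC.
- exists (~` O (fun s => ~ B s)); first exact: open_closedC.
  apply/seteqP; split=> [s [Is Bs]|s [Is nO]].
    split=> // -[s' [Is' Bs']] b; apply: Bs'; apply/((eP s' Is').2 _ Is) => //.
    by move: b; rewrite /ball /= distrC.
  by split=> //; apply: contrapT => nB; apply: nO; exact: IO.
Qed.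

(** * The torus as a topological group *)

Section TorusTopology.
Variables (R : realType) (n : nat).
Local Notation T := (torus R n).
Local Notation piT := (\pi_(torus R n)).

(** The product of the projection onto the torus with an identity map is again
    a quotient map, because the projection is open. *)
Lemma torus_prod_continuous (X Y : topologicalType) (f : T * X -> Y) :
  continuous (fun p : 'rV[R]_n * X => f (piT p.1, p.2)) -> continuous f.
Proof.
move=> cf [t x] W; rewrite -[t]reprK => nW.
have [[A B] /= [nA nB] AB] := cf (repr t : 'rV[R]_n, x) _ nW.
exists (piT @` A, B); first by split=> //; exact: torus_pi_nbhs.
by move=> [_ y] /= [[a Aa <-] By]; exact: (AB (a, y)).
Qed.

Lemma torus_piN (u : 'rV[R]_n) : piT (- u) = - piT u.
Proof.
apply: (addrI (piT u)); rewrite -torus_piD !subrr; apply: (addIr (piT u)).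
by rewrite -torus_piD !add0r.
Qed.

Lemma torus_piB : {morph piT : u v / u - v}.
Proof. by move=> u v; rewrite torus_piD torus_piN. Qed.

Lemma torus_pi0 : piT 0 = 0.
Proof. by rewrite -(subrr (0 : 'rV_n)) torus_piB subrr. Qed.

Lemma torus_pi_int (u : 'rV[R]_n) :
  piT u = 0 <-> forall j, u 0 j \is a Num.int.
Proof.
rewrite -torus_pi0 torus_pi_eq subr0; split=> [/mxOverP h j|h]; first exact: h.
by apply/mxOverP => i j; rewrite ord1.
Qed.

Lemma torus_compact : compact [set: T].
Proof.
have -> : [set: T] = piT @` [set v : 'rV[R]_n | forall j, `[0, 1]%classic (v 0 j)].
  apply/seteqP; split=> // t _; rewrite -[t]reprK; set u := repr t.
  exists (\row_j (u 0 j - (Num.floor (u 0 j))%:~R)).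
    move=> j; rewrite mxE /= in_itv /= subr_ge0 floor_le_tmp.
    by rewrite lerBlDl ltW // -(intrD1) floorD1_gt.
  rewrite [RHS]reprK -[RHS]reprK.
  apply/torus_pi_eq/mxOverP => i j; rewrite !mxE ord1 addrAC subrr sub0r.
  by rewrite rpredN; exact: intr_int.
apply: continuous_compact; first exact/continuous_subspaceT/pi_continuous.
exact: (@rV_compact R n (fun _ => `[0, 1]%classic) (fun _ => @segment_compact R 0 1)).
Qed.
End TorusTopology.

(** * Integer matrices as homomorphisms of tori *)

Definition realmx (R : realType) (m n : nat) (A : 'M[int]_(m, n)) :
  'M[R]_(m, n) := map_mx intr A.

Definition tlin (R : realType) (m n : nat) (A : 'M[int]_(m, n))
  (t : torus R m) : torus R n := \pi_(torus R n) (repr t *m realmx R A).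

Section TorusLinear.
Variable R : realType.

Lemma realmx_mul (m n p : nat) (A : 'M[int]_(m, n)) (B : 'M[int]_(n, p)) :
  realmx R (A *m B) = realmx R A *m realmx R B.
Proof. exact: map_mxM. Qed.

Lemma realmx1 (n : nat) : realmx R (1%:M : 'M[int]_n) = 1%:M.
Proof. exact: map_mx1. Qed.

Lemma int_mul_realmx (m n : nat) (A : 'M[int]_(m, n)) (u : 'rV[R]_m) :
  (forall j, u 0 j \is a Num.int) ->
  forall j, (u *m realmx R A) 0 j \is a Num.int.
Proof.
move=> hu j; rewrite mxE; apply: rpred_sum => k _; rewrite !mxE.
by apply: rpredM => //; exact: intr_int.
Qed.

Lemma tlinE (m n : nat) (A : 'M[int]_(m, n)) (u : 'rV[R]_m) :
  tlin A (\pi_(torus R m) u) = \pi_(torus R n) (u *m realmx R A).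
Proof.
apply: subr0_eq; rewrite /tlin -torus_piB -mulmxBl; apply/torus_pi_int/int_mul_realmx.
by apply/torus_pi_int; rewrite torus_piB reprK subrr.
Qed.

Lemma tlinD (m n : nat) (A : 'M[int]_(m, n)) :
  {morph @tlin R m n A : s t / s + t}.
Proof.
move=> s t; rewrite -[s]reprK -[t]reprK -torus_piD !tlinE.
by rewrite mulmxDl torus_piD.
Qed.

Lemma tlinN (m n : nat) (A : 'M[int]_(m, n)) :
  {morph @tlin R m n A : s / - s}.
Proof. by move=> s; rewrite -[s]reprK -torus_piN !tlinE mulNmx torus_piN. Qed.

Lemma tlinB (m n : nat) (A : 'M[int]_(m, n)) :
  {morph @tlin R m n A : s t / s - t}.
Proof. by move=> s t; rewrite tlinD tlinN. Qed.

Lemma tlin_comp (m n p : nat) (A : 'M[int]_(m, n)) (B : 'M[int]_(n, p)) t :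
  tlin (R := R) (A *m B) t = tlin B (tlin A t).
Proof. rewrite -[t]reprK; set u := repr t.
by rewrite (tlinE A) (tlinE B) (tlinE (A *m B)) realmx_mul mulmxA. Qed.

Lemma tlin1 (n : nat) (t : torus R n) : tlin 1%:M t = t.
Proof. by rewrite -[t]reprK tlinE realmx1 mulmx1. Qed.

Lemma mulmx_continuous (m n : nat) (A : 'M[R]_(m, n)) :
  continuous (fun u : 'rV[R]_m => u *m A).
Proof.
have -> : (fun u : 'rV[R]_m => u *m A) =
          (fun u : 'rV[R]_m => \row_j \sum_k u 0 k * A k j).
  by apply/funext => u; apply/rowP => j; rewrite !mxE.
move=> u; apply: continuous_mkrow => j.
have cM k : {for u, continuous (fun y : 'rV[R]_m => y 0 k * A k j)}.
  have c := @coord_row_continuous R m k u; exact: (cvgM c (cvg_cst _)).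
exact: (continuous_sum cM).
Qed.

Lemma tlin_continuous (m n : nat) (A : 'M[int]_(m, n)) :
  continuous (@tlin R m n A).
Proof.
apply/quotient_continuous.
have -> : tlin A \o \pi_(torus R m) =
          \pi_(torus R n) \o (fun u => u *m realmx R A).
  by apply/funext => u; rewrite /= tlinE.
move=> u; apply: continuous_comp; first exact: mulmx_continuous.
exact: pi_continuous.
Qed.

Lemma tlin_aut (n : nat) (A : 'M[int]_n) :
  A \in unitmx -> torus_aut (@tlin R n n A).
Proof.
move=> uA; split; first exact: tlinD.
split; first exact: tlin_continuous.
exists (tlin (invmx A)); split; first exact: tlin_continuous.
  by move=> t; rewrite -tlin_comp mulmxV // tlin1.
by move=> t; rewrite -tlin_comp mulVmx // tlin1.
Qed.
End TorusLinear.

(** * The standard action on C^n *)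

Section Phase.
Variable R : realType.
Implicit Types x y : R.

Lemma phase_nat (f : R -> R) : periodic f (pi *+ 2) ->
  forall x (m : nat), f (2 * pi * (x + m%:R)) = f (2 * pi * x).
Proof.
move=> pf x; elim=> [|m IH]; first by rewrite addr0.
have -> : 2 * pi * (x + m.+1%:R) = 2 * pi * (x + m%:R) + (pi *+ 2 : R).
  by rewrite -natr1 -mulr_natl; ring.
by rewrite pf.
Qed.

Lemma phase_int (f : R -> R) : periodic f (pi *+ 2) ->
  forall x k, k \is a Num.int -> f (2 * pi * (x + k)) = f (2 * pi * x).
Proof.
move=> pf x k /intrP[[m|m] ->]; first exact: phase_nat.
by rewrite -[LHS](phase_nat pf _ m.+1) NegzE mulrNz subrK.
Qed.

(** By periodicity the angle can be taken in [0, 1[ turns, and cos (2 a) = 1 -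
    2 sin^2 a with sin positive on ]0, pi[. *)
Lemma phase_eq1 x : cos (2 * pi * x) = 1 -> x \is a Num.int.
Proof.
set k : R := (Num.floor x)%:~R; pose y := x - k.
have ik : k \is a Num.int by exact: intr_int.
have -> : x = y + k by rewrite subrK.
rewrite (phase_int (@cosD2pi R)) // => cy.
have y0 : 0 <= y by rewrite subr_ge0 floor_le_tmp.
have y1 : y < 1 by rewrite ltrBlDl -intrD1 floorD1_gt.
have [->|ny0] := eqVneq y 0; first by rewrite add0r.
have : 0 < sin (pi * y).
  apply: sin_gt0_pi; rewrite mulr_gt0 ?pi_gt0 ?lt0r ?ny0 //=.
  by rewrite gtr_pMr // pi_gt0.
have : cos ((pi * y) *+ 2) = 1 by rewrite -cy; congr cos; rewrite -mulr_natl; ring.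
rewrite cos_mulr2n cos2sin2 => h.
have : sin (pi * y) ^+ 2 = 0 by move: h; set s := sin _ ^+ 2; lra.
by move=> /eqP; rewrite sqrf_eq0 => /eqP ->; rewrite ltxx.
Qed.

Lemma polar_coord x y : exists th,
  x = Num.sqrt (x ^+ 2 + y ^+ 2) * cos (2 * pi * th) /\
  y = Num.sqrt (x ^+ 2 + y ^+ 2) * sin (2 * pi * th).
Proof.
set r := Num.sqrt _.
have r2 : r ^+ 2 = x ^+ 2 + y ^+ 2 by rewrite sqr_sqrtr // addr_ge0 ?sqr_ge0.
have pi0 : pi != 0 :> R by rewrite gt_eqF ?pi_gt0.
have pi2 (a : R) : 2 * pi * (a / (2 * pi)) = a.
  by rewrite mulrC divfK // mulf_neq0.
have [r0|nr0] := eqVneq r 0.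
  exists 0; rewrite r0 !mul0r.
  have /eqP : x ^+ 2 + y ^+ 2 = 0 by rewrite -r2 r0 expr0n.
  rewrite paddr_eq0 ?sqr_ge0 // !sqrf_eq0 => /andP[/eqP -> /eqP ->] //.
have rgt0 : 0 < r by rewrite lt0r nr0 sqrtr_ge0.
have xr : -1 <= x / r <= 1.
  rewrite ler_pdivlMr // ler_pdivrMr // mulN1r mul1r -ler_norml.
  by rewrite -sqrtr_sqr ler_sqrt ?addr_ge0 ?sqr_ge0 // lerDl sqr_ge0.
have E : Num.sqrt (1 - (x / r) ^+ 2) = `|y| / r.
  have -> : 1 - (x / r) ^+ 2 = (y / r) ^+ 2.
    by rewrite !expr_div_n r2; field; rewrite -r2 expf_neq0.
  by rewrite sqrtr_sqr normrM normfV (gtr0_norm rgt0).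
have [y0|y0] := leP 0 y.
  exists (acos (x / r) / (2 * pi)); rewrite pi2 acosK; last exact: xr.
  rewrite sin_acos // E ger0_norm //; split; by field.
exists (- acos (x / r) / (2 * pi)); rewrite mulNr mulrN pi2 cosN sinN acosK; last exact: xr.
rewrite sin_acos // E ltr0_norm //; split; by field.
Qed.
End Phase.

Definition Cn_zero (R : realType) (n : nat) (z : Cn R n) (j : 'I_n) : bool :=
  (z.1 0 j == 0) && (z.2 0 j == 0).

Definition cabs (R : realType) (n : nat) (z : Cn R n) : 'rV[R]_n :=
  \row_j Num.sqrt (z.1 0 j ^+ 2 + z.2 0 j ^+ 2).

(** The points with real coordinates are a slice for the standard action: with
    nonnegative coordinates they meet every orbit once. *)
Definition realpt (R : realType) (n : nat) (r : 'rV[R]_n) : Cn R n := (r, 0).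

Section StandardAction.
Variables (R : realType) (n : nat).
Local Notation T := (torus R n).
Local Notation piT := (\pi_(torus R n)).
Implicit Types (s t : T) (u v r : 'rV[R]_n) (z w : Cn R n).

Lemma std_actE u z : std_act (piT u) z =
  (\row_j (cos (2 * pi * u 0 j) * z.1 0 j - sin (2 * pi * u 0 j) * z.2 0 j),
   \row_j (sin (2 * pi * u 0 j) * z.1 0 j + cos (2 * pi * u 0 j) * z.2 0 j)).
Proof.
rewrite /std_act; set v := repr _.
have E j : exists2 k : R, k \is a Num.int & v 0 j = u 0 j + k.
  exists ((v - u) 0 j); last by rewrite !mxE addrCA subrr addr0.
  apply: (torus_pi_int (v - u)).1; by rewrite torus_piB reprK subrr.
have Ec j : cos (2 * pi * v 0 j) = cos (2 * pi * u 0 j).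
  by have [k ik ->] := E j; rewrite (phase_int (@cosD2pi R)).
have Es j : sin (2 * pi * v 0 j) = sin (2 * pi * u 0 j).
  by have [k ik ->] := E j; rewrite (phase_int (@sinD2pi R)).
by congr pair; apply/rowP => j; rewrite !mxE Ec Es.
Qed.

Lemma std_act0 z : std_act 0 z = z.
Proof.
rewrite -torus_pi0 std_actE; case: z => x y /=; congr pair; apply/rowP => j.
  by rewrite !mxE mulr0 cos0 sin0 mul1r mul0r subr0.
by rewrite !mxE mulr0 cos0 sin0 mul1r mul0r add0r.
Qed.

Lemma std_actD s t z : std_act (s + t) z = std_act s (std_act t z).
Proof.
rewrite -[s]reprK -[t]reprK -torus_piD !std_actE /=.
by congr pair; apply/rowP => j; rewrite !mxE mulrDr cosD sinD; ring.
Qed.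

Lemma std_act_continuous : continuous (fun p : T * Cn R n => std_act p.1 p.2).
Proof.
apply: torus_prod_continuous => /=.
have -> : (fun p : 'rV[R]_n * Cn R n => std_act (piT p.1) p.2) = (fun p =>
  (\row_j (cos (2 * pi * p.1 0 j) * p.2.1 0 j -
           sin (2 * pi * p.1 0 j) * p.2.2 0 j),
   \row_j (sin (2 * pi * p.1 0 j) * p.2.1 0 j +
           cos (2 * pi * p.1 0 j) * p.2.2 0 j))).
  by apply/funext => -[u z]; rewrite std_actE.
have cc j : continuous (fun p : 'rV[R]_n * Cn R n => p.1 0 j).
  move=> p; apply: (@continuous_comp _ _ _ fst (fun v : 'rV[R]_n => v 0 j)).
    exact: cvg_fst.
  exact: coord_continuous.
have c1 j : continuous (fun p : 'rV[R]_n * Cn R n => p.2.1 0 j).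
  move=> p; apply: (@continuous_comp _ _ _ (fun p => p.2.1)
    (fun v : 'rV[R]_n => v 0 j)); last exact: coord_continuous.
  by apply: (@continuous_comp _ _ _ snd fst); [exact: cvg_snd | exact: cvg_fst].
have c2 j : continuous (fun p : 'rV[R]_n * Cn R n => p.2.2 0 j).
  move=> p; apply: (@continuous_comp _ _ _ (fun p => p.2.2)
    (fun v : 'rV[R]_n => v 0 j)); last exact: coord_continuous.
  by apply: (@continuous_comp _ _ _ snd snd); exact: cvg_snd.
have c3 j : continuous (fun p : 'rV[R]_n * Cn R n => 2 * pi * p.1 0 j).
  by move=> p; apply: cvgM; [exact: cvg_cst | exact: cc].
have c4 j : continuous (fun p : 'rV[R]_n * Cn R n => cos (2 * pi * p.1 0 j)).
  move=> p; apply: (@continuous_comp _ _ _ (fun p : 'rV[R]_n * Cn R n => 2 * pi * p.1 0 j) (@cos R)).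
    exact: c3.
  exact: continuous_cos.
have c5 j : continuous (fun p : 'rV[R]_n * Cn R n => sin (2 * pi * p.1 0 j)).
  move=> p; apply: (@continuous_comp _ _ _ (fun p : 'rV[R]_n * Cn R n => 2 * pi * p.1 0 j) (@sin R)).
    exact: c3.
  exact: continuous_sin.
move=> p; apply: continuous_pair; apply: continuous_mkrow => j.
  by apply: cvgB; apply: cvgM; [exact: c4|exact: c1|exact: c5|exact: c2].
by apply: cvgD; apply: cvgM; [exact: c5|exact: c1|exact: c4|exact: c2].
Qed.

(** The isotropy group of z is the coordinate subtorus of its vanishing
    coordinates. A rotation fixing a nonzero vector of the plane has cosine 1.
    *)
Lemma std_act_fix u z : std_act (piT u) z = z <->
  forall j, ~~ Cn_zero z j -> u 0 j \is a Num.int.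
Proof.
rewrite std_actE; case: z => x y /=; split=> [[/rowP hx /rowP hy] j|h].
  rewrite /Cn_zero /= => nz; apply: phase_eq1.
  move: (hx j) (hy j); rewrite !mxE.
  set c := cos _; set s := sin _ => h1 h2.
  have : (c - 1) * (x 0 j ^+ 2 + y 0 j ^+ 2) = 0.
    have -> : (c - 1) * (x 0 j ^+ 2 + y 0 j ^+ 2) =
      (c * x 0 j - s * y 0 j - x 0 j) * x 0 j +
      (s * x 0 j + c * y 0 j - y 0 j) * y 0 j by ring.
    by rewrite h1 h2 !subrr !mul0r addr0.
  move=> /eqP; rewrite mulf_eq0 subr_eq0 => /orP[/eqP //|].
  by rewrite paddr_eq0 ?sqr_ge0 // !sqrf_eq0 (negPf nz).
have E j : (cos (2 * pi * u 0 j) = 1 /\ sin (2 * pi * u 0 j) = 0) \/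
    (x 0 j = 0 /\ y 0 j = 0).
  have [/andP[/eqP -> /eqP ->]|nz] := boolP (Cn_zero (x, y) j); first by right.
  left; have ik := h j nz.
  rewrite -[u 0 j]add0r (phase_int (@cosD2pi R)) // (phase_int (@sinD2pi R)) //.
  by rewrite mulr0 cos0 sin0.
by congr pair; apply/rowP => j; rewrite !mxE;
  have [[-> ->]|[-> ->]] := E j; ring.
Qed.

Lemma cabs_ge0 z j : 0 <= cabs z 0 j.
Proof. by rewrite mxE sqrtr_ge0. Qed.

Lemma cabs_eq0 z j : (cabs z 0 j == 0) = Cn_zero z j.
Proof.
rewrite mxE sqrtr_eq0 /Cn_zero -(sqrf_eq0 (z.1 0 j)) -(sqrf_eq0 (z.2 0 j)).
by rewrite -paddr_eq0 ?sqr_ge0 // eq_le addr_ge0 ?sqr_ge0 // andbT.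
Qed.

Lemma cabs_act t z : cabs (std_act t z) = cabs z.
Proof.
apply/rowP => j; rewrite -[t]reprK std_actE !mxE /= ?mxE; congr Num.sqrt.
have := cos2Dsin2 (2 * pi * (repr t : 'rV[R]_n) 0 j).
set c := cos _; set s := sin _ => cs.
transitivity ((c ^+ 2 + s ^+ 2) * (z.1 0 j ^+ 2 + z.2 0 j ^+ 2)); first by ring.
by rewrite cs mul1r.
Qed.

Lemma cabs_realpt r : (forall j, 0 <= r 0 j) -> cabs (realpt r) = r.
Proof.
move=> r0; apply/rowP => j; rewrite !mxE /= ?mxE expr0n addr0 sqrtr_sqr.
by rewrite ger0_norm.
Qed.

Lemma polar z : exists t, z = std_act t (realpt (cabs z)).
Proof.
have /choice[th thP] : forall j, exists th,
   z.1 0 j = cabs z 0 j * cos (2 * pi * th) /\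
   z.2 0 j = cabs z 0 j * sin (2 * pi * th).
  by move=> j; rewrite mxE; exact: polar_coord.
exists (piT (\row_j th j)); rewrite std_actE.
case: z thP => x y /= thP; congr pair; apply/rowP => j;
  have [E1 E2] := thP j; rewrite mxE /realpt /= ?E1 ?E2 !mxE; ring.
Qed.

Lemma Cn_re_continuous j : continuous (fun z : Cn R n => z.1 0 j).
Proof.
apply: (@comp_continuous _ _ _ fst (fun v : 'rV[R]_n => v 0 j)).
  by move=> z; exact: cvg_fst.
exact: coord_row_continuous.
Qed.

Lemma Cn_im_continuous j : continuous (fun z : Cn R n => z.2 0 j).
Proof.
apply: (@comp_continuous _ _ _ snd (fun v : 'rV[R]_n => v 0 j)).
  by move=> z; exact: cvg_snd.
exact: coord_row_continuous.
Qed.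

Lemma cabs_continuous : continuous (@cabs R n).
Proof.
move=> z; apply: continuous_row => j.
have -> : (fun y => cabs y 0 j) =
   (fun y : Cn R n => Num.sqrt (y.1 0 j ^+ 2 + y.2 0 j ^+ 2)).
  by apply/funext => y; rewrite mxE.
have c1 := @Cn_re_continuous j; have c2 := @Cn_im_continuous j.
apply: (@continuous_comp _ _ _ (fun y : Cn R n => y.1 0 j ^+ 2 + y.2 0 j ^+ 2)
  Num.sqrt); last exact: sqrt_continuous.
by apply: cvgD; apply: cvgM; [exact: c1|exact: c1|exact: c2|exact: c2].
Qed.

Lemma realpt_continuous : continuous (@realpt R n).
Proof.
move=> r; apply: (@continuous_pair 'rV[R]_n 'rV[R]_n 'rV[R]_n id (fun _ => 0)).
  exact: cvg_id.
exact: cst_continuous.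
Qed.
End StandardAction.

(** * Automorphisms of the torus *)

Section TorusAut.
Variable R : realType.

Lemma int_small (x : R) : x \is a Num.int -> `|x| < 1 -> x = 0.
Proof.
move=> /intrP[m ->]; rewrite -intr_norm (_ : 1 = 1%:~R) // ltr_int => m1.
by have -> : m = 0 by lia.
Qed.

(** An additive function that vanishes at d takes opposite values at s and d -
    s, so it is bounded by its values on [0, d / 2], which are half of values
    on [0, d]: any bound can be halved. *)
Lemma additive_bounded_eq0 (d b : R) (g : R -> R) :
  (forall s t, 0 <= s -> 0 <= t -> s + t <= d -> g (s + t) = g s + g t) ->
  (forall s, 0 <= s <= d -> `|g s| <= b) -> g d = 0 ->
  forall s, 0 <= s <= d -> g s = 0.
Proof.
move=> gD gb gd0 s sd.
have H k : forall s, 0 <= s <= d -> `|g s| <= b / 2 ^+ k.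
  elim: k => [|k IH] {sd}s sd; first by rewrite expr0 divr1 gb.
  have E2 : b / 2 ^+ k.+1 = (b / 2 ^+ k) / 2.
    by rewrite exprS; field; rewrite expf_neq0.
  have half t : 0 <= t <= d / 2 -> `|g t| <= b / 2 ^+ k.+1.
    move=> td; have -> : g t = g (t + t) / 2 by rewrite gD; lra.
    rewrite normrM (ger0_norm (_ : 0 <= 2^-1)) ?invr_ge0 // E2.
    by rewrite ler_pM2r ?invr_gt0 // IH; lra.
  have [ls|ls] := leP s (d / 2); first by apply: half; lra.
  have -> : g s = - g (d - s).
    have : g ((d - s) + s) = g (d - s) + g s by apply: gD; lra.
    by rewrite subrK gd0; lra.
  by rewrite normrN; apply: half; lra.
apply/eqP; rewrite -normr_le0; apply/ler_addgt0Pr => e e0; rewrite add0r.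
have b0 : 0 <= b by apply: le_trans (gb _ sd).
pose k := Num.bound (b / e).
apply: le_trans (H k s sd) _.
rewrite ler_pdivrMr ?exprn_gt0 // mulrC -ler_pdivrMr //.
have /ltW h : b / e < k%:R.
  by have := archi_boundP (_ : 0 <= b / e); apply; rewrite divr_ge0 // ltW.
apply: le_trans h _; rewrite -natrX ler_nat; exact/ltnW/ltn_expl.
Qed.

(** Near 0 the curve lifts to R^n. The lift is additive up to integer vectors,
    hence additive because it is small, and it is bounded; so it is linear on a
    short segment. Any parameter is an integer multiple of one in that segment.
    *)
Lemma one_parameter (n : nat) (phi : R -> torus R n) :
  {morph phi : s t / s + t} -> continuous phi ->
  exists a : 'rV[R]_n, forall s, phi s = \pi_(torus R n) (s *: a).
Proof.
move=> phiD cphi.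
have phi0 : phi 0 = 0.
  by apply: (addrI (phi 0)); rewrite -phiD !addr0.
have phiN s : phi (- s) = - phi s.
  by apply: (addrI (phi s)); rewrite -phiD !subrr phi0.
have phiMn s m : phi (s *+ m) = phi s *+ m.
  by elim: m => [|m IH]; rewrite ?mulr0n ?phi0 // !mulrS phiD IH.
(* With lifts smaller than 1/8 in each coordinate, the defect L (s + t) - L s -
   L t is an integer vector smaller than 1, hence 0. *)
pose B : set 'rV[R]_n := ball (0 : 'rV[R]_n) (8^-1 : R).
have nB : nbhs (phi 0) (\pi_(torus R n) @` B).
  by rewrite phi0 -torus_pi0; apply: torus_pi_nbhs; apply: nbhsx_ballx.
have /nbhs_ballP[e /= e0 eB] := cphi 0 _ nB.
pose d := e / 2.
have d0 : 0 < d by rewrite divr_gt0.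
have /choice[L LP] : forall s, exists v : 'rV[R]_n, `|s| <= d ->
    (forall j, `|v 0 j| < 8^-1) /\ phi s = \pi_(torus R n) v.
  move=> s; have [sd|sd] := pselect (`|s| <= d); last by exists 0.
  have : ball 0 e s.
    rewrite /ball /= sub0r normrN; apply: le_lt_trans sd _.
    by rewrite /d; lra.
  move=> /eB[v [_ vB] vE]; exists v => _; split=> // j.
  by have := vB 0 j; rewrite mxE /ball /= sub0r normrN.
have LD j s t : 0 <= s -> 0 <= t -> s + t <= d ->
    L (s + t) 0 j = L s 0 j + L t 0 j.
  move=> s0 t0 std.
  have [h1 e1] := LP s ltac:(rewrite ger0_norm; lra).
  have [h2 e2] := LP t ltac:(rewrite ger0_norm; lra).
  have [h3 e3] := LP (s + t) ltac:(rewrite ger0_norm; lra).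
  have : (L (s + t) - (L s + L t)) 0 j \is a Num.int.
    apply: (torus_pi_int _).1; rewrite torus_piB torus_piD -e1 -e2 -e3 phiD.
    by rewrite subrr.
  move=> /int_small E; apply/eqP; rewrite -subr_eq0; apply/eqP.
  move: E; rewrite !mxE; apply.
  move: (h1 j) (h2 j) (h3 j); rewrite !ltr_norml; lra.
pose a := d^-1 *: L d.
have La s : 0 <= s <= d -> L s = s *: a.
  move=> sd; apply/rowP => j; apply/eqP; rewrite -subr_eq0; apply/eqP.
  have bnd s' : 0 <= s' <= d -> `|L s' 0 j| <= 8^-1.
    by move=> s'd; apply: ltW; apply: (LP s' _).1; rewrite ger0_norm; lra.
  pose g s := L s 0 j - (s *: a) 0 j.
  apply: (@additive_bounded_eq0 d 1 g) => //; rewrite /g => {s sd}.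
  - by move=> s t s0 t0 st; rewrite LD // !mxE; ring.
  - move=> s sd; rewrite !mxE mulrA.
    have := bnd s sd; have := bnd d ltac:(lra).
    set x := L s 0 j; set y := L d 0 j => hy hx.
    have hsd : 0 <= s / d <= 1.
      by rewrite ler_pdivrMr // mul1r divr_ge0 //; lra.
    have : `|s / d * y| <= 8^-1.
      rewrite normrM ger0_norm; last lra.
      apply: le_trans hy; rewrite ler_piMl //; lra.
    move: hx; rewrite !ler_norml; lra.
  - by rewrite !mxE mulrA divff ?mul1r ?subrr // gt_eqF.
have pos s : 0 <= s -> phi s = \pi_(torus R n) (s *: a).
  move=> s0; pose N := (Num.bound (s / d)).+1.
  have N0 : 0 < N%:R :> R by rewrite ltr0n.
  have sN : 0 <= s / N%:R <= d.
    apply/andP; split; first by rewrite divr_ge0 // ltW.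
    rewrite ler_pdivrMr // [d * _]mulrC -ler_pdivrMr //.
    have : s / d < (Num.bound (s / d))%:R.
      by have := archi_boundP (_ : 0 <= s / d); apply; rewrite divr_ge0 // ltW.
    by move=> /ltW h; apply: le_trans h _; rewrite ler_nat.
  have piMn v m : \pi_(torus R n) (v *+ m) = \pi_(torus R n) v *+ m.
    by elim: m => [|m IH]; rewrite ?mulr0n ?torus_pi0 // !mulrS torus_piD IH.
  have -> : s = (s / N%:R) *+ N by rewrite -mulr_natr divfK // gt_eqF.
  rewrite phiMn -scalerMnl piMn; congr (_ *+ _).
  rewrite (LP _ _).2 ?La // ger0_norm; lra.
exists a => s; have [s0|s0] := leP 0 s; first exact: pos.
have := pos (- s); rewrite oppr_ge0 ltW // phiN scaleNr torus_piN.
by move=> /(_ isT)/oppr_inj.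
Qed.

(** The homomorphism lifts to the linear map given on the axes by one-parameter
    subgroups; since the unit vectors map to 0 in the torus, its matrix has
    integer entries. *)
Lemma torus_hom_tlin (m n : nat) (psi : torus R m -> torus R n) :
  {morph psi : s t / s + t} -> continuous psi ->
  exists A : 'M[int]_(m, n), psi =1 tlin A.
Proof.
move=> psiD cpsi.
have psi0 : psi 0 = 0 by apply: (addrI (psi 0)); rewrite -psiD !addr0.
pose e i : 'rV[R]_m := delta_mx 0 i.
have /choice[a aP] : forall i, exists a : 'rV[R]_n,
    forall s, psi (\pi_(torus R m) (s *: e i)) = \pi_(torus R n) (s *: a).
  move=> i; apply: one_parameter => [s t|].
    by rewrite scalerDl torus_piD psiD.
  move=> s; apply: (@continuous_comp _ _ _
    (fun s : R => \pi_(torus R m) (s *: e i)) psi); last exact: cpsi.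
  apply: (@continuous_comp _ _ _ (fun s : R => s *: e i)); last exact: pi_continuous.
  exact: scalel_continuous.
have psi_sum (u : 'rV[R]_m) : psi (\pi_(torus R m) u) =
    \pi_(torus R n) (\sum_i u 0 i *: a i).
  rewrite {1}(row_sum_delta u).
  elim/big_ind2: _ => [||i _].
  - by rewrite !torus_pi0.
  - by move=> u1 v1 u2 v2 h1 h2; rewrite !torus_piD psiD h1 h2.
  - exact: aP.
have ai i j : a i 0 j \is a Num.int.
  apply: (torus_pi_int (a i)).1; rewrite -[a i]scale1r -aP scale1r.
  have -> : \pi_(torus R m) (e i) = 0; last by [].
  apply/torus_pi_int => k; rewrite mxE; case: (_ && _); exact: intr_nat.
exists (\matrix_(i, j) Num.floor (a i 0 j)) => t.
rewrite -[t]reprK tlinE psi_sum; congr (\pi_(torus R n) _).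
apply/rowP => j; rewrite summxE !mxE; apply: eq_bigr => i _.
by rewrite !mxE floorK.
Qed.

(** If an entry differs by d <> 0, the point with coordinate 1 / (2 d) in that
    row distinguishes the two homomorphisms. *)
Lemma tlin_inj (m n : nat) (A B : 'M[int]_(m, n)) :
  tlin (R := R) A =1 tlin B -> A = B.
Proof.
move=> AB; apply/matrixP => i j; apply/eqP; rewrite -subr_eq0; apply/negPn/negP.
set D := A i j - B i j => D0.
pose s : R := (2 * D%:~R)^-1.
have DR0 : D%:~R != 0 :> R by rewrite intr_eq0.
pose u : 'rV[R]_m := s *: delta_mx 0 i.
have : (u *m realmx R A - u *m realmx R B) 0 j \is a Num.int.
  apply: (torus_pi_int _).1; rewrite torus_piB -!tlinE AB subrr //.
rewrite /u -!scalemxAl -!rowE -scalerBr !mxE -rmorphB -/D.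
have -> : s * D%:~R = 2^-1 by rewrite /s; field.
move=> /int_small; rewrite gtr0_norm // => h.
have : 2^-1 = 0 :> R by apply: h; lra.
by move/eqP; rewrite invr_eq0 pnatr_eq0.
Qed.

Lemma torus_aut_tlin (n : nat) (psi : torus R n -> torus R n) :
  torus_aut psi -> exists2 A : 'M[int]_n, A \in unitmx & psi =1 tlin A.
Proof.
move=> [psiD [cpsi [g [cg psiK gK]]]].
have [A AP] := torus_hom_tlin psiD cpsi.
have gD : {morph g : s t / s + t}.
  by move=> s t; apply: (can_inj psiK); rewrite gK psiD !gK.
have [B BP] := torus_hom_tlin gD cg.
exists A => //.
have AB : A *m B = 1%:M.
  by apply: tlin_inj => t; rewrite tlin_comp tlin1 -AP -BP psiK.
by have [] := mulmx1_unit AB.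
Qed.
End TorusAut.

(** * Facets of the cube *)

(** Facets are the zero sets of affine functions that are nonnegative on the
    cube; this treats both kinds of facets alike, and affinity makes convexity
    arguments immediate. *)
Definition fheight (R : realType) (n : nat) (k : 'I_(n + n)) (q : 'rV[R]_n) : R :=
  match fintype.split k with
  | inl i => q 0 i
  | inr i => 1 - q 0 i
  end.

Definition fcenter (R : realType) (n : nat) (k : 'I_(n + n)) : 'rV[R]_n :=
  \row_j match fintype.split k with
  | inl i => if j == i then 0 else 2^-1
  | inr i => if j == i then 1 else 2^-1
  end.

Section Facets.
Variables (R : realType) (n : nat).
Implicit Types (k : 'I_(n + n)) (p q : 'rV[R]_n).

Lemma facetE k q : facet k q = (fheight k q == 0).
Proof.
rewrite /facet /fheight; case: (fintype.split k) => i //.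
by rewrite subr_eq0 eq_sym.
Qed.

Lemma fheight_ge0 k q : cube R n q -> 0 <= fheight k q.
Proof.
rewrite /fheight => cq; case: (fintype.split k) => i; have := cq i => /andP[] //.
by rewrite subr_ge0.
Qed.

Lemma fheight_conv k (e : R) p q :
  fheight k ((1 - e) *: p + e *: q) = (1 - e) * fheight k p + e * fheight k q.
Proof. by rewrite /fheight; case: (fintype.split k) => i; rewrite !mxE; ring. Qed.

Lemma fheight_continuous k : continuous (@fheight R n k).
Proof.
rewrite /fheight; case: (fintype.split k) => i; first exact: coord_row_continuous.
move=> q; have c := @coord_row_continuous R n i q.
exact: (cvgB (cvg_cst _) c).
Qed.

Lemma split_lshift (i : 'I_n) : fintype.split (lshift n i) = inl i.
Proof. exact: (unsplitK (inl i)). Qed.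

Lemma split_rshift (i : 'I_n) : fintype.split (rshift n i) = inr i.
Proof. exact: (unsplitK (inr i)). Qed.

Lemma facet_lshift (i : 'I_n) q : facet (lshift n i) q = (q 0 i == 0).
Proof. by rewrite /facet split_lshift. Qed.

Lemma facet_rshift (i : 'I_n) q : facet (rshift n i) q = (q 0 i == 1).
Proof. by rewrite /facet split_rshift. Qed.

Lemma fcenter_cube k : cube R n (fcenter R k).
Proof.
by move=> j; rewrite mxE; case: (fintype.split k) => i; case: ifP => _; lra.
Qed.

Lemma facet_fcenter k k' : facet k' (fcenter R k) = (k' == k).
Proof.
have half0 : (2^-1 == 0 :> R) = false by rewrite invr_eq0 pnatr_eq0.
have half1 : (2^-1 == 1 :> R) = false by apply/eqP => h; lra.
have [i ->|i ->] := fintype.split_ordP k; have [j ->|j ->] := fintype.split_ordP k'.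
- rewrite facet_lshift mxE split_lshift eq_lshift.
  by case: (j == i); rewrite ?eqxx ?half0.
- rewrite facet_rshift mxE split_lshift eq_rlshift.
  by case: (j == i); rewrite ?half1 // eq_sym oner_eq0.
- rewrite facet_lshift mxE split_rshift eq_lrshift.
  by case: (j == i); rewrite ?half0 // oner_eq0.
- rewrite facet_rshift mxE split_rshift eq_rshift.
  by case: (j == i); rewrite ?eqxx ?half1.
Qed.

Lemma cube_conv p q (e : R) : cube R n p -> cube R n q -> 0 <= e <= 1 ->
  cube R n ((1 - e) *: p + e *: q).
Proof. by move=> cp cq e01 j; have := cp j; have := cq j; rewrite !mxE; nra. Qed.

(** A nonnegative affine function vanishes at a point interior to a segment
    exactly when it vanishes at both ends. *)
Lemma facet_toward_fcenter k q (e : R) : cube R n q -> facet k q -> 0 < e <= 1 ->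
  forall k', facet k' ((1 - e) *: q + e *: fcenter R k) = (k' == k).
Proof.
move=> cq; rewrite facetE => /eqP fq e01 k'; rewrite facetE fheight_conv.
have h1 := fheight_ge0 k' cq; have h2 := fheight_ge0 k' (fcenter_cube k).
have := facet_fcenter k k'; rewrite facetE.
case: (k' =P k) => [->|_] /eqP h.
  by rewrite h fq !mulr0 addr0 eqxx.
have h3 : 0 < fheight k' (fcenter R k) by rewrite lt0r h2 andbT; apply/eqP.
have : 0 < (1 - e) * fheight k' q + e * fheight k' (fcenter R k).
  by apply: ltr_wpDl; [apply: mulr_ge0 => //; lra | apply: mulr_gt0 => //; lra].
by move=> /gt_eqF.
Qed.

Lemma segment_continuous p q :
  continuous (fun s : R => (1 - s) *: p + s *: q : 'rV[R]_n).
Proof.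
move=> s.
suff : {for s, continuous (fun s : R => (1 - s) *: p + s *: q : 'rV[R]_n)} by [].
apply: continuousD; last exact: scalel_continuous.
apply: (@continuous_comp _ _ _ (fun s : R => 1 - s) (fun s : R => s *: p)).
  by apply: continuousB; [exact: cst_continuous | exact: cvg_id].
exact: scalel_continuous.
Qed.

Lemma near_facet_interior k q (N : set 'rV[R]_n) : cube R n q -> facet k q ->
  nbhs q N ->
  exists2 p, N p & cube R n p /\ forall k', facet k' p = (k' == k).
Proof.
move=> cq fk nN.
have : nbhs (0 : R) [set s | N ((1 - s) *: q + s *: fcenter R k)].
  apply: (@segment_continuous q (fcenter R k) 0 N).
  by rewrite subr0 scale1r scale0r addr0.
move=> /nbhs_ballP[d /= d0 dP].
pose s : R := Num.min (d / 2) 1.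
have s0 : 0 < s by rewrite lt_min ltr01 divr_gt0.
have s1 : s <= 1 by rewrite ge_min lexx orbT.
have sd : s < d by rewrite gt_min; apply/orP; left; lra.
exists ((1 - s) *: q + s *: fcenter R k).
  by apply: dP; rewrite /ball /= sub0r normrN gtr0_norm.
split; first by apply: cube_conv => //; [exact: fcenter_cube | lra].
by apply: facet_toward_fcenter => //; rewrite s0.
Qed.

Lemma cube_depth1 q : cube_depth q = 1%N ->
  exists k, forall k', facet k' q = (k' == k).
Proof.
by move=> /mem_card1[k kP]; exists k => k'; have := kP k'; rewrite !inE.
Qed.

Lemma cube_depth1E q k : (forall k', facet k' q = (k' == k)) -> cube_depth q = 1%N.
Proof.
by move=> h; rewrite /cube_depth -(card1 k); apply: eq_card => k'; rewrite !inE h.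
Qed.

(** The heights over the other facets are nonzero at a point of depth one,
    hence nonzero nearby, so the only facet through the moving point cannot
    change. *)
Lemma facet_constant (g : R -> 'rV[R]_n) k :
  (forall s : R, 0 <= s <= 1 ->
     [/\ {for s, continuous g}, cube R n (g s) & cube_depth (g s) = 1%N]) ->
  facet k (g 0) -> facet k (g 1).
Proof.
move=> gP; apply: (@locally_constant_segment R (fun s => facet k (g s))) => s s01.
have [cg cs ds] := gP s s01; have [k0 k0P] := cube_depth1 ds.
have nz k' : k' != k0 -> \forall s' \near s, fheight k' (g s') != 0.
  move=> ne; have c1 : {for s, continuous (fheight k' \o g)}.
    by apply: continuous_comp => //; exact: fheight_continuous.
  have z : (fheight k' \o g) s != 0 by rewrite /= -facetE k0P.
  exact: (cvgr_neq0 _ c1 z).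
have : \forall s' \near s, forall k', k' != k0 -> fheight k' (g s') != 0.
  apply: near_forall.
  move=> k'; have [->|ne] := eqVneq k' k0; last by apply: filterS (nz _ ne).
  by apply: filterS filterT => s' _ /eqP.
move=> /nbhs_ballP[e /= e0 eP]; exists e => // s' s'01 ss'.
have sB : ball s e s' by rewrite /ball /= distrC.
have [_ _ ds'] := gP s' s'01; have [k1 k1P] := cube_depth1 ds'.
have k10 : k1 = k0.
  apply/eqP/negPn/negP => /(eP _ sB); rewrite -facetE k1P eqxx //.
by rewrite k0P k1P k10.
Qed.
End Facets.

(** * The orbit map of a quasitoric manifold *)

Section QuasitoricLocal.
Variables (R : realType) (n : nat) (M : quasitoric R n).
Local Notation T := (torus R n).
Local Notation piT := (\pi_(torus R n)).

(** The orbit of a point, as a vector, so that coordinates and facets can be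
    spoken of directly. *)
Definition qpos (x : M) : 'rV[R]_n := set_val (qt_proj x).
Local Notation P := qpos.

Lemma qpos_continuous : continuous P.
Proof.
move=> x; apply: continuous_comp; first exact: qt_proj_continuous.
exact: initial_continuous.
Qed.

Lemma qpos_cube x : cube R n (P x).
Proof. exact: set_valP. Qed.

Lemma qpos_surj q : cube R n q -> exists x, P x = q.
Proof.
move=> cq; have [x xE] := qt_proj_surj M (SigSub (mem_set cq) : cube R n).
by exists x; rewrite /qpos xE.
Qed.

Lemma qpos_orbit x y : P x = P y <-> exists t, y = tact t x.
Proof.
have [h hh hE] := @qt_proj_homeo R n M.
have hinj : injective h by case: hh => _ [g [_ hK _]]; exact: can_inj hK.
split=> [/val_inj|].
  rewrite -!hE => /hinj/eqmodP/asboolP; exact.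
move=> xy; rewrite /qpos -!hE; congr (set_val (h _)).
by apply/eqmodP/asboolP.
Qed.

(** The projection to the orbit space is open, the saturation of an open set
    being a union of translates. Openness is relative to the cube, hence the
    condition on q. *)
Lemma qpos_open x (O : set M) : nbhs x O ->
  nbhs (P x) [set q | cube R n q -> exists2 y, O y & P y = q].
Proof.
rewrite nbhsE => -[U [oU Ux] UO].
have [h [ch [g [cg hK gK]]] hE] := @qt_proj_homeo R n M.
pose V : set (orbit_space M) := \pi_(orbit_space M) @` U.
have oV : open V.
  rewrite /open /= /quotient_open.
  have -> : \pi_(orbit_space M) @^-1` V = \bigcup_(t in [set: T]) (tact t @^-1` U).
    apply/seteqP; split=> [y [z Uz /eqmodP/asboolP[t tE]]|y [t _ Uty]].
      by exists (- t) => //=; rewrite tE -tactD addNr tact0.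
    exists (tact t y) => //; apply/eqmodP/asboolP; exists (- t).
    by rewrite -tactD addNr tact0.
  apply: bigcup_open => t _; apply: open_comp => // y _.
  have := @tact_continuous R n M (t, y).
  move=> c; apply: (@continuous_comp _ _ _ (fun y => (t, y))
    (fun p : T * M => tact p.1 p.2)); last exact: c.
  exact: (cvg_pair (cvg_cst _) cvg_id).
have oW : open (g @^-1` V) by apply: open_comp => // z _; exact: cg.
have [W oWW WE] := oW.
rewrite nbhsE; exists W; first split=> //.
  have : (g @^-1` V) (qt_proj x) by rewrite /= -hE hK; exists x.
  by rewrite -WE.
move=> q Wq cq; pose q' : cube R n := SigSub (mem_set cq).
have : (g @^-1` V) q' by rewrite -WE.
move=> [y Uy yE]; exists y; first exact: UO.
by rewrite /qpos -hE yE gK.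
Qed.
End QuasitoricLocal.

(** * Local structure of the orbit map *)

Lemma nbhs_sub (X : topologicalType) (x : X) (A B : set X) :
  nbhs x A -> A `<=` B -> nbhs x B.
Proof. by move=> nA AB; apply: filterS nA. Qed.

Lemma nbhs_and (X : topologicalType) (x : X) (A B : set X) :
  nbhs x A -> nbhs x B -> nbhs x (A `&` B).
Proof. by move=> nA nB; exact: filterI. Qed.

Lemma continuous_neq0 (R : realType) (X : topologicalType) (f : X -> R) (x : X) :
  {for x, continuous f} -> f x != 0 -> nbhs x [set y | f y != 0].
Proof. by move=> cf fx; exact: (cvgr_neq0 _ cf fx). Qed.

Lemma conv_coord (R : realType) (n : nat) (p q : 'rV[R]_n) (s : R) j :
  ((1 - s) *: p + s *: q) 0 j = (1 - s) * p 0 j + s * q 0 j.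
Proof. by rewrite !mxE. Qed.

Section LocalModel.
Variables (R : realType) (n : nat) (M : quasitoric R n).
Local Notation T := (torus R n).
Local Notation piT := (\pi_(torus R n)).
Local Notation P := (@qpos R n M).

(** A standard chart around an orbit contains a compact box Q of real points
    with nonnegative coordinates, which meets each of its orbits once, so the
    orbit map th embeds Q. Compactness of the image of Q, injectivity and the
    fact that it covers a neighbourhood of q0 make it a local transversal K to
    the orbits. The depth of th r is the number of vanishing coordinates of r.
    Points of Q for which only the coordinate j vanishes form a convex set, so
    they all go to the interior of one facet kap j, and by continuity the whole
    wall r_j = 0 goes to that facet. Counting then shows that kap is injective
    and that the facets through th r are exactly those of its vanishing
    coordinates. This translates the isotropy groups of the chart into facets
    of the cube. *)
Lemma local_model (q0 : 'rV[R]_n) : cube R n q0 ->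
  exists (A : 'M[int]_n) (kap : 'I_n -> 'I_(n + n)) (J : {set 'I_n}) (K : set M),
  [/\ A \in unitmx, {in J &, injective kap},
      forall k, facet k q0 = (k \in kap @: J),
      [/\ compact K, forall x y, K x -> K y -> P x = P y -> x = y &
      nbhs q0 [set q | cube R n q -> exists2 y, K y & P y = q]] &
      forall y, K y -> forall u, tact (piT u) y = y <->
        forall j, ~~ ((j \in J) && facet (kap j) (P y)) ->
          (u *m realmx R A) 0 j \is a Num.int].
Proof.
move=> cq0; have [x0 x0E] := qpos_surj M cq0.
have [c sc cx0] := qt_locally_standard x0.
have [cdomT cimgT _ [psi apsi cpsi]] := sc.
have [A uA psiE] := torus_aut_tlin apsi.
have psi_surj t : exists s, psi s = t.
  exists (tlin (invmx A) t); by rewrite psiE -tlin_comp mulVmx // tlin1.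
pose r0 := cabs (c x0); have r0E : r0 = cabs (c x0) by [].
clearbody r0; pose J := [set j | r0 0 j == 0]%SET.
have imgc x : chart_dom c x -> chart_img c (c x) by move=> ?; exists x.
have invK z : chart_img c z -> c (chart_inv c z) = z.
  by move=> [x dx <-]; rewrite chart_mapK ?inE.
have inv_dom z : chart_img c z -> chart_dom c (chart_inv c z).
  by move=> [x dx <-]; rewrite chart_mapK ?inE.
have c_inj x y : chart_dom c x -> chart_dom c y -> c x = c y -> x = y.
  move=> dx dy xy.
  by rewrite -(@chart_mapK _ _ _ c x) ?inE // xy chart_mapK ?inE.
have img_abs z : chart_img c z -> chart_img c (realpt (cabs z)).
  move=> iz; have [t tE] := polar z.
  have -> : realpt (cabs z) = std_act (- t) z.
    by rewrite [z in RHS]tE -std_actD addNr std_act0.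
  exact: cimgT.
have img_r0 : chart_img c (realpt r0) by rewrite r0E; apply/img_abs/imgc.
(* The radius of the box: small enough to stay in the chart and to keep the
   nonzero coordinates of r0 away from 0. *)
have [d d0 dP] : exists2 d : R, 0 < d & forall r : 'rV[R]_n,
    (forall j, `|r 0 j - r0 0 j| <= d) ->
    chart_img c (realpt r) /\ (forall j, r 0 j = 0 -> j \in J).
  have n1 : \forall r \near r0, chart_img c (realpt r).
    have := @realpt_continuous R n r0; apply.
    by apply: open_nbhs_nbhs; split=> //; exact: chart_img_open.
  have n2 : \forall r \near r0, forall j, (r : 'rV[R]_n) 0 j = 0 -> j \in J.
    apply: near_forall => j; have [jJ|jJ] := boolP (j \in J).
      exact: filterE.
    have h : r0 0 j != 0 by move: jJ; rewrite inE.
    have := continuous_neq0 (@coord_row_continuous R n j r0) h.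
    by move=> /nbhs_sub; apply => r /= /eqP.
  have /nbhs_ballP[e /= e0 eP] := nbhs_and n1 n2.
  exists (e / 2); first by rewrite divr_gt0.
  move=> r rP; apply: eP; split=> // i j; rewrite ord1 /ball /= distrC.
  by apply: le_lt_trans (rP j) _; lra.
pose Q := [set r : 'rV[R]_n | forall j, 0 <= r 0 j /\ `|r 0 j - r0 0 j| <= d].
have QP r : Q r -> chart_img c (realpt r) /\ (forall j, r 0 j = 0 -> j \in J).
  by move=> Qr; apply: dP => j; have [] := Qr j.
have r0_ge0 j : 0 <= r0 0 j by rewrite r0E; exact: cabs_ge0.
have Qr0 : Q r0 by move=> j; split=> //; rewrite subrr normr0 ltW.
have cQ : compact Q.
  have := @rV_compact R n (fun j => `[Num.max 0 (r0 0 j - d), r0 0 j + d]%classic)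
    (fun _ => @segment_compact R _ _).
  congr compact; apply/seteqP; split=> r /= rQ j; have := rQ j;
    rewrite /= in_itv /= ge_max ler_norml ?ord1; lra.
pose sg (r : 'rV[R]_n) : M := chart_inv c (realpt r).
pose th r := P (sg r).
have c_sg r : Q r -> c (sg r) = realpt r by move=> /QP[i _]; exact: invK.
have dom_sg r : Q r -> chart_dom c (sg r) by move=> /QP[i _]; exact: inv_dom.
have sg_cont r : Q r -> {for r, continuous sg}.
  move=> /QP[i _]; apply: (@continuous_comp _ _ _ (@realpt R n) (chart_inv c)).
    exact: realpt_continuous.
  exact: chart_inv_continuous.
have th_cont r : Q r -> {for r, continuous th}.
  move=> Qr; apply: continuous_comp; [exact: sg_cont | exact: qpos_continuous].
have th_cube r : cube R n (th r) by exact: qpos_cube.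
have th_depth r : Q r -> cube_depth (th r) = #|[set j | r 0 j == 0]%SET|.
  move=> Qr; rewrite /th /qpos -(@qt_proj_depth R n M c) //; last exact: dom_sg.
  rewrite c_sg // cardsE; apply: eq_card => j.
  by rewrite !inE /realpt /= mxE eqxx andbT.
have orb x : chart_dom c x -> Q (cabs (c x)) ->
    exists t, sg (cabs (c x)) = tact t x.
  move=> dx Qx; have [t tE] := polar (c x); have [s sE] := psi_surj (- t).
  exists s; apply: c_inj; [exact: dom_sg|exact: cdomT|].
  by rewrite c_sg // cpsi // sE [c x in RHS]tE -std_actD addNr std_act0.
have th_inj r r' : Q r -> Q r' -> th r = th r' -> r = r'.
  move=> Qr Qr' /qpos_orbit[t tE].
  have := congr1 c tE; rewrite cpsi ?c_sg //; last exact: dom_sg.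
  move=> /(congr1 (@cabs R n)); rewrite cabs_act !cabs_realpt // => j.
    by have [] := Qr j.
  by have [] := Qr' j.
have th_r0 : th r0 = q0.
  have h := orb x0 cx0; rewrite -r0E in h.
  by rewrite -x0E; symmetry; apply/qpos_orbit; exact: h.
have nQ : nbhs q0 [set q | cube R n q -> exists2 r, Q r & th r = q].
  have : nbhs x0 [set x | chart_dom c x /\ Q (cabs (c x))].
    apply: nbhs_and.
      by apply: open_nbhs_nbhs; split=> //; exact: chart_dom_open.
    have cc : {for x0, continuous (fun x => cabs (c x))}.
      apply: (@continuous_comp _ _ _ c (@cabs R n)).
        exact: chart_map_continuous.
      exact: cabs_continuous.
    have : \forall x \near x0, ball r0 d (cabs (c x)).
      by rewrite r0E; exact: (cc _ (nbhsx_ballx _ d d0)).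
    move=> /nbhs_sub; apply => x [_ xB] j; split; first exact: cabs_ge0.
    by apply: ltW; have := xB 0 j; rewrite /ball /= distrC.
  move=> /qpos_open; rewrite x0E; move=> /nbhs_sub; apply => q qP /qP[y [dy Qy] yE].
  exists (cabs (c y)) => //; rewrite -yE; symmetry; apply/qpos_orbit; exact: orb.
(* A point of the box that lies on the wall j and on no other wall; its facet
   defines kap j. *)
pose rj j : 'rV[R]_n := \row_i (if i == j then 0 else r0 0 i + d).
have Qrj j : j \in J -> Q (rj j).
  rewrite inE => /eqP jJ i; rewrite mxE; case: eqP => [->|_].
    by rewrite jJ subrr normr0; split=> //; exact: ltW.
  by have := r0_ge0 i; rewrite addrAC subrr add0r gtr0_norm //; lra.
have rj0 j i : (rj j 0 i == 0) = (i == j).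
  rewrite mxE; case: (i == j); first by rewrite eqxx.
  by apply: gt_eqF; have := r0_ge0 i; lra.
have dep1 r j : Q r -> (forall i, (r 0 i == 0) = (i == j)) ->
    cube_depth (th r) = 1%N.
  move=> Qr h; rewrite th_depth //.
  transitivity #|[set j]%SET|; last exact: cards1.
  by apply: eq_card => i; rewrite !inE h.
have /choice[kap kapP] : forall j, exists k, j \in J -> facet k (th (rj j)).
  move=> j; have [jJ|_] := boolP (j \in J); last by exists (lshift n j).
  have [k kP] := cube_depth1 (dep1 _ j (Qrj j jJ) (rj0 j)).
  by exists k; rewrite kP.
have Qconv r r' (s : R) : Q r -> Q r' -> 0 <= s <= 1 ->
    Q ((1 - s) *: r + s *: r').
  move=> Qr Qr' s01 j; have [a1 a2] := Qr j; have [b1 b2] := Qr' j.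
  rewrite conv_coord; split; first by nra.
  move: a2 b2; rewrite !ler_norml => /andP[? ?] /andP[? ?].
  by apply/andP; split; nra.
have C0 r j : Q r -> j \in J -> (forall i, (r 0 i == 0) = (i == j)) ->
    facet (kap j) (th r).
  move=> Qr jJ rP.
  pose g s := th ((1 - s) *: rj j + s *: r).
  have -> : th r = g 1 by rewrite /g subrr scale0r add0r scale1r.
  apply: facet_constant; last first.
    by rewrite /g subr0 scale1r scale0r addr0 kapP.
  move=> s s01; have Qs := Qconv _ _ s (Qrj j jJ) Qr s01; split; [|exact: th_cube|].
    apply: (@continuous_comp _ _ _ (fun s : R => (1 - s) *: rj j + s *: r) th).
      exact: segment_continuous.
    exact: th_cont.
  apply: (dep1 _ j Qs) => i; rewrite conv_coord.
  have [h1 _] := Qrj j jJ i; have [h2 _] := Qr i.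
  have := rj0 j i; have := rP i; case: (i == j) => /eqP e2 /eqP e1.
    by rewrite e1 e2 !mulr0 addr0 eqxx.
  apply: gt_eqF; have l1 : 0 < rj j 0 i by rewrite lt0r h1 andbT; apply/eqP.
  have l2 : 0 < r 0 i by rewrite lt0r h2 andbT; apply/eqP.
  by have [->|s1] := eqVneq s 1; nra.
(* Moving from r toward rj j leaves all the other walls at once, so a point of
   the wall is a limit of points to which C0 applies. *)
have C1 r j : Q r -> r 0 j = 0 -> facet (kap j) (th r).
  move=> Qr rj_0; have jJ : j \in J by apply: (QP _ Qr).2.
  apply: contraT; rewrite facetE => nf.
  pose g s := th ((1 - s) *: r + s *: rj j).
  have cg : {for 0, continuous (fun s => fheight (kap j) (g s))}.
    apply: (@continuous_comp _ _ _ g (fheight (kap j))); last first.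
      exact: fheight_continuous.
    apply: (@continuous_comp _ _ _ (fun s : R => (1 - s) *: r + s *: rj j) th).
      exact: segment_continuous.
    by apply: th_cont; rewrite subr0 scale1r scale0r addr0.
  have nf' : fheight (kap j) (g 0) != 0.
    by rewrite /g subr0 scale1r scale0r addr0.
  have /nbhs_ballP[e /= e0 eP] := continuous_neq0 cg nf'.
  pose s : R := Num.min (e / 2) 1.
  have s0 : 0 < s by rewrite lt_min ltr01 divr_gt0.
  have s1 : s <= 1 by rewrite ge_min lexx orbT.
  have se : s < e by rewrite gt_min; apply/orP; left; lra.
  have Qs := Qconv _ _ s Qr (Qrj j jJ) ltac:(lra).
  have : ball (0 : R) e s by rewrite /ball /= sub0r normrN gtr0_norm.
  move=> /eP /=; rewrite -facetE C0 // => i.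
  rewrite conv_coord.
  have [h1 _] := Qrj j jJ i; have [h2 _] := Qr i.
  have := rj0 j i; have [->|ij] := eqVneq i j => /eqP e1.
    by rewrite e1 rj_0 !mulr0 addr0 eqxx.
  apply: gt_eqF; have l1 : 0 < rj j 0 i by rewrite lt0r h1 andbT; apply/eqP.
  by nra.
have C2 : [set k | facet k q0]%SET = kap @: J.
  apply/setP => k; rewrite inE; apply/idP/imsetP => [fk|[j]]; last first.
    by rewrite inE => /eqP r0j ->; rewrite -th_r0 C1.
  have [p pN [cp fp]] := near_facet_interior cq0 fk nQ.
  have [r Qr rE] := pN cp.
  have := cube_depth1E fp; rewrite -rE th_depth // => /eqP/cards1P[j jE].
  have rj_0 : r 0 j = 0.
    by apply/eqP; have := set11 j; rewrite -jE inE.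
  exists j; first exact: (QP _ Qr).2.
  by apply/eqP; rewrite eq_sym -fp -rE C1.
(* Both sides count the facets through q0. *)
have kinj : {in J &, injective kap}.
  apply/imset_injP; rewrite -C2 cardsE -[#|_|]/(cube_depth q0) -th_r0.
  by rewrite th_depth.
exists A, kap, J, (sg @` Q); split=> //.
- by move=> k; rewrite -C2 inE.
- split.
  + apply: continuous_compact => //; apply: continuous_in_subspaceT => r.
    by rewrite inE => /sg_cont.
  + by move=> _ _ [r Qr <-] [r' Qr' <-] /th_inj ->.
  + by apply: filterS nQ => q qP /qP[r Qr rE]; exists (sg r) => //; exists r.
move=> _ [r Qr <-] u.
have zeroE j : (j \in J) && facet (kap j) (th r) = (r 0 j == 0).
  pose Z := [set j | r 0 j == 0]%SET.
  have ZJ : {subset Z <= J} by move=> i; rewrite inE => /eqP; exact: (QP _ Qr).2.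
  have kZ : kap @: Z = [set k | facet k (th r)]%SET.
    apply/eqP; rewrite eqEcard; apply/andP; split.
      apply/fintype.subsetP => k /imsetP[i iZ ->].
      by move: iZ; rewrite !inE => /eqP; exact: C1.
    rewrite cardsE -[#|_|]/(cube_depth (th r)) th_depth // card_in_imset //.
    by move=> i i' /ZJ iJ /ZJ i'J; exact: kinj.
  apply/andP/idP => [[jJ fj]|rj_0].
    have : kap j \in kap @: Z by rewrite kZ inE.
    by move=> /imsetP[i iZ /(kinj _ _ jJ (ZJ _ iZ)) ->]; move: iZ; rewrite inE.
  split; first by apply: ZJ; rewrite inE.
  by apply: C1 => //; exact/eqP.
have -> : (tact (piT u) (sg r) = sg r) <->
          (std_act (piT (u *m realmx R A)) (realpt r) = realpt r).
  split=> [/(congr1 c)|h].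
    by rewrite cpsi ?c_sg //; [rewrite psiE tlinE | exact: dom_sg].
  apply: c_inj; [apply: cdomT; exact: dom_sg | exact: dom_sg |].
  by rewrite cpsi ?c_sg //; [rewrite psiE tlinE | exact: dom_sg].
have zE j : Cn_zero (realpt r) j = (r 0 j == 0).
  by rewrite /Cn_zero /realpt /= mxE eqxx andbT.
rewrite std_act_fix; split=> h j.
  by rewrite zeroE -zE; exact: h.
by rewrite zE -zeroE; exact: h.
Qed.
End LocalModel.

(** * Characteristic vectors of a quasitoric manifold *)

Section UnimodularSpan.
Variables (R : realType) (n : nat).
Local Notation piT := (\pi_(torus R n)).

(** In the coordinates w = u A the condition says that w is integral outside Z,
    that is, u is congruent modulo Z^n to a real combination of the vectors of
    the dual basis with index in Z. *)
Lemma unimodular_span (A : 'M[int]_n) (Z : pred 'I_n) (u : 'rV[R]_n) :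
  A \in unitmx ->
  (forall j, ~~ Z j -> (u *m realmx R A) 0 j \is a Num.int) <->
  exists s : 'I_n -> R,
    piT u = piT (\sum_(j | Z j) s j *: row j (realmx R (invmx A))).
Proof.
move=> uA; set B := realmx R (invmx A).
have BA : B *m realmx R A = 1%:M by rewrite -realmx_mul mulVmx // realmx1.
have AB : realmx R A *m B = 1%:M by rewrite -realmx_mul mulmxV // realmx1.
split=> [h|[s sE] j Zj].
  pose w := u *m realmx R A; exists (fun j => w 0 j).
  have -> : u = w *m B by rewrite -mulmxA AB mulmx1.
  apply: subr0_eq; rewrite -torus_piB mulmx_sum_row (bigID Z) /=.
  rewrite addrAC subrr add0r; apply/torus_pi_int => i; rewrite summxE.
  apply: rpred_sum => j Zj; rewrite mxE; apply: rpredM; first exact: h.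
  by rewrite !mxE; exact: intr_int.
pose v := u - \sum_(j | Z j) s j *: row j B.
have vint i : v 0 i \is a Num.int.
  by apply: (torus_pi_int v).1; rewrite torus_piB sE subrr.
have -> : u = v + \sum_(j | Z j) s j *: row j B by rewrite subrK.
rewrite mulmxDl mxE; apply: rpredD; first exact: int_mul_realmx.
rewrite mulmx_suml summxE big1 ?rpred0 // => i Zi.
rewrite -scalemxAl -row_mul BA !mxE; case: eqP => [ij|_]; last by rewrite mulr0.
by move: Zj; rewrite -ij Zi.
Qed.

Lemma real_multiples_int (m : int) :
  (forall s : R, s * m%:~R \is a Num.int) -> m = 0.
Proof.
move=> h; apply/eqP/negPn/negP => m0.
have mR : m%:~R != 0 :> R by rewrite intr_eq0.
have := h ((2 * m%:~R)^-1).
have -> : (2 * m%:~R)^-1 * m%:~R = 2^-1 :> R by field.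
move=> /int_small; rewrite gtr0_norm // => E.
have : 2^-1 = 0 :> R by apply: E; lra.
by move/eqP; rewrite invr_eq0 pnatr_eq0.
Qed.

(** The primitive vector of the first circle, scaled by any real number, lies
    in the second one; its coordinates that must be integral along this line
    therefore vanish. *)
Lemma circle_multiple (A A' : 'M[int]_n) (j j' : 'I_n) :
  A \in unitmx -> A' \in unitmx ->
  (forall u : 'rV[R]_n,
     (forall i, i != j -> (u *m realmx R A) 0 i \is a Num.int) ->
     (forall i, i != j' -> (u *m realmx R A') 0 i \is a Num.int)) ->
  exists m : int, row j (invmx A) = m *: row j' (invmx A').
Proof.
move=> uA uA' h; set r := row j (invmx A).
have rA : r *m A = delta_mx 0 j by rewrite -row_mul mulVmx // row1.
exists ((r *m A') 0 j').
have E i : i != j' -> (r *m A') 0 i = 0.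
  move=> ij; apply: real_multiples_int => s.
  have -> : s * ((r *m A') 0 i)%:~R = (s *: realmx R r *m realmx R A') 0 i.
    by rewrite -scalemxAl -realmx_mul [RHS]mxE; congr (_ * _); rewrite [RHS]mxE.
  apply: h ij => k kj; rewrite -scalemxAl -realmx_mul rA !mxE.
  by rewrite (negPf kj) andbF mulr0 rpred0.
rewrite -[r in LHS]mulmx1 -(mulmxV uA') mulmxA; set w := r *m A' in E *.
rewrite mulmx_sum_row (bigD1 j') //= big1 ?addr0 // => i ij.
by rewrite E // scale0r.
Qed.

Lemma circle_sign (A A' : 'M[int]_n) (j j' : 'I_n) :
  A \in unitmx -> A' \in unitmx ->
  (forall u : 'rV[R]_n,
     (forall i, i != j -> (u *m realmx R A) 0 i \is a Num.int) <->
     (forall i, i != j' -> (u *m realmx R A') 0 i \is a Num.int)) ->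
  exists2 e : int, e = 1 \/ e = -1 & row j (invmx A) = e *: row j' (invmx A').
Proof.
move=> uA uA' h.
have [m mE] := circle_multiple uA uA' (fun u => (h u).1).
have [m' m'E] := circle_multiple uA' uA (fun u => (h u).2).
exists m => //.
have mm : m * m' = 1.
  have : row j (invmx A) *m A = (m * m') *: (row j (invmx A) *m A).
    by rewrite scalemxAl -scalerA -m'E -mE.
  rewrite -row_mul mulVmx // row1 => /rowP/(_ j); rewrite !mxE !eqxx /=.
  by rewrite mulr1 => <-.
have : `|m|%N = 1%N.
  apply/eqP; rewrite -dvdn1; apply/dvdnP; exists `|m'|%N.
  by rewrite -abszM mulrC mm.
lia.
Qed.
End UnimodularSpan.

Section CharacteristicVectors.
Variables (R : realType) (n : nat) (M : quasitoric R n).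
Local Notation T := (torus R n).
Local Notation piT := (\pi_(torus R n)).
Local Notation P := (@qpos R n M).

(** Points over the same q lie in one orbit, so they have the same isotropy
    group. It is stored as a set of vectors of R^n, the preimage under the
    projection. *)
Definition isotropy (q u : 'rV[R]_n) : Prop :=
  forall x : M, P x = q -> tact (piT u) x = x.

Lemma isotropyE (x : M) u : isotropy (P x) u <-> tact (piT u) x = x.
Proof.
split=> [|h y]; first exact.
move=> /esym/qpos_orbit[t ->]; rewrite -tactD addrC tactD h //.
Qed.

(** In the local model around a point of depth one the isotropy group is
    described by the facet alone, so it is locally constant along the segment
    to the center of the facet. *)
Lemma isotropy_constant (q u : 'rV[R]_n) (k : 'I_(n + n)) :
  cube R n q -> (forall k', facet k' q = (k' == k)) ->
  isotropy q u <-> isotropy (fcenter R k) u.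
Proof.
move=> cq fq; pose g (s : R) := (1 - s) *: q + s *: fcenter R k.
have g0 : g 0 = q by rewrite /g subr0 scale1r scale0r addr0.
have g1 : g 1 = fcenter R k by rewrite /g subrr scale0r add0r scale1r.
have gcube s : 0 <= s <= 1 -> cube R n (g s).
  by move=> s01; apply: cube_conv => //; exact: fcenter_cube.
have gf s : 0 <= s <= 1 -> forall k', facet k' (g s) = (k' == k).
  move=> s01; have [->|s0] := eqVneq s 0; first by rewrite g0.
  apply: facet_toward_fcenter => //; first by rewrite fq eqxx.
  by move: s01; rewrite [0 < s]lt0r s0.
apply: iff_sym; rewrite -g1 -[in X in _ <-> X]g0.
apply: (@locally_constant_segment R (fun s => isotropy (g s) u <-> isotropy (g 0) u)) => //.
move=> s s01.
have [A [kap [J [K [uA kinj kJ [cK Kinj nK] Kst]]]]] :=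
  local_model M (gcube s s01).
have cg : {for s, continuous g} by exact: segment_continuous.
have /nbhs_ballP[e /= e0 eP] := cg _ nK.
have loc s' : 0 <= s' <= 1 -> ball s e s' -> isotropy (g s') u <->
    forall j, ~~ ((j \in J) && (kap j == k)) ->
      (u *m realmx R A) 0 j \is a Num.int.
  move=> s'01 /eP/(_ (gcube s' s'01))[y Ky yE].
  rewrite -yE isotropyE Kst //; split=> h j.
    by move=> hj; apply: h; rewrite yE gf.
  by rewrite yE gf //; exact: h.
exists e => // s' s'01 ss'.
have h1 := loc s' s'01 ltac:(by rewrite /ball /= distrC).
have h2 := loc s s01 (ballxx s e0).
by rewrite h1 h2.
Qed.

Lemma isotropy_center (k : 'I_(n + n)) :
  exists (A : 'M[int]_n) (j : 'I_n), A \in unitmx /\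
    forall u, isotropy (fcenter R k) u <->
      forall i, i != j -> (u *m realmx R A) 0 i \is a Num.int.
Proof.
have [A [kap [J [K [uA kinj kJ [cK Kinj nK] Kst]]]]] :=
  local_model M (fcenter_cube R k).
have : facet k (fcenter R k) by rewrite facet_fcenter.
rewrite kJ => /imsetP[j jJ kj]; exists A, j; split=> // u.
have [y Ky yE] := nbhs_singleton nK (fcenter_cube R k).
rewrite -yE isotropyE Kst //; split=> h i ij; apply: h.
  apply/negP => /andP[iJ]; rewrite yE facet_fcenter kj => /eqP/kinj E.
  by move: ij; rewrite E ?eqxx.
by apply: contra ij => /eqP ->; rewrite jJ yE facet_fcenter kj eqxx.
Qed.

(** The vector of a facet generates the isotropy circle over its center. Near
    any point q0, the local model gives a basis of Z^n and assigns a member of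
    it to each facet through q0; moving into the interior of that facet shows
    that this member and the vector of the facet generate the same circle, so
    they differ by a sign. At a vertex all the members are used. *)
Theorem characteristic_vectors : exists L : 'M[int]_(n + n, n),
  (forall (x : M) u, tact (piT u) x = x <-> exists s : 'I_(n + n) -> R,
     piT u = piT (\sum_(k | facet k (P x)) s k *: row k (realmx R L))) /\
  (forall f : 'I_n -> 'I_(n + n), injective f ->
     (exists2 q, cube R n q & forall j, facet (f j) q) ->
     rowsub f L \in unitmx).
Proof.
have /choice[Aj AjP] : forall k, exists Aj : 'M[int]_n * 'I_n,
    Aj.1 \in unitmx /\ forall u, isotropy (fcenter R k) u <->
      forall i, i != Aj.2 -> (u *m realmx R Aj.1) 0 i \is a Num.int.
  by move=> k; have [A [j h]] := isotropy_center k; exists (A, j).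
pose L : 'M[int]_(n + n, n) := \matrix_k row (Aj k).2 (invmx (Aj k).1).
have local q0 : cube R n q0 ->
    exists (A : 'M[int]_n) (kap : 'I_n -> 'I_(n + n)) (J : {set 'I_n})
      (e : 'I_n -> int),
    [/\ A \in unitmx, {in J &, injective kap},
        forall k, facet k q0 = (k \in kap @: J),
        forall j, j \in J -> (e j = 1 \/ e j = -1) /\
           row j (invmx A) = e j *: row (kap j) L &
        forall u, isotropy q0 u <->
          forall j, j \notin J -> (u *m realmx R A) 0 j \is a Num.int].
  move=> cq0; have [A [kap [J [K [uA kinj kJ [cK Kinj nK] Kst]]]]] :=
    local_model M cq0.
  have /choice[e eP] : forall j, exists e : int, j \in J ->
      (e = 1 \/ e = -1) /\ row j (invmx A) = e *: row (kap j) L.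
    move=> j; have [jJ|_] := boolP (j \in J); last by exists 1.
    set k := kap j; have fk : facet k q0 by rewrite kJ imset_f.
    have [uAk Ak] := AjP k.
    have [e0 e1 e2] : exists2 e : int, e = 1 \/ e = -1 &
        row j (invmx A) = e *: row (Aj k).2 (invmx (Aj k).1).
      apply: (@circle_sign R) => // u; rewrite -Ak.
      have [p pN [cp fp]] := near_facet_interior cq0 fk nK.
      have [y Ky yE] := pN cp.
      rewrite -(isotropy_constant u cp fp) -yE isotropyE Kst //.
      split=> h i ij; apply: h.
        by apply: contra ij => /eqP ->; rewrite jJ yE fp eqxx.
      apply/negP => /andP[iJ]; rewrite yE fp => /eqP/kinj E.
      by move: ij; rewrite E ?eqxx.
    by exists e0 => _; split=> //; rewrite e2; congr (_ *: _); apply/rowP => i; rewrite !mxE.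
  exists A, kap, J, e; split=> // u.
  have [y Ky yE] := nbhs_singleton nK cq0.
  rewrite -yE isotropyE Kst //; split=> h j jJ; apply: h.
    by rewrite negb_and jJ.
  by move: jJ; rewrite negb_and yE => /orP[//|]; rewrite kJ; apply: contra => /imset_f ->.
clearbody L; exists L; split=> [x u|f finj [q cq fq]].
  have [A [kap [J [e [uA kinj kJ eP iso]]]]] := local (P x) (qpos_cube x).
  rewrite -isotropyE iso (@unimodular_span R n A (fun j => j \in J)) //.
  have reindex (s : 'I_(n + n) -> R) :
      \sum_(k | facet k (P x)) s k *: row k (realmx R L) =
      \sum_(j in J) (s (kap j) * (e j)%:~R) *: row j (realmx R (invmx A)).
    rewrite (eq_bigl (fun k => k \in kap @: J)) // big_imset //=.
    apply: eq_bigr => j jJ; have [e1 rE] := eP j jJ.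
    rewrite -!map_row rE map_mxZ scalerA -mulrA -rmorphM.
    have -> : e j * e j = 1 by case: e1 => ->.
    by rewrite mulr1.
  split=> -[s sE]; last by exists (fun j => s (kap j) * (e j)%:~R); rewrite sE reindex.
  have /choice[s' s'P] : forall k, exists r : R,
      forall j, j \in J -> kap j = k -> r = s j * (e j)%:~R.
    move=> k; have [/imsetP[j jJ kj]|nk] := boolP (k \in kap @: J).
      by exists (s j * (e j)%:~R) => i iJ; rewrite kj => /kinj ->.
    by exists 0 => j jJ jk; move: nk; rewrite -jk imset_f.
  exists s'; rewrite reindex sE; congr (\pi_(torus R n) _).
  apply: eq_bigr => j jJ; rewrite (s'P _ j) // -mulrA -rmorphM.
  have -> : e j * e j = 1 by have [[->|->] _] := eP j jJ.
  by rewrite mulr1.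
have [A [kap [J [e [uA kinj kJ eP _]]]]] := local q cq.
have fJ i : exists j, j \in J /\ f i = kap j.
  by have := fq i; rewrite kJ => /imsetP[j jJ ->]; exists j.
have /choice[sg sgP] := fJ.
have sginj : injective sg.
  by move=> i i' E; apply: finj; rewrite (sgP i).2 (sgP i').2 E.
pose d : 'rV[int]_n := \row_i e (sg i).
(* The rows of L for the facets f are the rows of the inverse of A, permuted
   and multiplied by signs. *)
have -> : rowsub f L = diag_mx d *m (perm_mx (perm sginj) *m invmx A).
  apply/matrixP => i k; rewrite mul_diag_mx -row_permE !mxE permE.
  have [jJ jE] := sgP i; have [e1 /rowP/(_ k)] := eP _ jJ.
  rewrite !mxE jE => ->; rewrite mulrA.
  by have -> : e (sg i) * e (sg i) = 1; [case: e1 => -> | rewrite mul1r].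
rewrite !unitmx_mul unitmx_perm unitmx_inv uA !andbT unitmxE det_diag.
apply: rpred_prod => i _; rewrite mxE.
by have [[->|->] _] := eP _ (sgP i).1; rewrite ?unitrN unitr1.
Qed.
End CharacteristicVectors.

(** * A continuous section of the orbit map *)

Section Transversal.
Variables (R : realType) (n : nat) (M : quasitoric R n).
Local Notation T := (torus R n).
Local Notation piT := (\pi_(torus R n)).
Local Notation P := (@qpos R n M).
Variable L : 'M[int]_(n + n, n).
Hypothesis stabL : forall (x : M) u, tact (piT u) x = x <->
  exists s : 'I_(n + n) -> R,
    piT u = piT (\sum_(k | facet k (P x)) s k *: row k (realmx R L)).

(** Isotropy groups grow toward the boundary: more facets pass through the
    point. *)
Lemma stab_sub (x y : M) (t : T) :
  (forall k, facet k (P x) -> facet k (P y)) -> tact t x = x -> tact t y = y.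
Proof.
move=> xy; rewrite -[t]reprK => /stabL[s sE]; apply/stabL.
exists (fun k => if facet k (P x) then s k else 0); rewrite sE.
congr (\pi_(torus R n) _); rewrite [LHS]big_mkcond [RHS]big_mkcond /=.
apply: eq_bigr => k _; case: ifP => [/xy ->|_] //.
by rewrite scale0r if_same.
Qed.

(** A section over B, encoded by its image. Compactness of the image stands for
    continuity of the section and is easier to carry through the gluing. Only
    the orbits over B have to be met; the set K may meet others. *)
Definition transversal (B : set 'rV[R]_n) : Prop := exists K : set M,
  [/\ compact K, forall x y, K x -> K y -> P x = P y -> x = y &
      forall q, cube R n q -> B q -> exists2 y, K y & P y = q].

Lemma transversal_sub (B B' : set 'rV[R]_n) :
  (forall q, cube R n q -> B' q -> B q) -> transversal B -> transversal B'.
Proof.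
move=> BB' [K [cK Ki KB]]; exists K; split=> // q cq B'q.
by apply: KB => //; exact: BB'.
Qed.

Definition flatten_coord (i : 'I_n) (m : R) (q : 'rV[R]_n) : 'rV[R]_n :=
  \row_j if j == i then m else q 0 j.

Lemma flatten_coord_continuous i m : continuous (flatten_coord i m).
Proof.
move=> q; apply: continuous_mkrow => j; case: (j == i).
  exact: cst_continuous.
exact: coord_row_continuous.
Qed.

(** For 0 < m < 1 the hyperplane avoids the two facets of the coordinate i. *)
Lemma facet_flatten i m k q : 0 < m < 1 ->
  facet k (flatten_coord i m q) -> facet k q.
Proof.
move=> m01; have [j ->|j ->] := fintype.split_ordP k.
  rewrite !facet_lshift mxE; case: ifP => // _ /eqP m0.
  by move: m01; rewrite m0 ltxx.
rewrite !facet_rshift mxE; case: ifP => // _ /eqP m1.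
by move: m01; rewrite m1 ltxx andbF.
Qed.

(** On the wall where the coordinate i equals m the two transversals differ by
    elements t of the torus, defined up to isotropy. The part of K2 beyond the
    wall is multiplied by the element t found at the projection of the point to
    the wall. The result is well defined because the isotropy group at the
    projection is contained in the one at the point. It is compact as the image
    of a closed relation between the torus, K2 and the two transversals over
    the wall: the relation replaces the choice of t, which need not be
    continuous. *)
Lemma transversal_glue (B1 B2 : set 'rV[R]_n) (i : 'I_n) (m : R) : 0 < m < 1 ->
  transversal B1 -> transversal B2 ->
  (forall q, B2 q -> m <= q 0 i ->
     B1 (flatten_coord i m q) /\ B2 (flatten_coord i m q)) ->
  transversal [set q | (B1 q /\ q 0 i <= m) \/ (B2 q /\ m <= q 0 i)].
Proof.
move=> m01 [K1 [cK1 K1i K1B]] [K2 [cK2 K2i K2B]] fB.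
pose rho := flatten_coord i m.
(* A tuple (t, (y2, (y1, y2'))): y2 is a point of K2 beyond the wall, y1 and
   y2' are the points of K1 and K2 over its projection, and t carries y2' to
   y1. *)
pose Z0 := [set p : T * (M * (M * M)) |
  [/\ P p.2.2.1 = rho (P p.2.1), P p.2.2.2 = rho (P p.2.1),
      p.2.2.1 = tact p.1 p.2.2.2 & m <= P p.2.1 0 i]].
pose Z := ([set: T] `*` (K2 `*` (K1 `*` K2))) `&` Z0.
pose p2 (p : T * (M * (M * M))) := p.2.1.
pose p3 (p : T * (M * (M * M))) := p.2.2.1.
pose p4 (p : T * (M * (M * M))) := p.2.2.2.
have c2 : continuous p2.
  move=> p; apply: (@continuous_comp _ _ _ snd fst); first exact: cvg_snd.
  exact: cvg_fst.
have c22 : continuous (fun p : T * (M * (M * M)) => p.2.2).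
  by move=> p; apply: (@continuous_comp _ _ _ snd snd); exact: cvg_snd.
have c3 : continuous p3.
  move=> p; apply: (@continuous_comp _ _ _ (fun p => p.2.2) fst); first exact: c22.
  exact: cvg_fst.
have c4 : continuous p4.
  move=> p; apply: (@continuous_comp _ _ _ (fun p => p.2.2) snd); first exact: c22.
  exact: cvg_snd.
have cP : continuous P by exact: qpos_continuous.
have crP : continuous (fun p => rho (P (p2 p))).
  move=> p; apply: (@continuous_comp _ _ _ (P \o p2) rho).
    by apply: continuous_comp; [exact: c2 | exact: cP].
  exact: flatten_coord_continuous.
have cact : continuous (fun p => tact p.1 (p4 p)).
  move=> p; apply: (@continuous_comp _ _ _ (fun p => (p.1, p4 p))
    (fun p : T * M => tact p.1 p.2)); last exact: tact_continuous.
  by apply: continuous_pair; [exact: cvg_fst | exact: c4].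
have hR : hausdorff_space 'rV[R]_n by exact: norm_hausdorff.
have clZ : closed Z0.
  have -> : Z0 = [set p | P (p3 p) = rho (P (p2 p))] `&`
    ([set p | P (p4 p) = rho (P (p2 p))] `&`
     ([set p | p3 p = tact p.1 (p4 p)] `&`
      ((fun p => P (p2 p) 0 i) @^-1` [set x | m <= x]))).
    by apply/seteqP; split=> p /=; [case|case=> [? [? []]]].
  apply: closedI; last apply: closedI; last apply: closedI.
  - apply: coincidence_closed => // p.
    by apply: continuous_comp; [exact: c3 | exact: cP].
  - apply: coincidence_closed => // p.
    by apply: continuous_comp; [exact: c4 | exact: cP].
  - by apply: coincidence_closed => //; exact: qt_hausdorff.
  - apply: preimage_closed; last exact: closed_ge.
    move=> p _; apply: (@continuous_comp _ _ _ (P \o p2) (fun v : 'rV[R]_n => v 0 i)).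
      by apply: continuous_comp; [exact: c2 | exact: cP].
    exact: coord_row_continuous.
have cZ : compact Z.
  apply: compact_closedI => //.
  apply: compact_setX; first exact: torus_compact.
  by apply: compact_setX => //; exact: compact_setX.
have Pact t (y : M) : P (tact t y) = P y by symmetry; apply/qpos_orbit; exists t.
exists ((K1 `&` [set y | P y 0 i <= m]) `|`
        ((fun p => tact p.1 (p2 p)) @` Z)); split.
- apply: compactU.
    apply: compact_closedI => //.
    apply: (@preimage_closed _ _ (fun y => P y 0 i) [set x | x <= m]).
      move=> y _; apply: (@continuous_comp _ _ _ P (fun v : 'rV[R]_n => v 0 i)).
        exact: cP.
      exact: coord_row_continuous.
    exact: closed_le.
  apply: continuous_compact => //; apply: continuous_subspaceT => p.
  apply: (@continuous_comp _ _ _ (fun p => (p.1, p2 p))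
    (fun p : T * M => tact p.1 p.2)); last exact: tact_continuous.
  by apply: continuous_pair; [exact: cvg_fst | exact: c2].
- have mix x y : (K1 `&` [set y | P y 0 i <= m]) x ->
      ((fun p => tact p.1 (p2 p)) @` Z) y -> P x = P y -> x = y.
    move=> [K1x xm] [[t [y2 [y1 y2']]]].
    move=> [/= [_ [/= K2y2 [/= K1y1 K2y2']]]] [/= e1 e2 e3 my] <- /=.
    rewrite /p2 /= Pact => xy; rewrite /= xy in xm.
    have rE : rho (P y2) = P y2.
      apply/rowP => j; rewrite mxE; case: eqP => // ->.
      by apply/eqP; rewrite eq_le xm my.
    have -> : x = y1 by apply: K1i => //; rewrite e1 rE.
    by rewrite e3; congr tact; apply: K2i => //; rewrite e2 rE.
  move=> x y [x1|x2] [y1|y2] xy.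
  + exact: K1i x1.1 y1.1 xy.
  + exact: mix.
  + by symmetry; apply: mix.
  + case: x2 xy => -[t [a2 [a1 a2']]].
    move=> [/= [_ [/= K2a2 [/= K1a1 K2a2']]]] [/= e1 e2 e3 my] <- /=.
    case: y2 => -[t' [b2 [b1 b2']]].
    move=> [/= [_ [/= K2b2 [/= K1b1 K2b2']]]] [/= f1 f2 f3 my'] <- /=.
    rewrite /p2 /= !Pact => ab.
    have {}ab : a2 = b2 by exact: K2i.
    subst b2.
    have E1 : a1 = b1 by apply: K1i => //; rewrite e1 f1.
    have E2 : a2' = b2' by apply: K2i => //; rewrite e2 f2.
    subst b1 b2'.
    have : tact (t - t') a2 = a2.
      apply: (@stab_sub a2'); last first.
        by rewrite addrC tactD -e3 E1 -tactD addNr tact0.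
      by move=> k; rewrite e2; exact: facet_flatten.
    by move=> h; rewrite -{2}h -tactD addrC subrK.
- move=> q cq [[B1q qm]|[B2q qm]].
    have [y K1y yE] := K1B q cq B1q; exists y => //; left; split=> //=.
    by rewrite yE.
  have [h1 h2] := fB q B2q qm.
  have cr : cube R n (rho q).
    by move=> j; rewrite mxE; case: eqP => _; [lra | exact: cq].
  have [y2 K2y2 y2E] := K2B q cq B2q.
  have [y1 K1y1 y1E] := K1B _ cr h1.
  have [y2' K2y2' y2'E] := K2B _ cr h2.
  have [t tE] : exists t, y1 = tact t y2' by apply/qpos_orbit; rewrite y1E y2'E.
  exists (tact t y2); last by rewrite Pact.
  right; exists (t, (y2, (y1, y2'))) => //; split=> //=.
  by split=> //=; rewrite y2E ?y1E ?y2'E.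
Qed.

Definition slab (d : nat) (q : 'rV[R]_n) (i : 'I_n) (a b e : R) : set 'rV[R]_n :=
  [set p | a <= p 0 i <= b /\ forall j : 'I_n, (d < j)%N -> `|p 0 j - q 0 j| <= e].

Lemma transversal_slab_extend (q : 'rV[R]_n) (i : 'I_n) (m l e1 e2 : R) :
  0 <= m <= l -> l <= 1 -> 0 < e1 -> 0 < e2 ->
  transversal (slab i q i 0 m e1) -> transversal (slab i q i m l e2) ->
  exists2 e, 0 < e & transversal (slab i q i 0 l e).
Proof.
move=> ml l1 e10 e20 H1 H2.
have [m0|m0] := eqVneq m 0; first by exists e2 => //; rewrite -m0.
have [m1|m1] := eqVneq m 1.
  by exists e1 => //; have -> : l = m by lra.
have m01 : 0 < m < 1 by rewrite !lt_neqAle eq_sym m0 m1; lra.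
pose e := Num.min e1 e2; exists e; first by rewrite lt_min e10.
have sub e' a b : e <= e' -> slab i q i a b e `<=` slab i q i a b e'.
  by move=> ee' p [h1 h2]; split=> // j ij; apply: le_trans (h2 j ij) ee'.
have le1 : e <= e1 by rewrite ge_min lexx.
have le2 : e <= e2 by rewrite ge_min lexx orbT.
have G := transversal_glue (i := i) m01
  (transversal_sub (fun p _ => @sub _ _ _ le1 p) H1)
  (transversal_sub (fun p _ => @sub _ _ _ le2 p) H2).
apply: transversal_sub (G _) => [p _ [/andP[p0 pl] pj]|p [p1 pj] mp].
  have [pm|pm] := leP (p 0 i) m; [left|right]; split=> //.
    by split=> //; rewrite p0.
    by split=> //; rewrite pl ltW.
  by rewrite ltW.
have h (j : 'I_n) : (i < j)%N -> `|flatten_coord i m p 0 j - q 0 j| <= e.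
  move=> ij; rewrite mxE; case: eqP => [E|_]; last exact: pj.
  by move: ij; rewrite E ltnn.
by split; split=> //; rewrite mxE eqxx lexx ?andbT; lra.
Qed.

(** Induction on the number d of coordinates that are allowed to run over all
    of [0, 1]. Local models start it. To free one more coordinate, the set of s
    such that a transversal exists over [0, s] in that direction is open and
    closed in [0, 1]: around each s the induction hypothesis gives a
    transversal over a short interval, which is glued to the one at hand. *)
Lemma transversal_boxes (d : nat) (q : 'rV[R]_n) : cube R n q ->
  exists2 e, 0 < e & transversal
    [set p | forall j : 'I_n, (d <= j)%N -> `|p 0 j - q 0 j| <= e].
Proof.
elim: d q => [|d IH] q cq.
  have [A [kap [J [K [_ _ _ [cK Kinj nK] _]]]]] := local_model M cq.
  have /nbhs_ballP[e /= e0 eP] := nK.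
  exists (e / 2); first by rewrite divr_gt0.
  exists K; split=> // p cp pq; apply: eP => //; split=> // i j.
  rewrite ord1 /ball /= distrC; apply: le_lt_trans (pq j isT) _; lra.
have [nd|dn] := leqP n d.
  have [e e0 He] := IH q cq; exists e => //; apply: transversal_sub He => p _ _ j.
  by move=> dj; move: (ltn_ord j); rewrite ltnNge (leq_trans nd).
pose i : 'I_n := Ordinal dn.
have loc (s : R) : 0 <= s <= 1 -> exists2 e, 0 < e & forall a b,
    s - e <= a -> b <= s + e -> transversal (slab i q i a b e).
  move=> s01; have cs : cube R n (flatten_coord i s q).
    by move=> j; rewrite mxE; case: eqP => _ //; exact: cq.
  have [e e0 He] := IH _ cs; exists e => // a b sa bs.
  apply: transversal_sub He => p _ [/andP[pa pb] pj] j dj; rewrite mxE.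
  case: eqP => [->|/eqP ji]; first by rewrite ler_norml; lra.
  by apply: pj; rewrite ltn_neqAle dj andbT eq_sym -(inj_eq val_inj) in ji *.
pose H (s : R) := exists2 e, 0 < e & transversal (slab i q i 0 s e).
have Hmono (s s' : R) : s <= s' -> H s' -> H s.
  move=> ss' [e e0 He]; exists e => //; apply: transversal_sub He.
  by move=> p _ [/andP[p0 ps] pj]; split=> //; rewrite p0 (le_trans ps).
have : H 1.
  apply: locally_constant_segment => [s s01|].
    have [e e0 He] := loc s s01; exists e => // s' s'01.
    rewrite ltr_norml => ss'; have [le|lt] := leP s s'.
      split; last exact: Hmono.
      move=> [e1 e10 H1]; apply: (@transversal_slab_extend _ _ s s' e1 e) => //.
      + lra.
      + lra.
      + apply: He; lra.
    split; first by apply: Hmono; exact: ltW.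
    move=> [e1 e10 H1]; apply: (@transversal_slab_extend _ _ s' s e1 e) => //.
    + lra.
    + lra.
    + apply: He; lra.
  have [e e0 He] := loc 0 ltac:(lra); exists e => //; apply: He; lra.
move=> [e e0 He]; exists e => //; apply: transversal_sub He => p cp pj.
by split; [exact: cp | exact: pj].
Qed.

Lemma transversal_cube : transversal setT.
Proof.
have c0 : cube R n 0 by move=> j; rewrite mxE lexx ler01.
have [e _ He] := transversal_boxes n c0; apply: transversal_sub He.
by move=> p _ _ j; rewrite leqNgt ltn_ord.
Qed.

(** The orbit map is a homeomorphism from a compact transversal onto the cube.
    *)
Lemma continuous_section : exists2 s : cube R n -> M,
  continuous s & forall q, P (s q) = set_val q.
Proof.
have [K [cK Ki KB]] := transversal_cube.
have /choice[s sP] : forall q : cube R n, exists y, K y /\ P y = set_val q.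
  move=> q; have [y Ky yE] := KB (set_val q) (set_valP q) I; by exists y.
exists s; last by move=> q; have [] := sP q.
have sK x : K x -> s (qt_proj x) = x.
  by move=> Kx; have [Ks sE] := sP (qt_proj x); apply: Ki.
move=> q; apply: (@compact_cancel_continuous _ _ K (@qt_proj R n M)) => //.
- have hR : hausdorff_space 'rV[R]_n by exact: norm_hausdorff.
  move=> a b ab; apply: val_inj; apply: hR => A B nA nB.
  have nA' : nbhs a (set_val @^-1` A) by exact: initial_continuous.
  have nB' : nbhs b (set_val @^-1` B) by exact: initial_continuous.
  by have [c [Ac Bc]] := ab _ _ nA' nB'; exists (set_val c).
- exact/continuous_subspaceT/qt_proj_continuous.
- apply: filterS filterT => q' _; have [Kq' qE] := sP q'.
  by exists (s q') => //; apply: val_inj.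
Qed.
End Transversal.

(** * Weakly equivariant homeomorphism as an equivalence *)

Section WeakEquivalence.
Variables (R : realType) (n : nat).
Implicit Types X Y Z : tspace R n.

Lemma torus_aut_inv (psi : torus R n -> torus R n) : torus_aut psi ->
  exists2 psi', torus_aut psi' & cancel psi psi' /\ cancel psi' psi.
Proof.
move=> [psiD [cpsi [g [cg psiK gK]]]]; exists g => //; split.
  by move=> s t; apply: (can_inj psiK); rewrite gK psiD !gK.
by split=> //; exists psi.
Qed.

Lemma weq_sym X Y : weq_homeomorphic X Y -> weq_homeomorphic Y X.
Proof.
move=> [f [psi [[cf [g [cg fK gK]]] /torus_aut_inv[psi' apsi' [pK p'K]] fe]]].
exists g, psi'; split=> //; first by split=> //; exists f.
by move=> t y; apply: (can_inj fK); rewrite fe p'K !gK.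
Qed.

Lemma weq_trans X Y Z :
  weq_homeomorphic X Y -> weq_homeomorphic Y Z -> weq_homeomorphic X Z.
Proof.
move=> [f [psi [[cf [g [cg fK gK]]] [pD [cp [p [cp' pK p'K]]]] fe]]].
move=> [f' [psi' [[cf' [g' [cg' fK' gK']]] [pD' [cq [q [cq' qK q'K]]]] fe']]].
exists (f' \o f), (psi' \o psi); split.
- split; first exact: comp_continuous.
  exists (g \o g'); split; first exact: comp_continuous.
    exact: can_comp.
  exact: can_comp.
- split; first by move=> s t /=; rewrite pD pD'.
  split; first exact: comp_continuous.
  exists (p \o q); split; first exact: comp_continuous.
    exact: can_comp.
  exact: can_comp.
- by move=> t x /=; rewrite fe fe'.
Qed.

Lemma weh_class_eq X Y : weq_homeomorphic X Y -> weh_class X = weh_class Y.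
Proof.
move=> XY; apply/funext => Z; apply/propext; split; last exact: weq_trans.
by apply: weq_trans; exact: weq_sym.
Qed.
End WeakEquivalence.

(** * Compactness of the cube *)

Section CubeCompact.
Variables (R : realType) (n : nat).

Lemma cube_continuous (X : topologicalType) (f : X -> cube R n) :
  continuous (fun x => set_val (f x)) -> continuous f.
Proof. by move=> cf; apply/continuous_comp_initial. Qed.

Lemma cube_val_continuous : continuous (set_val : cube R n -> 'rV[R]_n).
Proof. exact: initial_continuous. Qed.

Lemma clamp_cube (q : 'rV[R]_n) :
  cube R n (\row_j Num.max 0 (Num.min 1 (q 0 j))).
Proof. by move=> j; rewrite mxE le_max lexx /= ge_max ler01 ge_min lexx. Qed.

Lemma cube_compact : compact [set: cube R n].
Proof.
pose cl (q : 'rV[R]_n) : cube R n := SigSub (mem_set (clamp_cube q)).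
have ccl : continuous cl.
  apply: cube_continuous => q; apply: continuous_mkrow => j.
  apply: (@continuous_comp _ _ _ (fun q : 'rV[R]_n => q 0 j)
    (fun x : R => Num.max 0 (Num.min 1 x))); first exact: coord_row_continuous.
  apply: continuous_max; first exact: cst_continuous.
  by apply: continuous_min; [exact: cst_continuous | exact: cvg_id].
have -> : [set: cube R n] = cl @` [set q : 'rV[R]_n | forall j, `[0, 1]%classic (q ord0 j)].
  apply/seteqP; split=> // q _; exists (set_val q).
    by move=> j /=; rewrite in_itv /=; exact: (set_valP q j).
  apply: val_inj; apply/rowP => j; rewrite /= mxE.
  have /andP[h1 h2] := set_valP q j.
  by rewrite (min_r h2) (max_r h1).
apply: continuous_compact; first exact: continuous_subspaceT.
exact: (@rV_compact R n (fun _ => `[0, 1]%classic) (fun _ => @segment_compact R 0 1)).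
Qed.
End CubeCompact.

(** * Recognition of the model manifold *)

Section Recognition.
Variables (R : realType) (n : nat) (M : quasitoric R n).
Local Notation T := (torus R n).
Local Notation piT := (\pi_(torus R n)).
Local Notation P := (@qpos R n M).

Lemma subtorus_tlin (xi : 'M[int]_n) (q u : 'rV[R]_n) :
  subtorus xi q (piT u) <-> exists s : 'I_(n + n) -> R,
    piT u = piT (\sum_(k | facet k q) s k *: row k (realmx R (char_mx xi)^T)).
Proof.
have E (s : 'I_(n + n) -> R) :
    \sum_(k | facet k q) s k *: row k (realmx R (char_mx xi)^T) =
    \sum_(k | facet k q) s k *: \row_i (char_mx xi i k)%:~R.
  by apply: eq_bigr => k _; congr (_ *: _); apply/rowP => i; rewrite !mxE.
by split=> -[s sE]; exists s; rewrite sE E.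
Qed.

(** Map the class of (t, q) to tlin A^-1 t applied to the section at g q. The
    symmetry g of the cube permutes the facets by gam, and the rows of L A
    agree with the characteristic vectors of xi up to this permutation and
    signs, so the isotropy groups of M match the subtori collapsed in the
    model. The map is therefore well defined and bijective; it is a
    homeomorphism because the model is compact. *)
Theorem recognition (L : 'M[int]_(n + n, n)) (xi A : 'M[int]_n)
    (g g' : 'rV[R]_n -> 'rV[R]_n) (gam : 'I_(n + n) -> 'I_(n + n))
    (e : 'I_(n + n) -> int) :
  (forall (x : M) u, tact (piT u) x = x <-> exists s : 'I_(n + n) -> R,
     piT u = piT (\sum_(k | facet k (P x)) s k *: row k (realmx R L))) ->
  continuous g -> (forall q, cube R n q -> cube R n (g q)) ->
  (forall q, cube R n q -> cube R n (g' q)) -> cancel g g' -> cancel g' g ->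
  injective gam -> (forall k q, facet k (g q) = facet (gam k) q) ->
  A \in unitmx -> (forall k, e k = 1 \/ e k = -1) ->
  (forall k, row (gam k) (char_mx xi)^T = e k *: row k (L *m A)) ->
  weq_homeomorphic (qt_of_square R xi) M.
Proof.
move=> stabL cg gcube g'cube gK g'K gaminj gamE uA e1 LA.
have [s cs sE] := continuous_section stabL.
pose gh (q : cube R n) : cube R n := SigSub (mem_set (gcube _ (set_valP q))).
have cgh : continuous gh.
  apply: cube_continuous => q.
  apply: (@continuous_comp _ _ _ (set_val : cube R n -> 'rV[R]_n) g).
    exact: cube_val_continuous.
  exact: cg.
pose B := invmx A.
pose F (p : T * cube R n) : M := tact (tlin B p.1) (s (gh p.2)).
have PF p : P (F p) = g (set_val p.2).
  have -> : P (F p) = P (s (gh p.2)).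
    by symmetry; apply/qpos_orbit; exists (tlin B p.1).
  by rewrite sE.
have cF : continuous F.
  move=> p; apply: (@continuous_comp _ _ _
    (fun p : T * cube R n => (tlin B p.1, s (gh p.2)))
    (fun p : T * M => tact p.1 p.2)); last exact: tact_continuous.
  apply: continuous_pair.
    apply: (@continuous_comp _ _ _ fst (tlin B)); first exact: cvg_fst.
    exact: tlin_continuous.
  apply: (@continuous_comp _ _ _ (fun p : T * cube R n => gh p.2) s); last exact: cs.
  apply: (@continuous_comp _ _ _ snd gh); first exact: cvg_snd.
  exact: cgh.
have e2 k : (e k)%:~R * (e k)%:~R = 1 :> R.
  by rewrite -rmorphM /=; case: (e1 k) => ->.
have rowL k : row (gam k) (realmx R (char_mx xi)^T) *m realmx R B =
              (e k)%:~R *: row k (realmx R L).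
  rewrite -!map_row LA map_mxZ -scalemxAl -map_mxM -row_mul -mulmxA mulmxV //.
  by rewrite mulmx1.
have stabF q t : subtorus xi (set_val q) t <->
    tact (tlin B t) (s (gh q)) = s (gh q).
  rewrite -[t]reprK; set u := repr t; rewrite tlinE stabL sE subtorus_tlin /=.
  have reindex (c : 'I_(n + n) -> R) :
      (\sum_(k | facet k (set_val q)) c k *:
         row k (realmx R (char_mx xi)^T)) *m realmx R B =
      \sum_(k | facet k (g (set_val q))) (c (gam k) * (e k)%:~R) *:
         row k (realmx R L).
    rewrite mulmx_suml (reindex_inj gaminj) /=; apply: eq_big => [k|k _].
      by rewrite gamE.
    by rewrite -scalemxAl rowL scalerA.
  have BA (v : 'rV[R]_n) : v *m realmx R B *m realmx R A = v.
    by rewrite -mulmxA -realmx_mul mulVmx // realmx1 mulmx1.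
  split=> -[c cE].
    exists (fun k => c (gam k) * (e k)%:~R); rewrite -reindex.
    by rewrite -!tlinE cE.
  have [gami gamK' gamK] := injF_bij gaminj.
  exists (fun k => c (gami k) * (e (gami k))%:~R).
  have := congr1 (tlin A) cE; rewrite !tlinE BA => ->.
  set w := (X in _ = \pi_(torus R n) X); rewrite -[w]BA; congr (\pi_(torus R n) (_ *m _)).
  rewrite reindex; apply: eq_bigr => k _.
  by rewrite gamK' -mulrA e2 mulr1.
pose f (x : qt_model R xi) : M := F (repr x).
have fE p : f (\pi_(qt_model R xi) p) = F p.
  rewrite /f; case: piP => p' /eqmodP/asboolP[]; rewrite /F => <-.
  move=> /stabF; rewrite tlinB addrC tactD => /(congr1 (tact (tlin B p'.1))).
  by rewrite -tactD subrr tact0.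
have cf : continuous f.
  apply/quotient_continuous.
  have -> : f \o \pi_(qt_model R xi) = F by apply/funext => p; exact: fE.
  exact: cF.
have finj : injective f.
  move=> x y; rewrite -[x]reprK -[y]reprK !fE => FF.
  have q12 : (repr x).2 = (repr y).2.
    have := congr1 P FF; rewrite !PF => /(can_inj gK).
    exact: val_inj.
  apply/eqmodP/asboolP; split=> //; apply/stabF.
  move: FF; rewrite /F -q12 tlinB addrC tactD => ->.
  by rewrite -tactD addNr tact0.
have fsurj y : exists x, f x = y.
  pose q : cube R n := SigSub (mem_set (g'cube _ (qpos_cube y))).
  have : P (s (gh q)) = P y by rewrite sE; exact: g'K.
  move=> /qpos_orbit[t tE]; exists (\pi_(qt_model R xi) (tlin A t, q)).
  rewrite fE /F /= -tlin_comp mulmxV // tlin1 -tE //.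
have /choice[h hK] := fsurj.
exists f, (tlin B); split.
- split=> //; exists h; split=> //; last by move=> x; apply: finj; rewrite hK.
  move=> y; apply: (@compact_cancel_continuous _ _ setT f) => //.
  + exact: qt_hausdorff.
  + have -> : [set: qt_model R xi] = \pi_(qt_model R xi) @` [set: T * cube R n].
      by apply/seteqP; split=> // x _; exists (repr x); rewrite ?reprK.
    apply: continuous_compact; first exact/continuous_subspaceT/pi_continuous.
    by rewrite -setXTT; apply: compact_setX; [exact: torus_compact | exact: cube_compact].
  + exact: continuous_subspaceT.
  + by move=> x _; apply: finj; rewrite hK.
  + by apply: filterS filterT => z _; exists (h z).
- by apply: tlin_aut; rewrite unitmx_inv.
- move=> t x; rewrite -[x]reprK; case: (repr x) => u q.
  rewrite /= qt_model_actE !fE /F /= tlinD tactD //.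
Qed.
End Recognition.

(** * Equivalence of characteristic matrices *)

(** A permutation of the facets induced by a self-homeomorphism of the cube. *)
Definition cube_sym (R : realType) (n : nat) (gam : 'I_(n + n) -> 'I_(n + n)) :
    Prop :=
  injective gam /\ exists g g' : 'rV[R]_n -> 'rV[R]_n,
  [/\ continuous g, forall q, cube R n q -> cube R n (g q),
      forall q, cube R n q -> cube R n (g' q), cancel g g' /\ cancel g' g &
      forall k q, facet k (g q) = facet (gam k) q].

Definition flip_perm (n : nat) (s : {perm 'I_n}) (fl : 'I_n -> bool)
    (k : 'I_(n + n)) : 'I_(n + n) :=
  match fintype.split k with
  | inl i => if fl i then rshift n (s i) else lshift n (s i)
  | inr i => if fl i then lshift n (s i) else rshift n (s i)
  end.

Section CubeSym.
Variables (R : realType) (n : nat).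

Lemma flip_perm_lshift s fl (i : 'I_n) : flip_perm s fl (lshift n i) =
  if fl i then rshift n (s i) else lshift n (s i).
Proof. by rewrite /flip_perm split_lshift. Qed.

Lemma flip_perm_rshift s fl (i : 'I_n) : flip_perm s fl (rshift n i) =
  if fl i then lshift n (s i) else rshift n (s i).
Proof. by rewrite /flip_perm split_rshift. Qed.

Lemma cube_sym_flip_perm (s : {perm 'I_n}) fl : cube_sym R (flip_perm s fl).
Proof.
split.
  move=> k k'; have [i ->|i ->] := fintype.split_ordP k;
    have [j ->|j ->] := fintype.split_ordP k';
    rewrite ?flip_perm_lshift ?flip_perm_rshift.
  - case: ifP => fi; case: ifP => fj /eqP;
      rewrite ?eq_rshift ?eq_lshift ?eq_lrshift ?eq_rlshift // => /eqP/perm_inj ->//.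
  - case: ifP => fi; case: ifP => fj /eqP;
      rewrite ?eq_rshift ?eq_lshift ?eq_lrshift ?eq_rlshift // => /eqP/perm_inj E;
      by move: fi; rewrite E fj.
  - case: ifP => fi; case: ifP => fj /eqP;
      rewrite ?eq_rshift ?eq_lshift ?eq_lrshift ?eq_rlshift // => /eqP/perm_inj E;
      by move: fi; rewrite E fj.
  - case: ifP => fi; case: ifP => fj /eqP;
      rewrite ?eq_rshift ?eq_lshift ?eq_lrshift ?eq_rlshift // => /eqP/perm_inj ->//.
exists (fun q => \row_j if fl j then 1 - q 0 (s j) else q 0 (s j)).
exists (fun q => \row_i let j := (s^-1)%g i in if fl j then 1 - q 0 j else q 0 j).
split.
- move=> q; apply: continuous_mkrow => j; case: (fl j).
    by apply: continuousB; [exact: cst_continuous | exact: coord_row_continuous].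
  exact: coord_row_continuous.
- by move=> q cq j; rewrite mxE; case: ifP => _; have := cq (s j); lra.
- by move=> q cq j; rewrite mxE /=; case: ifP => _; have := cq ((s^-1)%g j); lra.
- split=> q; apply/rowP => j; rewrite !mxE /= ?mxE ?permK ?permKV.
    by case: (fl _) => //; rewrite subKr.
  by case: (fl _) => //; rewrite subKr.
- have h0 (x : R) : (1 - x == 0) = (x == 1) by rewrite subr_eq0 eq_sym.
  have h1 (x : R) : (1 - x == 1) = (x == 0).
    by rewrite -subr_eq0 addrAC subrr sub0r oppr_eq0.
  move=> k q; have [i ->|i ->] := fintype.split_ordP k.
    rewrite flip_perm_lshift facet_lshift mxE.
    by case: ifP => _; rewrite ?facet_rshift ?facet_lshift.
  rewrite flip_perm_rshift facet_rshift mxE.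
  by case: ifP => _; rewrite ?facet_rshift ?facet_lshift.
Qed.

Lemma cube_sym_comp (gam gam' : 'I_(n + n) -> 'I_(n + n)) :
  cube_sym R gam -> cube_sym R gam' -> cube_sym R (gam' \o gam).
Proof.
move=> [gi [g [g' [cg gc gc' [gK gK'] gE]]]].
move=> [hi [h [h' [ch hc hc' [hK hK'] hE]]]].
split; first exact: inj_comp.
exists (g \o h), (h' \o g'); split.
- exact: comp_continuous.
- by move=> q cq; apply/gc/hc.
- by move=> q cq; apply/hc'/gc'.
- by split; exact: can_comp.
- by move=> k q; rewrite /= gE hE.
Qed.
End CubeSym.

(** The operations that do not change the class of the manifold. The matrices
    are transposed, with one row for each facet, so that a change of basis of
    the torus acts on the right. *)
Definition mx_equiv (R : realType) (n : nat) (L L' : 'M[int]_(n + n, n)) : Prop :=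
  exists (gam : 'I_(n + n) -> 'I_(n + n)) (e : 'I_(n + n) -> int) (A : 'M[int]_n),
  [/\ cube_sym R gam, A \in unitmx, forall k, e k = 1 \/ e k = -1 &
      forall k, row (gam k) L' = e k *: row k (L *m A)].

Lemma mx_equiv_trans (R : realType) (n : nat) (L1 L2 L3 : 'M[int]_(n + n, n)) :
  mx_equiv R L1 L2 -> mx_equiv R L2 L3 -> mx_equiv R L1 L3.
Proof.
move=> [g [e [A [cg uA e1 E]]]] [g' [e' [A' [cg' uA' e1' E']]]].
exists (g' \o g), (fun k => e' (g k) * e k), (A *m A'); split.
- exact: cube_sym_comp.
- by rewrite unitmx_mul uA.
- by move=> k; case: (e1 k) => ->; case: (e1' (g k)) => ->; lia.
- by move=> k; rewrite /= E' row_mul E -scalemxAl -row_mul scalerA mulmxA.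
Qed.

Lemma mx_equiv_refl (R : realType) (n : nat) (L : 'M[int]_(n + n, n)) :
  mx_equiv R L L.
Proof.
exists (flip_perm 1%g (fun=> false)), (fun=> 1), 1%:M; split.
- exact: cube_sym_flip_perm.
- exact: unitmx1.
- by left.
move=> k; rewrite mulmx1 scale1r; congr (row _ _).
by have [i ->|i ->] := fintype.split_ordP k;
  rewrite ?flip_perm_lshift ?flip_perm_rshift perm1.
Qed.

(** * Classification of characteristic squares of order 3 *)

(** A square with unit diagonal, by its off-diagonal entries read row by row.
    Tuples make the search computable. *)
Definition sq3 : Type := (int * int * int * int * int * int)%type.

Definition sq_mx (x : sq3) : 'M[int]_3 :=
  let: (a, b, c, d, e, f) := x in
  mx3 [:: [:: 1; a; b]; [:: c; 1; d]; [:: e; f; 1]].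

(** Swap and Neg act on the square by conjugation; Pivot0 exchanges the roles
    of the facets x_0 = 0 and x_0 = 1. *)
Inductive move := Swap01 | Swap12 | Neg0 | Neg1 | Pivot0.

Definition act_move (m : move) (x : sq3) : option sq3 :=
  let: (a, b, c, d, e, f) := x in
  match m with
  | Swap01 => Some (c, d, a, b, f, e)
  | Swap12 => Some (b, a, e, f, c, d)
  | Neg0 => Some (- a, - b, - c, d, - e, f)
  | Neg1 => Some (- a, b, - c, - d, e, - f)
  | Pivot0 =>
      if ((1 - a * c) ^+ 2 == 1) && ((1 - b * e) ^+ 2 == 1) then
        Some ((1 - a * c) * a, (1 - b * e) * b, - c,
              (1 - b * e) * (d - b * c), - e, (1 - a * c) * (f - a * e))
      else None
  end.

Lemma I3P (P : 'I_3 -> Prop) : P 0 -> P 1 -> P 2%:R -> forall i, P i.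
Proof.
move=> p0 p1 p2 [[|[|[|//]]] h].
- by have -> : Ordinal h = 0 by apply: val_inj.
- by have -> : Ordinal h = 1 by apply: val_inj.
- by have -> : Ordinal h = 2%:R by apply: val_inj.
Qed.

Lemma char_lshift n (xi : 'M[int]_n) i j :
  (char_mx xi)^T (lshift n i) j = (j == i)%:R.
Proof. by rewrite mxE row_mxEl mxE. Qed.

Lemma char_rshift n (xi : 'M[int]_n) i j : (char_mx xi)^T (rshift n i) j = xi j i.
Proof. by rewrite mxE row_mxEr. Qed.

Section Moves.
Variable R : realType.
Local Notation L x := (char_mx (sq_mx x))^T.

Lemma sum3 (F : 'I_3 -> int) : \sum_i F i = F 0 + F 1 + F 2%:R.
Proof.
by rewrite !big_ord_recl big_ord0 addr0 addrA; congr (F _ + F _ + F _);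
  apply: val_inj.
Qed.

Lemma swap_equiv (i j : 'I_3) (xi xi' : 'M[int]_3) :
  (forall a b, xi' a b = xi (tperm i j a) (tperm i j b)) ->
  mx_equiv R (char_mx xi)^T (char_mx xi')^T.
Proof.
move=> E; set s := tperm i j in E *.
exists (flip_perm s (fun=> false)), (fun=> 1), (perm_mx s^-1); split.
- exact: cube_sym_flip_perm.
- exact: unitmx_perm.
- by left.
move=> k; rewrite scale1r -col_permE; apply/rowP => l.
rewrite [LHS]mxE [RHS]mxE [RHS]mxE.
have [m ->|m ->] := fintype.split_ordP k.
  rewrite flip_perm_lshift /= !char_lshift; congr (nat_of_bool _)%:R.
  by apply/eqP/eqP => [->|<-]; rewrite tpermK.
by rewrite flip_perm_rshift /= !char_rshift E tpermK.
Qed.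

Lemma neg_equiv (s : 'I_3 -> int) (xi xi' : 'M[int]_3) :
  (forall i, s i = 1 \/ s i = -1) ->
  (forall a b, xi' a b = s a * s b * xi a b) ->
  mx_equiv R (char_mx xi)^T (char_mx xi')^T.
Proof.
move=> s1 E; pose D : 'rV[int]_3 := \row_i s i.
have ss i : s i * s i = 1 by case: (s1 i) => ->.
exists (flip_perm 1%g (fun=> false)),
  (fun k => match fintype.split k with inl i => s i | inr i => s i end), (diag_mx D).
split.
- exact: cube_sym_flip_perm.
- rewrite unitmxE det_diag; apply: rpred_prod => i _; rewrite mxE.
  by case: (s1 i) => ->; rewrite ?unitrN unitr1.
- by move=> k; case: fintype.split => i; exact: s1.
move=> k; rewrite mul_mx_diag; apply/rowP => l.
rewrite [LHS]mxE [RHS]mxE [X in _ * X]mxE [X in _ * X]mxE [D 0 l]mxE.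
have [m ->|m ->] := fintype.split_ordP k.
  rewrite flip_perm_lshift /= perm1 ?split_lshift !char_lshift.
  by case: eqP => [->|_]; rewrite ?mul1r ?ss // mul0r mulr0.
rewrite flip_perm_rshift /= perm1 ?split_rshift !char_rshift E; ring.
Qed.

Lemma sign_sqr (z : int) : z ^+ 2 == 1 -> z = 1 \/ z = -1.
Proof. by rewrite sqrf_eq1 => /orP[] /eqP; [left|right]. Qed.

(** The facets x_0 = 1, x_1 = 0, x_2 = 0 meet at a vertex; writing the other
    characteristic vectors in the basis given by these three, and restoring the
    unit diagonal by signs, gives the new square. The signs are the minors 1 -
    a c and 1 - b e. *)
Lemma pivot_equiv (x y : sq3) : act_move Pivot0 x = Some y ->
  mx_equiv R (L x) (L y).
Proof.
case: x => [[[[[a b] c] d] e] f] /=; case: ifP => // /andP[/sign_sqr s1 /sign_sqr s2].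
move=> [<-]; set u := 1 - a * c in s1 *; set v := 1 - b * e in s2 *.
exists (flip_perm 1%g (fun i => i == 0)),
  (fun k => match fintype.split k with inl i => 1
     | inr i => nth 0 [:: 1; u; v] i end),
  (mx3 [:: [:: 1; - c; - e]; [:: 0; 1; 0]; [:: 0; 0; 1]]).
split.
- exact: cube_sym_flip_perm.
- rewrite unitmxE -det_tr det_trig.
    by apply: rpred_prod; elim/I3P => _; rewrite !mxE.
  apply/is_trig_mxP; elim/I3P; elim/I3P => //; by rewrite !mxE.
- by move=> k; case: fintype.split; [by left|]; elim/I3P => /=; [left| |].
move=> k; apply/rowP => l.
have rowE (M : 'M[int]_(3 + 3, 3)) i : row i M 0 l = M i l by rewrite mxE.
have scE (z : int) (w : 'rV[int]_3) : (z *: w) 0 l = z * w 0 l by rewrite mxE.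
have mulE (M : 'M[int]_(3 + 3, 3)) (N : 'M[int]_3) i :
  (M *m N) i l = M i 0 * N 0 l + M i 1 * N 1 l + M i 2%:R * N 2%:R l.
  by rewrite mxE sum3.
rewrite scE !rowE mulE.
have uE : u = 1 - a * c by []. have vE : v = 1 - b * e by [].
clear rowE scE mulE; clearbody u v.
have [m ->|m ->] := fintype.split_ordP k.
  rewrite flip_perm_lshift ?split_lshift perm1 !char_lshift.
  by elim/I3P: m; elim/I3P: l; rewrite /= ?char_rshift ?char_lshift !mxE /=; ring.
rewrite flip_perm_rshift ?split_rshift perm1 !char_rshift.
elim/I3P: m; elim/I3P: l; rewrite /= ?char_rshift ?char_lshift !mxE /=;
  by case: s1 => s1; case: s2 => s2; move: uE vE; rewrite s1 s2; lia.
Qed.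

Lemma act_move_equiv (m : move) (x y : sq3) : act_move m x = Some y ->
  mx_equiv R (L x) (L y).
Proof.
case: m; last exact: pivot_equiv; case: x => [[[[[a b] c] d] e] f] /= [<-].
- apply: (@swap_equiv 0 1); elim/I3P; elim/I3P;
    by rewrite !permE /= !mxE.
- apply: (@swap_equiv 1 2%:R); elim/I3P; elim/I3P;
    by rewrite !permE /= !mxE.
- apply: (@neg_equiv (fun i => if i == 0 then -1 else 1)).
    by elim/I3P; [right|left|left].
  by elim/I3P; elim/I3P; rewrite !mxE /=; lia.
- apply: (@neg_equiv (fun i => if i == 1 then -1 else 1)).
    by elim/I3P; [left|right|left].
  by elim/I3P; elim/I3P; rewrite !mxE /=; lia.
Qed.
End Moves.

Definition act_word (w : seq move) (x : sq3) : option sq3 :=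
  foldl (fun ox m => obind (act_move m) ox) (Some x) w.

Definition listed : set 'M[int]_3 :=
  A1 `|` A2 `|` A3 `|` [set chi1; chi5; chi6; chi10].

Definition in_listed (x : sq3) : bool :=
  let: (a, b, c, d, e, f) := x in
  [|| [&& c == 0, e == 0 & f == 0], [&& c == 0, e == 0, d == 2 & f == 1],
      [&& a == 0, b == 0, d == 2 & f == 1] |
      x \in [:: (0, 2, 1, 2, 0, 1); (2, 1, 0, 1, 2, 2); (1, 1, 0, 2, 2, 1);
                (2, 2, 0, 2, 1, 1)] ].

Lemma in_listedP (x : sq3) : in_listed x -> listed (sq_mx x).
Proof.
case: x => [[[[[a b] c] d] e] f] /=.
case/or4P => [/and3P[/eqP -> /eqP -> /eqP ->]|/and4P[/eqP -> /eqP -> /eqP -> /eqP ->]|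
  /and4P[/eqP -> /eqP -> /eqP -> /eqP ->]|].
- by left; left; left; exists a, b, d.
- by left; left; right; exists a, b.
- by left; right; exists c, e.
rewrite !inE => /or4P[] /eqP[-> -> -> -> -> ->]; right.
- by left; left; left.
- by left; left; right.
- by left; right.
- by right.
Qed.

Definition swap_words : seq (seq move) :=
  [:: [::]; [:: Swap01]; [:: Swap12]; [:: Swap01; Swap12]; [:: Swap12; Swap01];
      [:: Swap01; Swap12; Swap01]].

Definition pivot_words : seq (seq move) :=
  let p0 := [:: Pivot0] in let p1 := [:: Swap01; Pivot0; Swap01] in
  let p2 := [:: Swap12; Swap01; Pivot0; Swap01; Swap12] in
  [:: [::]; p0; p1; p2; p0 ++ p1; p0 ++ p2; p1 ++ p2; p0 ++ p1 ++ p2].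

Definition sign_words : seq (seq move) := [:: [::]; [:: Neg0]; [:: Neg1]; [:: Neg0; Neg1]].

(** A symmetry of the cube is a set of flips followed by a permutation of the
    coordinates, and it determines the square up to conjugation by signs; two
    signs suffice because a global sign acts trivially. *)
Definition words : seq (seq move) :=
  [seq (ps ++ z)%SEQ | ps <- [seq (p ++ s)%SEQ | p <- pivot_words, s <- swap_words],
     z <- sign_words].

(** Written with [find] because [has], evaluated by value, would run through
    all the words even after a success. *)
Definition reducible (x : sq3) : bool :=
  (find (fun w => if act_word w x is Some y then in_listed y else false) words
    < size words)%N.

(** The principal minors of order 2 are 1 - a c, 1 - b e and 1 - d f; each is a
    unit exactly when the product is 0 or 2. *)
Definition unit_minors (x : sq3) : Prop :=
  let: (a, b, c, d, e, f) := x in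
  [/\ a * c = 0 \/ a * c = 2, b * e = 0 \/ b * e = 2, d * f = 0 \/ d * f = 2 &
      1 - d * f - a * c - b * e + a * d * e + b * c * f = 1 \/
      1 - d * f - a * c - b * e + a * d * e + b * c * f = -1].

(** Every row and every column has a nonzero entry off the diagonal. The other
    squares are covered by the infinite families. *)
Definition mixing (x : sq3) : bool :=
  let: (a, b, c, d, e, f) := x in
  [&& (a != 0) || (b != 0), (c != 0) || (d != 0), (e != 0) || (f != 0),
      (c != 0) || (e != 0), (a != 0) || (f != 0) & (b != 0) || (d != 0)].

Definition small : seq int := [:: 0; 1; 2; 3; 4; -1; -2; -3; -4].

(** The tests are nested, not conjoined, so that the search abandons a partial
    tuple as soon as a minor fails. *)
Definition small_check (a c b e d f : int) : bool :=
  if (d * f == 0) || (d * f == 2) then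
    if `|1 - d * f - a * c - b * e + a * d * e + b * c * f| == 1 then
      if mixing (a, b, c, d, e, f) then reducible (a, b, c, d, e, f) else true
    else true
  else true.

Lemma small_reducible : all (fun a => all (fun c =>
  if (a * c == 0) || (a * c == 2) then all (fun b => all (fun e =>
  if (b * e == 0) || (b * e == 2) then all (fun d => all (fun f =>
    small_check a c b e d f) small) small else true) small) small
  else true) small) small.
Proof. vm_compute. reflexivity. Qed.

Lemma small_mem (z : int) : `|z| <= 4 -> z \in small.
Proof. by rewrite !inE; lia. Qed.

Lemma factor_bound (x y z : int) : y != 0 -> z != 0 -> `|x * y * z| <= 4 -> `|x| <= 4.
Proof.
move=> y0 z0; rewrite !normrM; apply: le_trans.
have : 1 <= `|y| by lia.
have : 1 <= `|z| by lia.
move=> hz hy; rewrite -mulrA ler_peMr //; nia.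
Qed.

Lemma mul_eq2 (x y : int) : x * y = 2 ->
  [\/ x = 2 /\ y = 1, x = 1 /\ y = 2, x = -2 /\ y = -1 | x = -1 /\ y = -2].
Proof.
move=> xy; have y0 : y != 0 by apply/eqP => y0; move: xy; rewrite y0 mulr0.
have x0 : x != 0 by apply/eqP => x0; move: xy; rewrite x0 mul0r.
have nxy : `|x| * `|y| = 2 by rewrite -normrM xy.
have ny : 1 <= `|y| by lia.
have hx : `|x| <= 2 by nia.
have : x = 2 \/ x = 1 \/ x = -2 \/ x = -1 by lia.
by case=> [E|[E|[E|E]]]; rewrite E in xy *; [constructor 1|constructor 2|constructor 3|constructor 4];
  split=> //; lia.
Qed.

(** If the product of an entry a with its mirror image c is 2, then a divides
    2. If instead c = 0, the determinant reduces to a d e = (1 or -1) - 1 + d f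
    + b e, so |a d e| <= 4, while d and e are nonzero as the row or the column
    that they share with c has a nonzero entry off the diagonal. *)
Lemma mixing_small (x : sq3) : unit_minors x -> mixing x ->
  let: (a, b, c, d, e, f) := x in
  [/\ `|a| <= 4, `|b| <= 4, `|c| <= 4 & [/\ `|d| <= 4, `|e| <= 4 & `|f| <= 4]].
Proof.
case: x => [[[[[a b] c] d] e] f] /= [h1 h2 h3 h4].
move=> /and5P[r0 r1 r2 c0 /andP[c1 c2]].
have two (z z' : int) : z * z' = 2 -> `|z| <= 4.
  by move=> /mul_eq2[] [-> _].
have twor (z z' : int) : z * z' = 2 -> `|z'| <= 4 by rewrite mulrC; exact: two.
have zero (z z' : int) : z * z' = 0 -> z = 0 \/ z' = 0.
  by move/eqP; rewrite mulf_eq0 => /orP[] /eqP; [left|right].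
split; last split.
- case: h1 => [/zero[->//|c_0]|/two //].
  apply: (@factor_bound _ d e); [lia|lia|]; subst c; nia.
- case: h2 => [/zero[->//|e_0]|/two //].
  apply: (@factor_bound _ c f); [lia|lia|]; subst e; nia.
- case: h1 => [/zero[a_0|->//]|/twor //].
  apply: (@factor_bound _ b f); [lia|lia|]; subst a; nia.
- case: h3 => [/zero[->//|f_0]|/two //].
  apply: (@factor_bound _ a e); [lia|lia|]; subst f; nia.
- case: h2 => [/zero[b_0|->//]|/twor //].
  apply: (@factor_bound _ a d); [lia|lia|]; subst b; nia.
- case: h3 => [/zero[d_0|->//]|/twor //].
  apply: (@factor_bound _ b c); [lia|lia|]; subst d; nia.
Qed.

Section Classification.
Variable R : realType.
Local Notation L x := (char_mx (sq_mx x))^T.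

Lemma act_word_equiv (w : seq move) (x y : sq3) : act_word w x = Some y ->
  mx_equiv R (L x) (L y).
Proof.
rewrite /act_word; elim/last_ind: w y => [|w m IH] y /=.
  by move=> [->]; exact: mx_equiv_refl.
rewrite foldl_rcons; case E: (foldl _ _ w) => [z|//] /= /act_move_equiv h.
exact: mx_equiv_trans (IH z E) (h R).
Qed.

Definition classified (x : sq3) : Prop :=
  exists2 xi, listed xi & mx_equiv R (L x) (char_mx xi)^T.

Lemma classified_word (w : seq move) (x y : sq3) : act_word w x = Some y ->
  classified y -> classified x.
Proof.
move=> /act_word_equiv h [xi Axi yxi]; exists xi => //; exact: mx_equiv_trans h yxi.
Qed.

Lemma classified_listed (x : sq3) : in_listed x -> classified x.
Proof. by move=> /in_listedP h; exists (sq_mx x) => //; exact: mx_equiv_refl. Qed.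

Lemma reducible_classified (x : sq3) : reducible x -> classified x.
Proof.
rewrite /reducible -has_find; elim: words => //= w s IH /orP[|//].
by case E: act_word => [y|//] /classified_listed; exact: classified_word E.
Qed.

Lemma classified_A1 (a b d : int) : classified (a, b, 0, d, 0, 0).
Proof. exact: classified_listed. Qed.

Lemma classified_A2 (a b : int) : classified (a, b, 0, 2, 0, 1).
Proof. exact: classified_listed. Qed.

Lemma classified_A3 (c e : int) : classified (0, 0, c, 2, e, 1).
Proof. by apply: classified_listed; rewrite /= !orbT. Qed.

Lemma classified_col0 (a b d f : int) : d * f = 0 \/ d * f = 2 ->
  classified (a, b, 0, d, 0, f).
Proof.
case=> [/eqP|/mul_eq2[] [-> ->]].
- rewrite mulf_eq0 => /orP[] /eqP ->; last exact: classified_A1.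
  apply: (@classified_word [:: Swap12]) => //; exact: classified_A1.
- exact: classified_A2.
- apply: (@classified_word [:: Swap12]) => //; exact: classified_A2.
- apply: (@classified_word [:: Neg1]) => //; exact: classified_A2.
- apply: (@classified_word [:: Swap12; Neg1]) => //; exact: classified_A2.
Qed.

Lemma classified_row0 (c d e f : int) : d * f = 0 \/ d * f = 2 ->
  classified (0, 0, c, d, e, f).
Proof.
case=> [/eqP|/mul_eq2[] [-> ->]].
- rewrite mulf_eq0 => /orP[] /eqP ->.
    apply: (@classified_word [:: Swap01; Swap12; Swap01]) => //.
    exact: classified_A1.
  apply: (@classified_word [:: Swap01; Swap12]) => //; exact: classified_A1.
- exact: classified_A3.
- apply: (@classified_word [:: Swap12]) => //; exact: classified_A3.
- apply: (@classified_word [:: Neg1]) => //; exact: classified_A3.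
- apply: (@classified_word [:: Swap12; Neg1]) => //; exact: classified_A3.
Qed.

(** A mixing square is one of finitely many. Otherwise some row or column is
    trivial; a permutation makes it the first one, and the remaining block has
    d f equal to 0 or 2, which leaves the families. *)
Theorem unit_minors_classified (x : sq3) : unit_minors x -> classified x.
Proof.
move=> ux; have [mix|] := boolP (mixing x).
  apply: reducible_classified; have sm := mixing_small ux mix.
  move: sm mix.
  case: x ux => [[[[[a b] c] d] e] f] /= [h1 h2 h3 h4].
  move=> [/small_mem sa /small_mem sb /small_mem sc [/small_mem sd /small_mem se /small_mem sf]] mix.
  have b2 (z : int) : z = 0 \/ z = 2 -> (z == 0) || (z == 2) by case=> ->.
  have := allP (allP small_reducible a sa) c sc; rewrite b2 // => H.
  have := allP (allP H b sb) e se; rewrite b2 // => {}H.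
  have := allP (allP H d sd) f sf; rewrite /small_check b2 //.
  have -> : `|1 - d * f - a * c - b * e + a * d * e + b * c * f| == 1.
    by case: h4 => ->.
  by rewrite /mixing mix.
case: x ux => [[[[[a b] c] d] e] f] [h1 h2 h3 _] /=.
rewrite !negb_and !negb_or !negbK.
case/or4P => [/andP[/eqP -> /eqP ->]|/andP[/eqP -> /eqP ->]|/andP[/eqP -> /eqP ->]|].
- exact: classified_row0.
- apply: (@classified_word [:: Swap01]) => //=; exact: classified_row0.
- apply: (@classified_word [:: Swap12; Swap01]) => //=; exact: classified_row0.
case/or3P => /andP[/eqP -> /eqP ->].
- exact: classified_col0.
- apply: (@classified_word [:: Swap01]) => //=; exact: classified_col0.
- apply: (@classified_word [:: Swap12; Swap01]) => //=; exact: classified_col0.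
Qed.
End Classification.

(** * Unimodular matrices over the 3-cube *)

Lemma det3 (M : 'M[int]_3) : \det M =
  M 0 0 * (M 1 1 * M 2%:R 2%:R - M 1 2%:R * M 2%:R 1)
  - M 0 1 * (M 1 0 * M 2%:R 2%:R - M 1 2%:R * M 2%:R 0)
  + M 0 2%:R * (M 1 0 * M 2%:R 1 - M 1 1 * M 2%:R 0).
Proof.
have E (N : 'M[int]_2) : \det N = N 0 0 * N 1 1 - N 0 1 * N 1 0.
  rewrite (expand_det_row _ 0) !big_ord_recl big_ord0 /cofactor !det_mx11 !mxE /=.
  have -> : lift (0 : 'I_2) 0 = 1 by exact: val_inj.
  have -> : lift (1 : 'I_2) 0 = 0 by exact: val_inj.
  by rewrite expr0 expr1; ring.
rewrite (expand_det_row _ 0) sum3 /cofactor !E !mxE /=.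
have -> : lift (0 : 'I_3) 0 = 1 by exact: val_inj.
have -> : lift (0 : 'I_3) 1 = 2%:R by exact: val_inj.
have -> : lift (1 : 'I_3) 0 = 0 by exact: val_inj.
have -> : lift (1 : 'I_3) 1 = 2%:R by exact: val_inj.
have -> : lift (2%:R : 'I_3) 0 = 0 by exact: val_inj.
have -> : lift (2%:R : 'I_3) 1 = 1 by exact: val_inj.
by rewrite expr0 expr1 expr2; ring.
Qed.

Lemma int_unitP (z : int) : z \is a GRing.unit <-> z = 1 \/ z = -1.
Proof.
split=> [|[] ->]; rewrite ?unitrN ?unitr1 //.
by move=> h; case/orP: (h : (z == 1) || (z == -1)) => /eqP ->; [left|right].
Qed.

Definition vertex (R : realType) (n : nat) (v : 'I_n -> bool) : 'rV[R]_n :=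
  \row_j (v j)%:R.

(** Indexed by coordinates, so that matrices over the facets through a vertex
    are square of order n. *)
Definition vertex_facet (n : nat) (v : 'I_n -> bool) (i : 'I_n) : 'I_(n + n) :=
  if v i then rshift n i else lshift n i.

Section Vertices.
Variables (R : realType) (n : nat).

Lemma vertex_cube (v : 'I_n -> bool) : cube R n (vertex R v).
Proof. by move=> j; rewrite mxE; case: (v j); rewrite ?lexx ?ler01. Qed.

Lemma vertex_facetP (v : 'I_n -> bool) i : facet (vertex_facet v i) (vertex R v).
Proof.
by rewrite /vertex_facet; case: ifP => vi;
  rewrite ?facet_rshift ?facet_lshift mxE vi.
Qed.

Lemma vertex_facet_inj (v : 'I_n -> bool) : injective (vertex_facet v).
Proof.
move=> i j; rewrite /vertex_facet; case: ifP => _; case: ifP => _ /eqP;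
  by rewrite ?eq_rshift ?eq_lshift ?eq_rlshift ?eq_lrshift // => /eqP.
Qed.

(** The two facets of one coordinate are disjoint, so n facets with a common
    point involve each coordinate once: up to order they are the facets through
    a vertex. *)
Lemma char_square_vertices (xi : 'M[int]_n) : (forall i, xi i i = 1) ->
  (forall v, \det (colsub (vertex_facet v) (char_mx xi)) \is a GRing.unit) ->
  char_square R n xi.
Proof.
move=> d1 dv; split=> // f finj [q cq fq]; apply/int_unitP.
pose s i := match fintype.split (f i) with inl j => j | inr j => j end.
pose v i := q 0 i == 1.
have fE i : f i = vertex_facet v (s i).
  have := fq i; rewrite /s /vertex_facet /v.
  have [j ->|j ->] := fintype.split_ordP (f i).
    rewrite ?split_lshift facet_lshift => /eqP ->.
    by rewrite eq_sym oner_eq0.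
  by rewrite ?split_rshift facet_rshift => ->.
have sinj : injective s by move=> i j E; apply: finj; rewrite !fE E.
have -> : colsub f (char_mx xi) =
          col_perm (perm sinj) (colsub (vertex_facet v) (char_mx xi)).
  by apply/matrixP => i j; rewrite !mxE fE permE.
rewrite col_permE det_mulmx det_perm unitrM dv /= unitrX // unitrN unitr1.
Qed.
End Vertices.

Lemma listed_unit_minors (xi : 'M[int]_3) : listed xi ->
  exists2 x, xi = sq_mx x & unit_minors x.
Proof.
case=> [[[[a [b [d ->]]]|[a [b ->]]]|[c [e ->]]]|].
- by exists (a, b, 0, d, 0, 0) => //=; split; lia.
- by exists (a, b, 0, 2, 0, 1) => //=; split; lia.
- by exists (0, 0, c, 2, e, 1) => //=; split; lia.
case=> [[[|]|]|] ->.
- by exists (0, 2, 1, 2, 0, 1) => //=; split; lia.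
- by exists (2, 1, 0, 1, 2, 2) => //=; split; lia.
- by exists (1, 1, 0, 2, 2, 1) => //=; split; lia.
- by exists (2, 2, 0, 2, 1, 1) => //=; split; lia.
Qed.

Lemma unit_minors_char_square (R : realType) (x : sq3) :
  unit_minors x -> char_square R 3 (sq_mx x).
Proof.
move=> ux; apply: char_square_vertices.
  by case: x ux => [[[[[a b] c] d] e] f] _; elim/I3P; rewrite mxE.
move=> v; apply/int_unitP; rewrite -det_tr det3.
have E i j : (colsub (vertex_facet v) (char_mx (sq_mx x)))^T i j =
    if v i then sq_mx x j i else (j == i)%:R.
  rewrite 2!mxE /vertex_facet; case: ifP => _; first by rewrite row_mxEr.
  by rewrite row_mxEl mxE.
rewrite !E; case: x ux {E} => [[[[[a b] c] d] e] f] [h1 h2 h3 h4].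
by case: (v 0); case: (v 1); case: (v 2%:R); rewrite ?mxE /=; lia.
Qed.

Lemma listed_char_square (R : realType) : listed `<=` char_square R 3.
Proof. by move=> xi /listed_unit_minors[x -> /unit_minors_char_square]. Qed.

(** In the basis given by the vertex 0 the matrix becomes the identity on top
    of a square r. The determinant at the vertex v is the principal minor of r
    on the coordinates where v is 1, so all principal minors are units, in
    particular the diagonal entries, which signs turn into 1. *)
Lemma unimodular_classified (R : realType) (L : 'M[int]_(3 + 3, 3)) :
  (forall f : 'I_3 -> 'I_(3 + 3), injective f ->
     (exists2 q, cube R 3 q & forall j, facet (f j) q) -> rowsub f L \in unitmx) ->
  exists2 xi, listed xi & mx_equiv R L (char_mx xi)^T.
Proof.
move=> uL; have uv v : rowsub (vertex_facet v) L \in unitmx.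
  apply: uL; first exact: vertex_facet_inj.
  by exists (vertex R v); [exact: vertex_cube | exact: vertex_facetP].
pose B := rowsub (vertex_facet (fun=> false)) L.
have uB : B \in unitmx by exact: uv.
pose L1 := L *m invmx B.
have L1l i j : L1 (lshift 3 i) j = (j == i)%:R.
  have : (B *m invmx B) i j = L1 (lshift 3 i) j.
    by rewrite !mxE; apply: eq_bigr => k _; rewrite !mxE.
  by move=> <-; rewrite mulmxV // mxE eq_sym.
pose r i j := L1 (rshift 3 i) j.
have dv v : \det (rowsub (vertex_facet v) L1) \is a GRing.unit.
  have -> : rowsub (vertex_facet v) L1 = rowsub (vertex_facet v) L *m invmx B.
    by apply/matrixP => i j; rewrite !mxE; apply: eq_bigr => k _; rewrite !mxE.
  by rewrite -unitmxE unitmx_mul uv unitmx_inv.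
have dE v : let m i j := if v i then r i j else (j == i)%:R in
    m 0 0 * (m 1 1 * m 2%:R 2%:R - m 1 2%:R * m 2%:R 1)
  - m 0 1 * (m 1 0 * m 2%:R 2%:R - m 1 2%:R * m 2%:R 0)
  + m 0 2%:R * (m 1 0 * m 2%:R 1 - m 1 1 * m 2%:R 0) \is a GRing.unit.
  move=> m; have := dv v; rewrite det3.
  have E i j : rowsub (vertex_facet v) L1 i j = m i j.
    by rewrite mxE /vertex_facet /m; case: ifP => _ //; rewrite L1l.
  by rewrite !E.
have r0 := (int_unitP _).1 (dE (fun i => i == 0)).
have r1 := (int_unitP _).1 (dE (fun i => i == 1)).
have r2 := (int_unitP _).1 (dE (fun i => i == 2%:R)).
have r01 := (int_unitP _).1 (dE (fun i => i != 2%:R)).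
have r02 := (int_unitP _).1 (dE (fun i => i != 1)).
have r12 := (int_unitP _).1 (dE (fun i => i != 0)).
have r012 := (int_unitP _).1 (dE (fun i => true)).
move: r0 r1 r2 r01 r02 r12 r012; rewrite /= ?mul0r ?mulr0 ?mul1r ?mulr1 => r0 r1 r2 r01 r02 r12 r012.
pose x : sq3 := (r 1 1 * r 1 0, r 2%:R 2%:R * r 2%:R 0, r 0 0 * r 0 1,
  r 2%:R 2%:R * r 2%:R 1, r 0 0 * r 0 2%:R, r 1 1 * r 1 2%:R).
have q0 : r 0 0 = 1 \/ r 0 0 = -1 by lia.
have q1 : r 1 1 = 1 \/ r 1 1 = -1 by lia.
have q2 : r 2%:R 2%:R = 1 \/ r 2%:R 2%:R = -1 by lia.
have ux : unit_minors x.
  rewrite /x /=; case: q0 r0 r01 r02 r12 r012 => ->; case: q1 => ->; case: q2 => ->;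
    by clear; move=> *; split; lia.
have [xi Axi xiE] := unit_minors_classified R ux.
exists xi => //; apply: mx_equiv_trans xiE.
exists (flip_perm 1%g (fun=> false)),
  (fun k => match fintype.split k with inl i => 1 | inr i => r i i end), (invmx B).
split.
- exact: cube_sym_flip_perm.
- by rewrite unitmx_inv.
- move=> k; case: fintype.split => i; first by left.
  by elim/I3P: i.
move=> k; rewrite -/L1; apply/rowP => l; rewrite [LHS]mxE [RHS]mxE [row k L1 0 l]mxE.
have [m ->|m ->] := fintype.split_ordP k.
  by rewrite flip_perm_lshift ?split_lshift perm1 char_lshift L1l mul1r.
rewrite flip_perm_rshift ?split_rshift perm1 char_rshift -/(r m l).
by elim/I3P: m; elim/I3P: l; rewrite !mxE //=; case: q0 => q; case: q1 => q'; case: q2 => q'';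
  rewrite ?q ?q' ?q''.
Qed.

(** * Smooth functions *)

Section SmoothCalculus.
Variables (R : realType) (V : normedModType R) (U : set V).
Hypothesis oU : open U.
Implicit Types W : normedModType R.

Lemma near_open (x : V) (P : V -> Prop) : U x -> (forall y, U y -> P y) ->
  \forall y \near x, P y.
Proof.
move=> Ux UP; apply: nbhs_sub UP; exact: open_nbhs_nbhs.
Qed.

(** The class Ck is defined by functions on the whole space, while all the
    formulas below hold on U only; so differentiability must be transported
    along equality near a point. It suffices that a function vanishing near a
    point is differentiable there. *)
Lemma differentiable_near_eq W (f g : V -> W) (x : V) :
  (\forall y \near x, f y = g y) -> differentiable f x -> differentiable g x.
Proof.
move=> fg df.
have dz (u : V -> W) : (\forall y \near x, u y = 0) -> differentiable u x.
  move=> u0.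
  have E : u \o shift x = cst (u x) + (\0 : {linear V -> W}) +o_ 0 id.
    apply/eqaddoP => e e0.
    have : \forall h \near (0 : V), u (h + x) = 0.
      have c : {for (0 : V), continuous (fun h : V => h + x)}.
        by apply: continuousD; [exact: cvg_id | exact: cst_continuous].
      apply: (c (fun y => u y = 0)).
      by rewrite add0r.
    move=> /nbhs_sub; apply => h /= uh.
    have ux : u x = 0 by exact: nbhs_singleton u0.
    rewrite !fctE /= uh ux addr0 subr0 normr0.
    by rewrite mulr_ge0 // ltW.
  apply/diff_locallyP.
  have D0 : 'd u x = (\0 : {linear V -> W}) :> (V -> W).
    by apply: diff_unique E; exact: cst_continuous.
  split; first by rewrite D0; exact: cst_continuous.
  by rewrite E D0.
have -> : g = f + (fun y => g y - f y).
  by apply/funext => y; rewrite fctE addrC subrK.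
apply: differentiableD => //; apply: dz.
by move: fg => /nbhs_sub; apply => y /= ->; rewrite subrr.
Qed.

Lemma Ck_ext W k (f g : V -> W) : (forall x, U x -> f x = g x) ->
  Ck k f U -> Ck k g U.
Proof.
elim: k f g => [|k IH] f g fg /=.
  move=> cf x Ux; move: (cf x Ux).
  have fgx : \forall y \near x, f y = g y by apply: near_open Ux _.
  move=> cfx; have : g y @[y --> x] --> f x.
    by apply: cvg_trans cfx; exact: near_eq_cvg.
  by rewrite (fg x Ux).
move=> [df Cf]; split=> [x Ux|v].
  apply: differentiable_near_eq (df x Ux); exact: near_open.
apply: IH (Cf v) => x Ux; apply: near_eq_derive; exact: near_open.
Qed.

Lemma CkW W k (f : V -> W) : Ck k.+1 f U -> Ck k f U.
Proof.
elim: k f => [|k IH] f [df Cf].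
  by move=> x Ux; apply: differentiable_continuous; exact: df.
by split=> // v; apply: IH.
Qed.

Lemma Ck_cst W k (w : W) : Ck k (fun _ : V => w) U.
Proof.
elim: k w => [|k IH] w /=; first by move=> x _; exact: cst_continuous.
split=> [x _|v]; first exact: differentiable_cst.
apply: Ck_ext (IH 0) => x _; by rewrite (derive_cst w).
Qed.

Lemma CkD W k (f g : V -> W) : Ck k f U -> Ck k g U ->
  Ck k (fun x => f x + g x) U.
Proof.
elim: k f g => [|k IH] f g.
  move=> cf cg x Ux; exact: (cvgD (cf x Ux) (cg x Ux)).
move=> [df Cf] [dg Cg]; split=> [x Ux|v].
  by apply: differentiableD; [exact: df | exact: dg].
apply: Ck_ext (IH _ _ (Cf v) (Cg v)) => x Ux.
by rewrite deriveD //; apply: diff_derivable; [exact: df | exact: dg].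
Qed.

Lemma CkM k (f g : V -> R) : Ck k f U -> Ck k g U -> Ck k (fun x => f x * g x) U.
Proof.
elim: k f g => [|k IH] f g.
  move=> cf cg x Ux; exact: (cvgM (cf x Ux) (cg x Ux)).
move=> Hf Hg; have [df Cf] := Hf; have [dg Cg] := Hg.
split=> [x Ux|v].
  by apply: differentiableM; [exact: df | exact: dg].
apply: Ck_ext (CkD (IH _ _ (CkW Hf) (Cg v)) (IH _ _ (CkW Hg) (Cf v))) => x Ux.
by rewrite deriveM //; apply: diff_derivable; [exact: df | exact: dg].
Qed.

Lemma Ck_scale W k (f : V -> R) (w : W) : Ck k f U -> Ck k (fun x => f x *: w) U.
Proof.
elim: k f => [|k IH] f.
  by move=> cf x Ux; apply: cvgZr_tmp; exact: cf.
move=> [df Cf]; have dfw x : U x -> differentiable (fun x => f x *: w) x.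
  by move=> Ux; apply: differentiableZl; exact: df.
split=> // v.
apply: Ck_ext (IH _ (Cf v)) => x Ux.
rewrite [RHS]deriveE; last exact: dfw.
by rewrite (@diffZl _ _ _ f w x (df x Ux)) deriveE //; exact: df.
Qed.

Lemma derive_comp1 (f : V -> R) (g : R -> R) (x v : V) (dg : R) :
  differentiable f x -> is_derive (f x) 1 g dg ->
  'D_v (g \o f) x = dg * 'D_v f x /\ differentiable (g \o f) x.
Proof.
move=> df [dgx dgE]; have dgd : differentiable g (f x) by apply/derivable1_diffP.
have dgf : differentiable (g \o f) x by exact: differentiable_comp.
split=> //; rewrite deriveE // diff_comp // /= deriveE //.
by rewrite deriv1E //= derive1E dgE /= mulrC.
Qed.

Lemma Ck_cos_sin k (f : V -> R) : Ck k f U ->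
  Ck k (fun x => cos (f x)) U /\ Ck k (fun x => sin (f x)) U.
Proof.
elim: k f => [|k IH] f.
  move=> cf; split=> x Ux.
    apply: (@continuous_comp _ _ _ f (@cos R)); first exact: cf.
    exact: continuous_cos.
  apply: (@continuous_comp _ _ _ f (@sin R)); first exact: cf.
  exact: continuous_sin.
move=> Hf; have [df Cf] := Hf; have [Cc Cs] := IH _ (CkW Hf).
have H1 x v (Ux : U x) := derive_comp1 v (df x Ux) (is_derive_cos (f x)).
have H2 x v (Ux : U x) := derive_comp1 v (df x Ux) (is_derive_sin (f x)).
split; split=> [x Ux|v].
- exact: (H1 x 0 Ux).2.
- apply: Ck_ext (CkM (@Ck_cst R k (-1)) (CkM Cs (Cf v))) => x Ux.
  by rewrite mulN1r; have [-> _] := H1 x v Ux; rewrite mulNr.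
- exact: (H2 x 0 Ux).2.
- apply: Ck_ext (CkM Cc (Cf v)) => x Ux.
  by have [-> _] := H2 x v Ux.
Qed.

(** The derivative of f^(-1/2) is -1/2 f^(-3/2) f', a polynomial in f^(-1/2)
    and f', which is what makes the induction on the order close up. *)
Lemma Ck_rsqrt k (f : V -> R) : (forall x, U x -> 0 < f x) -> Ck k f U ->
  Ck k (fun x => (Num.sqrt (f x))^-1) U.
Proof.
move=> f0; have s0 x : U x -> Num.sqrt (f x) != 0.
  by move=> Ux; rewrite sqrtr_eq0 -ltNge f0.
elim: k => [|k IH].
  move=> cf x Ux; apply: (@cvgV _ _ _ _ (fun x => Num.sqrt (f x))); first exact: s0.
  apply: (@continuous_comp _ _ _ f (@Num.sqrt R)); first exact: cf.
  exact: sqrt_continuous.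
move=> Hf; have [df Cf] := Hf; have Ci := IH (CkW Hf).
have H x v (Ux : U x) := derive_comp1 v (df x Ux) (is_derive1_sqrt (f0 x Ux)).
split=> [x Ux|v].
  apply: (@differentiableV _ _ (fun x => Num.sqrt (f x))); last exact: s0.
  exact: (H x 0 Ux).2.
apply: Ck_ext (CkM (@Ck_cst R k (- 2^-1)) (CkM (CkM Ci (CkM Ci Ci)) (Cf v))) => x Ux.
have [E D] := H x v Ux.
rewrite (@deriveV _ _ (fun x => Num.sqrt (f x))); last first.
- exact: diff_derivable.
- exact: s0.
rewrite [X in _ *: X]E /GRing.scale /=; have := s0 x Ux.
by set s := Num.sqrt _ => sn0; field.
Qed.

Lemma smooth_cst W (w : W) : smooth (fun _ : V => w) U.
Proof. by move=> k; exact: Ck_cst. Qed.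

Lemma smoothD W (f g : V -> W) : smooth f U -> smooth g U ->
  smooth (fun x => f x + g x) U.
Proof. by move=> sf sg k; exact: CkD. Qed.

Lemma smoothM (f g : V -> R) : smooth f U -> smooth g U ->
  smooth (fun x => f x * g x) U.
Proof. by move=> sf sg k; exact: CkM. Qed.

Lemma smoothN (f : V -> R) : smooth f U -> smooth (fun x => - f x) U.
Proof.
move=> sf k; apply: Ck_ext (CkM (@Ck_cst R k (-1)) (sf k)) => x _.
by rewrite mulN1r.
Qed.

Lemma smooth_ext W (f g : V -> W) : (forall x, U x -> f x = g x) ->
  smooth f U -> smooth g U.
Proof. by move=> fg sf k; exact: Ck_ext (sf k). Qed.

Lemma smooth_sum W (I : Type) (s : seq I) (f : I -> V -> W) :
  (forall i, smooth (f i) U) -> smooth (fun x => \sum_(i <- s) f i x) U.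
Proof.
move=> sf; elim: s => [|i s IH].
  by apply: smooth_ext (@smooth_cst W 0) => x _; rewrite big_nil.
by apply: smooth_ext (smoothD (sf i) IH) => x _; rewrite big_cons.
Qed.

Lemma smooth_linear (f : V -> R) : continuous f ->
  (forall (a : R) u v, f (a *: u + v) = a * f u + f v) -> smooth f U.
Proof.
move=> cf lf [|k]; first by move=> x _; exact: cf.
pose L : {linear V -> R} := HB.pack f (GRing.isLinear.Build R V R _ f lf).
have dL x : differentiable L x by exact: linear_differentiable.
split=> [x _|v]; first exact: dL.
apply: Ck_ext (Ck_cst k (f v)) => x _.
rewrite [RHS]deriveE; last exact: dL.
by rewrite (@diff_lin _ _ _ L).
Qed.

Lemma smooth_Cn (n : nat) (f g : 'I_n -> V -> R) :
  (forall j, smooth (f j) U) -> (forall j, smooth (g j) U) ->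
  smooth (fun x => (\row_j f j x, \row_j g j x) : Cn R n) U.
Proof.
move=> sf sg.
pose e j : Cn R n := (delta_mx 0 j, 0); pose e' j : Cn R n := (0, delta_mx 0 j).
apply: (@smooth_ext (Cn R n) (fun x =>
  \sum_(j <- index_enum _) (f j x *: e j + g j x *: e' j))) => [x _|].
  rewrite big_split /=.
  have E1 : \sum_(j <- index_enum _) f j x *: e j = (\row_j f j x, 0).
    rewrite [RHS](_ : _ = ((\sum_j f j x *: delta_mx 0 j : 'rV[R]_n), 0)).
      by elim/big_rec2: _ => // j y1 y2 _ ->; rewrite /e; congr pair;
         rewrite /= ?scaler0 ?addr0.
    congr pair; rewrite [LHS]row_sum_delta; by apply: eq_bigr => j _; rewrite mxE.
  have E2 : \sum_(j <- index_enum _) g j x *: e' j = (0, \row_j g j x).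
    rewrite [RHS](_ : _ = (0, (\sum_j g j x *: delta_mx 0 j : 'rV[R]_n))).
      by elim/big_rec2: _ => // j y1 y2 _ ->; rewrite /e'; congr pair;
         rewrite /= ?scaler0 ?addr0.
    congr pair; rewrite [LHS]row_sum_delta; by apply: eq_bigr => j _; rewrite mxE.
  rewrite E1 E2; congr pair; rewrite /= ?addr0 ?add0r //.
apply: smooth_sum => j; apply: smoothD => k; apply: Ck_scale; [exact: sf | exact: sg].
Qed.

(** Angles are measured in turns. An argument function need not be continuous,
    but its cosine and sine can be smooth, and this property is stable under
    sums and integer multiples. *)
Definition smooth_angle (th : V -> R) : Prop :=
  smooth (fun x => cos (2 * pi * th x)) U /\ smooth (fun x => sin (2 * pi * th x)) U.

Lemma smooth_angle0 : smooth_angle (fun=> 0).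
Proof. by split; exact: smooth_cst. Qed.

Lemma smooth_angleD th th' : smooth_angle th -> smooth_angle th' ->
  smooth_angle (fun x => th x + th' x).
Proof.
move=> [c1 s1] [c2 s2]; split.
  apply: smooth_ext (smoothD (smoothM c1 c2) (smoothN (smoothM s1 s2))) => x _.
  by rewrite [2 * pi * (_ + _)]mulrDr cosD.
apply: smooth_ext (smoothD (smoothM s1 c2) (smoothM c1 s2)) => x _.
by rewrite [2 * pi * (_ + _)]mulrDr sinD.
Qed.

Lemma smooth_angleN th : smooth_angle th -> smooth_angle (fun x => - th x).
Proof.
move=> [c1 s1]; split.
  by apply: smooth_ext c1 => x _; rewrite mulrN cosN.
by apply: smooth_ext (smoothN s1) => x _; rewrite mulrN sinN.
Qed.

Lemma smooth_angle_int th (m : int) : smooth_angle th ->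
  smooth_angle (fun x => th x * m%:~R).
Proof.
move=> sth; have sn (p : nat) : smooth_angle (fun x => th x * p%:R).
  elim: p => [|p IH].
    have -> : (fun x => th x * 0%:R) = (fun=> 0) by apply/funext => x; rewrite mulr0.
    exact: smooth_angle0.
  have -> : (fun x => th x * p.+1%:R) = (fun x => th x * p%:R + th x).
    by apply/funext => x; rewrite -natr1 mulrDr mulr1.
  exact: smooth_angleD.
case: m => p; first exact: sn.
have -> : (fun x => th x * (Negz p)%:~R) = (fun x => - (th x * p.+1%:R)).
  by apply/funext => x; rewrite NegzE mulrNz mulrN.
exact: smooth_angleN.
Qed.

Lemma smooth_angle_sum (I : Type) (s : seq I) (P : pred I) (th : I -> V -> R) :
  (forall i, P i -> smooth_angle (th i)) ->
  smooth_angle (fun x => \sum_(i <- s | P i) th i x).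
Proof.
move=> sth; elim: s => [|i s IH].
  have -> : (fun x => \sum_(i <- [::] | P i) th i x) = (fun=> 0).
    by apply/funext => x; rewrite big_nil.
  exact: smooth_angle0.
case Pi: (P i).
  have -> : (fun x => \sum_(j <- i :: s | P j) th j x) =
            (fun x => th i x + \sum_(j <- s | P j) th j x).
    by apply/funext => x; rewrite big_cons Pi.
  by apply: smooth_angleD => //; exact: sth.
have -> : (fun x => \sum_(j <- i :: s | P j) th j x) =
          (fun x => \sum_(j <- s | P j) th j x).
  by apply/funext => x; rewrite big_cons Pi.
exact: IH.
Qed.

Lemma smooth_angle_smooth (th : V -> R) : smooth th U -> smooth_angle th.
Proof.
move=> sth; have s2 : smooth (fun x => 2 * pi * th x) U.
  by apply: smoothM => //; exact: smooth_cst.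
by split=> k; have [] := Ck_cos_sin (s2 k).
Qed.

(** The cosine and the sine of the argument are the coordinates divided by the
    modulus, which does not vanish. *)
Lemma smooth_angle_arg (X Y th : V -> R) :
  smooth X U -> smooth Y U -> (forall x, U x -> X x ^+ 2 + Y x ^+ 2 > 0) ->
  (forall x, U x -> X x = Num.sqrt (X x ^+ 2 + Y x ^+ 2) * cos (2 * pi * th x)) ->
  (forall x, U x -> Y x = Num.sqrt (X x ^+ 2 + Y x ^+ 2) * sin (2 * pi * th x)) ->
  smooth_angle th.
Proof.
move=> sX sY p0 hX hY.
have sS : smooth (fun x => X x ^+ 2 + Y x ^+ 2) U.
  by apply: smoothD; apply: smoothM.
have sI : smooth (fun x => (Num.sqrt (X x ^+ 2 + Y x ^+ 2))^-1) U.
  by move=> k; apply: Ck_rsqrt.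
have n0 x : U x -> Num.sqrt (X x ^+ 2 + Y x ^+ 2) != 0.
  by move=> Ux; rewrite sqrtr_eq0 -ltNge p0.
split.
  apply: smooth_ext (smoothM sI sX) => x Ux.
  by rewrite [X x in X in _ * X]hX // mulKf // n0.
apply: smooth_ext (smoothM sI sY) => x Ux.
by rewrite [Y x in X in _ * X]hY // mulKf // n0.
Qed.
End SmoothCalculus.

(** * Charts of the model manifold at the vertices *)

Section VertexCharts.
Variables (R : realType) (n : nat) (xi : 'M[int]_n).
Local Notation T := (torus R n).
Local Notation piT := (\pi_(torus R n)).
Local Notation X := (qt_model R xi).
Local Notation piX := (\pi_(qt_model R xi)).
Implicit Types (v w : 'I_n -> bool) (q : 'rV[R]_n) (z : Cn R n) (t : T).

(** The characteristic vectors of the facets through v, as rows. Its inverse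
    sends these vectors to the coordinate vectors, so it turns the collapsed
    subtori into coordinate subtori. *)
Definition vertex_basis v : 'M[int]_n := rowsub (vertex_facet v) (char_mx xi)^T.
Definition vertex_dual v : 'M[int]_n := invmx (vertex_basis v).

Hypothesis ubasis : forall v, vertex_basis v \in unitmx.

Definition vheight v j q : R := fheight (vertex_facet v j) q.

Lemma vheightE v j q : vheight v j q = if v j then 1 - q 0 j else q 0 j.
Proof.
rewrite /vheight /fheight /vertex_facet; case: (v j).
  by rewrite split_rshift.
by rewrite split_lshift.
Qed.

Lemma vheight_ge0 v j q : cube R n q -> 0 <= vheight v j q.
Proof. exact: fheight_ge0. Qed.

(** In the cube, the complement of the facets that do not pass through v. *)
Definition near_vertex v : set 'rV[R]_n := [set q | forall j, vheight v j q < 1].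

Lemma near_vertex_exists q : cube R n q -> near_vertex (fun j => q 0 j != 0) q.
Proof.
move=> cq j; rewrite vheightE; have /andP[q0 _] := cq j.
case: eqP => [->|/eqP nq] /=; first exact: ltr01.
by rewrite gtrBl lt0r nq.
Qed.

Lemma near_vertex_facet v q k : near_vertex v q -> facet k q ->
  exists j, k = vertex_facet v j.
Proof.
move=> nq fk; rewrite /vertex_facet.
have [j kE|j kE] := fintype.split_ordP k; exists j; have := nq j;
  rewrite vheightE; move: fk; rewrite kE ?facet_lshift ?facet_rshift;
  case: (v j) => // /eqP ->; by rewrite ?subr0 ltxx.
Qed.

(** The bijection h |-> sqrt (h / (1 - h)) from [0, 1[ to [0, +oo[ makes the
    chart onto C^n, and turns the change of facet h |-> 1 - h into r |-> 1 / r.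
    *)
Definition vradius v q : 'rV[R]_n :=
  \row_j Num.sqrt (vheight v j q / (1 - vheight v j q)).

Lemma vradius_ge0 v q j : 0 <= vradius v q 0 j.
Proof. by rewrite mxE sqrtr_ge0. Qed.

Lemma vradius_eq0 v q j : cube R n q -> near_vertex v q ->
  (vradius v q 0 j == 0) = facet (vertex_facet v j) q.
Proof.
move=> cq nq; have h0 := vheight_ge0 v j cq; have h1 := nq j.
have d0 : 0 < 1 - vheight v j q by rewrite subr_gt0.
rewrite mxE sqrtr_eq0 facetE -/(vheight v j q).
rewrite ler_pdivrMr // mul0r eq_le h0 andbT //.
Qed.

(** Near v only facets through v occur, so the collapsed subtorus is spanned by
    part of a basis. *)
Lemma vertex_span v q u : cube R n q -> near_vertex v q ->
  subtorus xi q (piT u) <->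
  forall j, ~~ facet (vertex_facet v j) q ->
    (u *m realmx R (vertex_dual v)) 0 j \is a Num.int.
Proof.
move=> cq nq; rewrite subtorus_tlin.
rewrite (@unimodular_span R n (vertex_dual v) (fun j => facet (vertex_facet v j) q));
  last by rewrite unitmx_inv.
rewrite /vertex_dual invmxK.
have reindex (s : 'I_(n + n) -> R) :
    \sum_(k | facet k q) s k *: row k (realmx R (char_mx xi)^T) =
    \sum_(j | facet (vertex_facet v j) q) s (vertex_facet v j) *:
      row j (realmx R (vertex_basis v)).
  pose Z := [set j | facet (vertex_facet v j) q]%SET.
  rewrite (eq_bigl (fun k => k \in vertex_facet v @: Z)) => [|k].
    rewrite big_imset /=; last by move=> i j _ _; exact: vertex_facet_inj.
    rewrite (eq_bigl (fun j => facet (vertex_facet v j) q)) => [|j].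
      by apply: eq_bigr => j _; congr (_ *: _); apply/rowP => i; rewrite !mxE.
    by rewrite inE.
  apply/idP/imsetP => [fk|[j]]; last by rewrite inE => fj ->.
  have [j kE] := near_vertex_facet nq fk; exists j => //.
  by rewrite inE -kE.
split=> -[s sE].
  by exists (fun j => s (vertex_facet v j)); rewrite sE reindex.
have /choice[s' s'P] : forall k, exists r : R,
    forall j, k = vertex_facet v j -> r = s j.
  move=> k; have [[j ->]|nk] := pselect (exists j, k = vertex_facet v j).
    by exists (s j) => i /vertex_facet_inj ->.
  by exists 0 => j kE; case: nk; exists j.
exists s'; rewrite sE reindex; congr (piT _); apply: eq_bigr => j _.
by rewrite (s'P _ j).
Qed.

Lemma subtorus_fix v q t : cube R n q -> near_vertex v q ->
  subtorus xi q t <->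
  std_act (tlin (vertex_dual v) t) (realpt (vradius v q)) = realpt (vradius v q).
Proof.
move=> cq nq; rewrite -[t]reprK tlinE std_act_fix (vertex_span _ cq nq).
have zE j : Cn_zero (realpt (vradius v q)) j = facet (vertex_facet v j) q.
  rewrite -(vradius_eq0 j cq nq) /Cn_zero /realpt /= [(0 : 'rV_n) 0 j]mxE.
  by rewrite eqxx andbT.
by split=> h j; have := h j; rewrite zE.
Qed.

Definition model_proj (x : X) : cube R n := (repr x).2.

Lemma model_projE (p : T * cube R n) : model_proj (piX p) = p.2.
Proof. by rewrite /model_proj; case: piP => p' /eqmodP/asboolP[-> _]. Qed.

Lemma model_proj_continuous : continuous model_proj.
Proof.
apply/quotient_continuous.
have -> : model_proj \o piX = snd by apply/funext => p; exact: model_projE.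
by move=> p; exact: cvg_snd.
Qed.

Definition model_pos (x : X) : 'rV[R]_n := set_val (model_proj x).

Lemma model_pos_continuous : continuous model_pos.
Proof. exact: comp_continuous model_proj_continuous (@cube_val_continuous R n). Qed.

Lemma model_pos_cube x : cube R n (model_pos x).
Proof. exact: set_valP. Qed.

Lemma model_posE t (q : cube R n) : model_pos (piX (t, q)) = set_val q.
Proof. by rewrite /model_pos model_projE. Qed.

Lemma model_pos_act t x : model_pos (qt_model_act t x) = model_pos x.
Proof.
by rewrite -[x]reprK; case: (repr x) => s q; rewrite qt_model_actE !model_posE.
Qed.

Lemma model_compact : compact [set: X].
Proof.
have -> : [set: X] = piX @` [set: T * cube R n].
  by apply/seteqP; split=> // x _; exists (repr x); rewrite ?reprK.
apply: continuous_compact; first exact/continuous_subspaceT/pi_continuous.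
by rewrite -setXTT; apply: compact_setX; [exact: torus_compact | exact: cube_compact].
Qed.

Definition vdom v : set X := model_pos @^-1` near_vertex v.

Lemma near_vertex_open v : open (near_vertex v).
Proof.
rewrite openE => q nq; rewrite /interior.
have : \forall y \near q, forall j, vheight v j y < 1; last by [].
apply: near_forall => j.
have c : {for q, continuous (vheight v j)} by exact: fheight_continuous.
have := @cvgr_lt _ _ _ _ (vheight v j) _ c 1 (nq j); exact.
Qed.

Lemma vdom_open v : open (vdom v).
Proof.
by apply: open_comp => [x _|]; [exact: model_pos_continuous|exact: near_vertex_open].
Qed.

Lemma vdom_exists x : exists v, vdom v x.
Proof. by eexists; apply: near_vertex_exists; exact: model_pos_cube. Qed.

Lemma vdom_act v t x : vdom v x -> vdom v (qt_model_act t x).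
Proof. by rewrite /vdom /= model_pos_act. Qed.

Definition vpolar v (p : T * cube R n) : Cn R n :=
  std_act (tlin (vertex_dual v) p.1) (realpt (vradius v (set_val p.2))).

(** Defined through a representative; [vchartE] shows that near v any
    representative gives the same value. *)
Definition vchart v (x : X) : Cn R n := vpolar v (repr x).

Lemma vchartE v t (q : cube R n) : near_vertex v (set_val q) ->
  vchart v (piX (t, q)) = vpolar v (t, q).
Proof.
move=> nq; rewrite /vchart; case: piP => -[t' q'] /eqmodP/asboolP[/= E].
rewrite -E => /(subtorus_fix _ (set_valP q) nq) h.
by rewrite /vpolar /= -[t](subrK t') tlinD addrC std_actD h.
Qed.

Lemma vchart_act v t x : vdom v x ->
  vchart v (qt_model_act t x) = std_act (tlin (vertex_dual v) t) (vchart v x).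
Proof.
rewrite -[x]reprK; case: (repr x) => s q; rewrite qt_model_actE.
rewrite /vdom /= model_posE => nq.
by rewrite !vchartE // /vpolar /= tlinD std_actD.
Qed.

Definition sqnorm z j : R := z.1 0 j ^+ 2 + z.2 0 j ^+ 2.

Lemma sqnorm_ge0 z j : 0 <= sqnorm z j.
Proof. by rewrite addr_ge0 ?sqr_ge0. Qed.

Lemma sqnorm_cabs z j : sqnorm z j = cabs z 0 j ^+ 2.
Proof. by rewrite mxE sqr_sqrtr // sqnorm_ge0. Qed.

Lemma sqnorm_eq0 z j : (sqnorm z j == 0) = Cn_zero z j.
Proof. by rewrite sqnorm_cabs sqrf_eq0 cabs_eq0. Qed.

(** The inverse of [vradius]: r^2 / (1 + r^2) is the height with radius r. *)
Definition vpos v z : 'rV[R]_n := \row_j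
  (let h := sqnorm z j / (1 + sqnorm z j) in if v j then 1 - h else h).

Lemma sqnorm1_gt0 z j : 0 < 1 + sqnorm z j.
Proof. by rewrite ltr_pwDl // sqnorm_ge0. Qed.

Lemma vheight_vpos v w z j : vheight w j (vpos v z) =
  if v j == w j then sqnorm z j / (1 + sqnorm z j) else 1 / (1 + sqnorm z j).
Proof.
rewrite vheightE mxE /=; have := lt0r_neq0 (sqnorm1_gt0 z j).
by set s := sqnorm z j => s0; case: (v j); case: (w j) => /=; field.
Qed.

Lemma vpos_cube v z : cube R n (vpos v z).
Proof.
move=> j; rewrite mxE /=; have s0 := sqnorm_ge0 z j; have s1 := sqnorm1_gt0 z j.
have h0 : 0 <= sqnorm z j / (1 + sqnorm z j) by rewrite divr_ge0 // ltW.
have h1 : sqnorm z j / (1 + sqnorm z j) <= 1.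
  by rewrite ler_pdivrMr // mul1r lerDr.
by case: (v j); lra.
Qed.

Lemma vpos_near v w z : near_vertex w (vpos v z) <->
  forall j, v j != w j -> ~~ Cn_zero z j.
Proof.
have s1 j := sqnorm1_gt0 z j; have s0 j := sqnorm_ge0 z j.
split=> h j.
  move=> vw; have := h j; rewrite vheight_vpos (negPf vw).
  rewrite ltr_pdivrMr // mul1r -sqnorm_eq0; have := s0 j.
  by move=> ?; apply: contraTN => /eqP ->; rewrite addr0 ltxx.
rewrite vheight_vpos; case: eqP => [_|/eqP/h].
  by rewrite ltr_pdivrMr // mul1r ltrDr.
rewrite -sqnorm_eq0 => sn; rewrite ltr_pdivrMr // mul1r.
by rewrite ltrDl lt0r sn s0.
Qed.

Lemma vpos_near_self v z : near_vertex v (vpos v z).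
Proof. by apply/vpos_near => j; rewrite eqxx. Qed.

Lemma vradius_vpos v w z j : vradius w (vpos v z) 0 j =
  if v j == w j then cabs z 0 j else (cabs z 0 j)^-1.
Proof.
rewrite mxE vheight_vpos [cabs z 0 j]mxE -/(sqnorm z j).
have := lt0r_neq0 (sqnorm1_gt0 z j); have := sqnorm_ge0 z j.
set s := sqnorm z j => s0 s1; case: eqP => _.
  by congr Num.sqrt; field; rewrite s1; apply/eqP; lra.
rewrite -sqrtrV //; congr Num.sqrt.
have [->|sn] := eqVneq s 0; first by rewrite addr0 divr1 subrr invr0 mulr0.
have -> : 1 - 1 / (1 + s) = s / (1 + s) by field.
by field; rewrite s1 sn.
Qed.

(** Arguments of the coordinates. They are chosen arbitrarily, also where a
    coordinate vanishes; the choice disappears in the quotient. *)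
Definition carg z : T := projT1 (cid (polar z)).

Lemma cargP z : z = std_act (carg z) (realpt (cabs z)).
Proof. exact: (projT2 (cid (polar z))). Qed.

Definition vpos_cubeT v z : cube R n := SigSub (mem_set (vpos_cube v z)).

Definition vinv v z : X := piX (tlin (vertex_basis v) (carg z), vpos_cubeT v z).

Lemma vinv_pos v z : model_pos (vinv v z) = vpos v z.
Proof. by rewrite model_posE. Qed.

Lemma vinv_dom v w z : vdom w (vinv v z) <-> forall j, v j != w j -> ~~ Cn_zero z j.
Proof. by rewrite /vdom /= vinv_pos vpos_near. Qed.

Lemma vinv_vdom v z : vdom v (vinv v z).
Proof. by apply/vinv_dom => j; rewrite eqxx. Qed.

Lemma vradius_self v z : vradius v (vpos v z) = cabs z.
Proof. by apply/rowP => j; rewrite vradius_vpos eqxx. Qed.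

Lemma vinvK v z : vchart v (vinv v z) = z.
Proof.
rewrite vchartE; last exact: vpos_near_self.
rewrite /vpolar /= -tlin_comp mulmxV // tlin1.
by rewrite [realpt _](_ : _ = realpt (cabs z)) -?cargP // vradius_self.
Qed.

Lemma vchart_cabs v t (q : cube R n) : near_vertex v (set_val q) ->
  cabs (vchart v (piX (t, q))) = vradius v (set_val q).
Proof.
move=> nq; rewrite vchartE // /vpolar cabs_act cabs_realpt // => j.
exact: vradius_ge0.
Qed.

Lemma vpos_vchart v x : vdom v x -> vpos v (vchart v x) = model_pos x.
Proof.
rewrite -[x]reprK; case: (repr x) => t q; rewrite /vdom /= model_posE => nq.
apply/rowP => j; rewrite mxE /= sqnorm_cabs vchart_cabs //.
have h0 := vheight_ge0 v j (set_valP q); have h1 := nq j.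
have d0 : 1 - vheight v j (set_val q) != 0 by rewrite subr_eq0 eq_sym lt_eqF.
rewrite mxE sqr_sqrtr; last by rewrite divr_ge0 // subr_ge0 ltW.
rewrite [X in if _ then 1 - X else X](_ : _ = vheight v j (set_val q)).
  rewrite vheightE; case: (v j) => //; by rewrite subKr.
move: d0; set h := vheight _ _ _ => d0; field.
rewrite d0 /=; have -> : 1 - h + h = 1 by rewrite subrK.
exact: oner_neq0.
Qed.

Lemma vchartK v x : vdom v x -> vinv v (vchart v x) = x.
Proof.
move=> dx; have := vpos_vchart dx; move: dx.
rewrite -[x]reprK; case: (repr x) => t q; rewrite /vdom /= model_posE => nq pE.
have qE : vpos_cubeT v (vchart v (piX (t, q))) = q by exact: val_inj.
apply/eqmodP/asboolP; split; first exact: qE.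
rewrite /= qE; apply/(subtorus_fix _ (set_valP q) nq).
rewrite tlinB -tlin_comp mulmxV // tlin1.
set z := vchart v _.
have cz : cabs z = vradius v (set_val q) by exact: vchart_cabs.
have zE : z = std_act (tlin (vertex_dual v) t) (realpt (vradius v (set_val q))).
  by rewrite /z vchartE.
rewrite addrC std_actD -cz -cargP zE -std_actD addNr std_act0 -zE cz //.
Qed.

Lemma vradius_continuous v q : near_vertex v q -> {for q, continuous (vradius v)}.
Proof.
move=> nq; apply: continuous_mkrow => j.
have ch : {for q, continuous (vheight v j)} by exact: fheight_continuous.
apply: (@continuous_comp _ _ _ (fun q => vheight v j q / (1 - vheight v j q))
  (@Num.sqrt R)); last exact: sqrt_continuous.
apply: continuousM; first exact: ch.
apply: continuousV; last first.
  by apply: continuousB; [exact: cst_continuous | exact: ch].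
by rewrite subr_eq0 eq_sym lt_eqF // nq.
Qed.

Lemma vpolar_continuous v (p : T * cube R n) : near_vertex v (set_val p.2) ->
  {for p, continuous (vpolar v)}.
Proof.
move=> nq; apply: (@continuous_comp _ _ _
  (fun p : T * cube R n => (tlin (vertex_dual v) p.1, realpt (vradius v (set_val p.2))))
  (fun p : T * Cn R n => std_act p.1 p.2)); last exact: std_act_continuous.
apply: continuous_pair.
  apply: (@continuous_comp _ _ _ fst (tlin (vertex_dual v))); first exact: cvg_fst.
  exact: tlin_continuous.
apply: (@continuous_comp _ _ _ (fun p : T * cube R n => vradius v (set_val p.2))
  (@realpt R n)); last exact: realpt_continuous.
apply: (@continuous_comp _ _ _ (fun p : T * cube R n => set_val p.2) (vradius v)).
  apply: (@continuous_comp _ _ _ snd (set_val : cube R n -> 'rV[R]_n)).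
    exact: cvg_snd.
  exact: cube_val_continuous.
exact: vradius_continuous.
Qed.

(** Continuity is checked on the quotient, where the chart is not given by a
    single formula over all of T * cube but only over the open part near v. *)
Lemma vchart_continuous v x : vdom v x -> {for x, continuous (vchart v)}.
Proof.
move=> dx W0; rewrite nbhsE => -[W [oW Wx] WW0].
suff oV : open (vdom v `&` vchart v @^-1` W).
  have : nbhs x (vdom v `&` vchart v @^-1` W) by apply: open_nbhs_nbhs.
  by move=> /nbhs_sub; apply => y [_ /WW0].
rewrite /open /= /quotient_open openE => -[t q] [nq Wp]; rewrite /interior.
move: nq Wp; rewrite /vdom /= model_posE => nq; rewrite vchartE // => Wp.
have n1 : nbhs (t, q) [set p : T * cube R n | near_vertex v (set_val p.2)].
  have c : continuous (fun p : T * cube R n => set_val p.2).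
    apply: (@comp_continuous _ _ _ snd (set_val : cube R n -> 'rV[R]_n)).
      by move=> p; exact: cvg_snd.
    exact: cube_val_continuous.
  apply: (c (t, q)); apply: open_nbhs_nbhs; split=> //; exact: near_vertex_open.
have n2 : nbhs (t, q) (vpolar v @^-1` W).
  by apply: (@vpolar_continuous v (t, q) nq); apply: open_nbhs_nbhs.
have := nbhs_and n1 n2 => /nbhs_sub; apply => -[t' q'] /= [nq' Wp'].
by split; rewrite /= ?model_posE // vchartE.
Qed.

Lemma sqnorm_continuous j : continuous (fun z : Cn R n => sqnorm z j).
Proof.
have c1 := @Cn_re_continuous R n j; have c2 := @Cn_im_continuous R n j.
by move=> z; apply: cvgD; apply: cvgM; [exact: c1|exact: c1|exact: c2|exact: c2].
Qed.

(** The inverse involves arguments, so its continuity is not visible from the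
    formula. Near z it is the inverse of the chart on the compact set of points
    whose heights are at most b j < 1. *)
Lemma vinv_continuous v : continuous (vinv v).
Proof.
move=> z; pose b j := (sqnorm z j + 1) / (sqnorm z j + 2).
have b1 j : b j < 1.
  have := sqnorm_ge0 z j; set s := sqnorm z j => s0.
  by rewrite /b -/s ltr_pdivrMr; lra.
pose K := [set x : X | forall j, vheight v j (model_pos x) <= b j].
have Kdom x : K x -> vdom v x by move=> Kx j; apply: le_lt_trans (Kx j) (b1 j).
have clK : closed K.
  have -> : K = \bigcap_(j in [set: 'I_n])
      ((fun x => vheight v j (model_pos x)) @^-1` [set y | y <= b j]).
    by apply/seteqP; split=> x Kx j; [move=> _; exact: Kx | exact: (Kx j I)].
  apply: closed_bigI => j _; apply: preimage_closed; last exact: closed_le.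
  move=> x _; apply: (@continuous_comp _ _ _ model_pos (vheight v j)).
    exact: model_pos_continuous.
  exact: fheight_continuous.
have cK : compact K.
  by rewrite -[K]setTI; apply: compact_closedI => //; exact: model_compact.
apply: (@compact_cancel_continuous _ _ K (vchart v)) => //.
- apply: continuous_in_subspaceT => x; rewrite inE => /Kdom; exact: vchart_continuous.
- by move=> x /Kdom; exact: vchartK.
- have : \forall z' \near z, forall j, sqnorm z' j < sqnorm z j + 1.
    apply: near_forall => j.
    have c : {for z, continuous (fun z => sqnorm z j)} by exact: sqnorm_continuous.
    have := @cvgr_lt _ _ _ _ (fun z => sqnorm z j) _ c (sqnorm z j + 1).
    by apply; rewrite ltrDl.
  move=> /nbhs_sub; apply => z' /= z'P; exists (vinv v z'); last exact: vinvK.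
  move=> j; rewrite vinv_pos vheight_vpos eqxx /b.
  have := z'P j; have := sqnorm_ge0 z' j; have := sqnorm_ge0 z j.
  set s := sqnorm z j; set s' := sqnorm z' j => s0 s'0 ss'.
  have p1 : 0 < 1 + s' by lra.
  have p2 : 0 < s + 2 by lra.
  rewrite ler_pdivrMr // mulrAC ler_pdivlMr //; nra.
Qed.

Lemma vchart_inj v x y : vdom v x -> vdom v y -> vchart v x = vchart v y -> x = y.
Proof. by move=> dx dy xy; rewrite -(vchartK dx) xy vchartK. Qed.

(** Two points over the same q lie in a common chart. *)
Lemma model_hausdorff : hausdorff_space X.
Proof.
move=> x y xy.
have pE : model_pos x = model_pos y.
  have hR : hausdorff_space 'rV[R]_n by exact: norm_hausdorff.
  apply: hR => A B nA nB.
  have [z [Az Bz]] := xy _ _ (@model_pos_continuous x A nA) (@model_pos_continuous y B nB).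
  by exists (model_pos z).
have [v dx] := vdom_exists x.
have dy : vdom v y by move: dx; rewrite /vdom /= pE.
apply: (vchart_inj dx dy).
have hC : hausdorff_space (Cn R n) by exact: norm_hausdorff.
apply: hC => A B nA nB.
have [z [Az Bz]] := xy _ _ (vchart_continuous dx nA) (vchart_continuous dy nB).
by exists (vchart v z).
Qed.
End VertexCharts.

(** * The model manifold is quasitoric *)

(** The entries of N = A^-1 A' with row in Z and column outside Z' vanish,
    since all real multiples of the row of A^-1 with index in Z must have
    integral coordinates there. The determinant of N is not zero, so some
    permutation s has N j (s j) <> 0 for all j, and s maps Z into Z'. *)
Lemma coordinate_card (R : realType) (n : nat) (A A' : 'M[int]_n)
    (Z Z' : {set 'I_n}) : A \in unitmx -> A' \in unitmx ->
  (forall u : 'rV[R]_n,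
     (forall j, j \notin Z -> (u *m realmx R A) 0 j \is a Num.int) ->
     (forall j, j \notin Z' -> (u *m realmx R A') 0 j \is a Num.int)) ->
  (#|Z| <= #|Z'|)%N.
Proof.
move=> uA uA' h; pose N := invmx A *m A'.
have N0 j i : j \in Z -> i \notin Z' -> N j i = 0.
  move=> jZ iZ; apply: (@real_multiples_int R) => s.
  have -> : s * (N j i)%:~R = (s *: realmx R (row j (invmx A)) *m realmx R A') 0 i.
    rewrite -scalemxAl -realmx_mul [RHS]mxE; congr (_ * _).
    by rewrite [RHS]mxE -row_mul [in RHS]mxE.
  apply: h iZ => k kZ; rewrite -scalemxAl -realmx_mul -row_mul mulVmx // row1 !mxE.
  case: (k =P j) => [kj|_]; first by move: kZ; rewrite kj jZ.
  by rewrite andbF mulr0 rpred0.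
have uN : \det N != 0.
  have : N \in unitmx by rewrite unitmx_mul unitmx_inv uA.
  by rewrite unitmxE; apply: contraTneq => ->; rewrite unitr0.
have [s sP] : exists s : 'S_n, forall j, N j (s j) != 0.
  apply: contrapT => ns; move/eqP: uN; apply; rewrite /determinant big1 // => s _.
  have [j /eqP Nj] : exists j, N j (s j) == 0.
    apply: contrapT => nj; apply: ns; exists s => j; apply/negP => Nj.
    by apply: nj; exists j.
  by rewrite (bigD1 j) //= Nj mul0r mulr0.
rewrite -(card_imset _ (@perm_inj _ s)); apply: subset_leq_card.
apply/fintype.subsetP => i /imsetP[j jZ ->]; apply: contraT => /(N0 j _ jZ) Nj.
by have := sP j; rewrite Nj eqxx.
Qed.

Section ModelManifold.
Variables (R : realType) (n : nat) (xi : 'M[int]_n).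
Local Notation T := (torus R n).
Local Notation piT := (\pi_(torus R n)).
Local Notation X := (qt_model R xi).
Local Notation piX := (\pi_(qt_model R xi)).
Local Notation vinv := (@vinv R n xi).
Implicit Types (v w : 'I_n -> bool) (q : 'rV[R]_n) (z : Cn R n) (t : T).
Hypothesis ubasis : forall v, vertex_basis xi v \in unitmx.

(** Preimages of balls with rational center and radius 1 / (m + 1) in the
    finitely many charts. *)
Lemma model_second_countable : @second_countable X.
Proof.
pose I := ({ffun 'I_n -> bool} * ('rV[rat]_n * 'rV[rat]_n) * nat)%type.
pose r0 (i : I) : Cn R n := (map_mx ratr i.1.2.1, map_mx ratr i.1.2.2).
pose O (i : I) : set X := vdom i.1.1 `&` vchart i.1.1 @^-1` ball (r0 i) (i.2.+1%:R^-1 : R).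
have oO i : open (O i).
  rewrite openE => x [dx Bx]; rewrite /interior; apply: nbhs_and.
    by apply: open_nbhs_nbhs; split=> //; exact: vdom_open.
  apply: (vchart_continuous ubasis dx); apply: open_nbhs_nbhs; split=> //.
  by apply: ball_open; rewrite invr_gt0.
exists (range O).
  exact: sub_countable (card_image_le O _) (countableP _).
split; first by move=> _ [i _ <-].
move=> x N nN; have [v dx] := vdom_exists x.
have : nbhs (vchart v x) (vinv v @^-1` N).
  by apply: (vinv_continuous ubasis); rewrite (vchartK ubasis dx).
move=> /nbhs_ballP[e /= e0 eP].
have [m mP] : exists m : nat, m.+1%:R^-1 < e / 2.
  exists (Num.bound (2 / e)).
  rewrite -[e / 2]invrK ltf_pV2 ?posrE ?invr_gt0 ?divr_gt0 //.
  rewrite invf_div; apply: lt_trans (_ : (Num.bound (2 / e))%:R < _).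
    by have := archi_boundP (_ : 0 <= 2 / e); apply; rewrite divr_ge0 // ltW.
  by rewrite ltr_nat.
have approx (y : R) : exists a : rat, `|ratr a - y| < m.+1%:R^-1.
  have [a aP] := @rat_in_itvoo R (y - m.+1%:R^-1) (y + m.+1%:R^-1)
    ltac:(by rewrite ltrD2l gtrN ?invr_gt0).
  exists a; move: aP; rewrite in_itv /= => /andP[al ar].
  by rewrite ltr_norml ltrBrDl al ltrBlDl ar.
have approxv (y : 'rV[R]_n) : exists a : 'rV[rat]_n,
    forall j, `|ratr (a 0 j) - y 0 j| < m.+1%:R^-1.
  have /choice[a aP] := fun j => approx (y 0 j).
  by exists (\row_j a j) => j; rewrite mxE.
have [a1 a1P] := approxv (vchart v x).1; have [a2 a2P] := approxv (vchart v x).2.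
pose i : I := ([ffun j => v j], (a1, a2), m).
have vE : i.1.1 =1 v by move=> j; rewrite ffunE.
have m0 : 0 < m.+1%:R^-1 :> R by rewrite invr_gt0.
have iE : O i = vdom v `&` vchart v @^-1` ball (r0 i) (m.+1%:R^-1 : R).
  by rewrite /O (funext vE).
have bP : ball (r0 i) (m.+1%:R^-1 : R) (vchart v x).
  split; split=> // k j; rewrite ord1.
    have -> : (r0 i).1 0 j = ratr (a1 0 j) by rewrite mxE.
    exact: a1P.
  have -> : (r0 i).2 0 j = ratr (a2 0 j) by rewrite mxE.
  exact: a2P.
exists (O i); first by split; [exists i | rewrite iE].
rewrite iE => y [dy By]; rewrite -(vchartK ubasis dy); apply: eP.
by apply: (@ball_splitr _ _ (r0 i)); [exact: le_ball (ltW mP) _ bP | exact: le_ball (ltW mP) _ By].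
Qed.

(** Where v and w agree they share a facet, so the change of basis fixes its
    vector. *)
Lemma transition_row v w k : v k = w k ->
  row k (vertex_basis xi v *m vertex_dual xi w) = delta_mx 0 k.
Proof.
move=> vw; rewrite row_mul.
have -> : row k (vertex_basis xi v) = row k (vertex_basis xi w).
  by apply/rowP => j; rewrite !mxE /vertex_facet vw.
by rewrite -row_mul mulmxV // row1.
Qed.

Lemma transition_entry v w k j : v k = w k ->
  (vertex_basis xi v *m vertex_dual xi w) k j = (j == k)%:R.
Proof. by move=> /transition_row/rowP/(_ j); rewrite [LHS]mxE => ->; rewrite mxE eqxx. Qed.

(** Reading the action of p x on the point with coordinates Z x in the chart at
    w: the modulus is kept at the coordinates where v and w agree and inverted
    at the others, and the argument at j is the sum psi of the translation and
    of integer multiples of the arguments at the coordinates where v and w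
    differ, plus the argument of Z at j if v and w agree there. The latter is
    arbitrary where Z vanishes, but it comes with its modulus, and together
    they are the coordinate itself. With p = 0 this is the change of charts;
    with p the first coordinate, the action. *)
Lemma smooth_transition (V : normedModType R) (U : set V) v w (Z : V -> Cn R n)
    (p : V -> 'rV[R]_n) : open U ->
  (forall j, smooth (fun x => (Z x).1 0 j) U) ->
  (forall j, smooth (fun x => (Z x).2 0 j) U) ->
  (forall j, smooth (fun x => p x 0 j) U) ->
  (forall x, U x -> forall j, v j != w j -> ~~ Cn_zero (Z x) j) ->
  smooth (fun x => vchart w (qt_model_act (piT (p x)) (vinv v (Z x)))) U.
Proof.
move=> oU sZ1 sZ2 sp Znz.
pose a := vertex_basis xi v *m vertex_dual xi w.
pose th x : 'rV[R]_n := repr (carg (Z x)).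
pose psi j x := (p x *m realmx R (vertex_dual xi w)) 0 j +
  \sum_(k | v k != w k) th x 0 k * (a k j)%:~R.
have polarE x j :
    (Z x).1 0 j = cabs (Z x) 0 j * cos (2 * pi * th x 0 j) /\
    (Z x).2 0 j = cabs (Z x) 0 j * sin (2 * pi * th x 0 j).
  have := cargP (Z x); rewrite /std_act -/(th x); set r := cabs (Z x) => E.
  have := congr1 (fun z : Cn R n => z.1 0 j) E.
  have := congr1 (fun z : Cn R n => z.2 0 j) E.
  by clearbody r; rewrite /= !mxE !mulr0 addr0 subr0 => -> ->; split; rewrite mulrC.
have sS j : smooth (fun x => (Z x).1 0 j ^+ 2 + (Z x).2 0 j ^+ 2) U.
  by apply: smoothD => //; apply: smoothM.
have pos x j : U x -> v j != w j -> 0 < (Z x).1 0 j ^+ 2 + (Z x).2 0 j ^+ 2.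
  move=> Ux vw; have := Znz x Ux j vw; rewrite -sqnorm_eq0 => h.
  by rewrite lt0r h sqnorm_ge0.
have sth j : v j != w j -> smooth_angle U (fun x => th x 0 j).
  move=> vw; apply: (smooth_angle_arg oU (sZ1 j) (sZ2 j)) => x Ux.
  - exact: pos.
  - by have [E _] := polarE x j; rewrite {1}E mxE.
  - by have [_ E] := polarE x j; rewrite {1}E mxE.
have spsi j : smooth_angle U (psi j).
  apply: smooth_angleD => //.
    apply: smooth_angle_smooth => //.
    apply: (smooth_ext oU (f := fun x => \sum_k p x 0 k * (vertex_dual xi w k j)%:~R)).
      by move=> x _; rewrite mxE; apply: eq_bigr => k _; rewrite mxE.
    apply: smooth_sum => // k; apply: smoothM => //; exact: smooth_cst.
  by apply: smooth_angle_sum => // k vw; apply: smooth_angle_int => //; exact: sth.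
pose phi x j := (if v j == w j then th x 0 j else 0) + psi j x.
pose rad x j := if v j == w j then cabs (Z x) 0 j else (cabs (Z x) 0 j)^-1.
apply: (smooth_ext oU (f := fun x =>
  (\row_j (rad x j * cos (2 * pi * phi x j)),
   \row_j (rad x j * sin (2 * pi * phi x j))) : Cn R n)) => [x Ux|].
  rewrite /vinv qt_model_actE (vchartE ubasis); last by apply/vpos_near/Znz.
  rewrite /vpolar /= tlinD -tlin_comp -/a -[carg (Z x)]reprK -/(th x) !tlinE.
  rewrite -torus_piD std_actE.
  have phiE j : (p x *m realmx R (vertex_dual xi w) + th x *m realmx R a) 0 j = phi x j.
    rewrite mxE /phi /psi addrCA; congr (_ + _); rewrite mxE (bigID (fun k => v k == w k)) /=.
    have aR k i : realmx R a k i = (a k i)%:~R by rewrite mxE.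
    congr (_ + _); last by apply: eq_bigr => k _; rewrite aR.
    case: eqP => [vw|/eqP vw].
      rewrite (bigD1 j) ?vw //= big1 ?addr0 => [|k /andP[/eqP vk kj]].
        by rewrite aR transition_entry // eqxx mulr1.
      by rewrite aR transition_entry // eq_sym (negPf kj) mulr0.
    rewrite big1 // => k /eqP vk.
    rewrite aR transition_entry //; case: eqP => [jk|_]; last by rewrite mulr0.
    by move: vw; rewrite jk vk eqxx.
  have radE j : vradius w (vpos v (Z x)) 0 j = rad x j by exact: vradius_vpos.
  congr pair; apply/rowP => j; rewrite [LHS]mxE [RHS]mxE phiE -radE /=.
    by rewrite [(0 : 'rV[R]_n) 0 j]mxE mulr0 subr0 mulrC.
  by rewrite [(0 : 'rV[R]_n) 0 j]mxE mulr0 addr0 mulrC.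
have scos j : smooth (fun x => rad x j * cos (2 * pi * phi x j)) U /\
              smooth (fun x => rad x j * sin (2 * pi * phi x j)) U.
  have [sc ss] := spsi j; rewrite /rad /phi; case: eqP => [vw|/eqP vw].
    split.
      apply: (smooth_ext oU (f := fun x => (Z x).1 0 j * cos (2 * pi * psi j x) +
         - ((Z x).2 0 j * sin (2 * pi * psi j x)))) => [x _|].
        by have [-> ->] := polarE x j; rewrite (mulrDr _ (th x 0 j)) cosD mulrBr !mulrA.
      by apply: smoothD => //; [|apply: smoothN => //]; apply: smoothM.
    apply: (smooth_ext oU (f := fun x => (Z x).1 0 j * sin (2 * pi * psi j x) +
         (Z x).2 0 j * cos (2 * pi * psi j x))) => [x _|].
      have [-> ->] := polarE x j; rewrite (mulrDr _ (th x 0 j)) sinD.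
      by rewrite (mulrDr (cabs _ _ _)) [RHS]addrC !mulrA addrC.
    by apply: smoothD => //; apply: smoothM.
  have srad : smooth (fun x => (cabs (Z x) 0 j)^-1) U.
    apply: (smooth_ext oU (f := fun x =>
      (Num.sqrt ((Z x).1 0 j ^+ 2 + (Z x).2 0 j ^+ 2))^-1)) => [x _|k].
      by rewrite mxE.
    apply: Ck_rsqrt => //; first by move=> x Ux; exact: pos.
    exact: sS.
  split.
    apply: (smooth_ext oU (f := fun x => (cabs (Z x) 0 j)^-1 * cos (2 * pi * psi j x))).
      by move=> x _; rewrite add0r.
    exact: smoothM.
  apply: (smooth_ext oU (f := fun x => (cabs (Z x) 0 j)^-1 * sin (2 * pi * psi j x))).
    by move=> x _; rewrite add0r.
  exact: smoothM.
by apply: smooth_Cn => // j; have [] := scos j.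
Qed.

Lemma overlap_open (V : topologicalType) v w (Z : V -> Cn R n) : continuous Z ->
  open [set x | forall j, v j != w j -> ~~ Cn_zero (Z x) j].
Proof.
move=> cZ; rewrite openE => x hx; rewrite /interior.
have : \forall y \near x, forall j, v j != w j -> ~~ Cn_zero (Z y) j; last by [].
apply: near_forall => j; have [vw|vw] := boolP (v j != w j); last first.
  by apply: (nbhs_sub filterT) => y _.
have c : {for x, continuous (fun y => sqnorm (Z y) j)}.
  by apply: (@continuous_comp _ _ _ Z (fun z => sqnorm z j));
    [exact: cZ | exact: sqnorm_continuous].
have nz : sqnorm (Z x) j != 0 by rewrite sqnorm_eq0 hx.
by have := continuous_neq0 c nz => /nbhs_sub; apply => y /= h _; rewrite -sqnorm_eq0.
Qed.

(** The standard chart property below asks for images that are invariant under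
    the torus, which is immediate when each chart is onto C^n. *)
Lemma vchart_img v : vchart v @` (vdom v : set X) = [set: Cn R n].
Proof.
by apply/seteqP; split=> // z _; exists (vinv v z); [exact: vinv_vdom|exact: vinvK].
Qed.

Fact vchart_img_open v : open (vchart v @` (vdom v : set X)).
Proof. by rewrite vchart_img; exact: openT. Qed.

Fact vchartK_in v : {in (vdom v : set X), cancel (vchart v) (vinv v)}.
Proof. by move=> x; rewrite inE => /(vchartK ubasis). Qed.

Fact vinv_continuous_on v z : (vchart v @` (vdom v : set X)) z ->
  {for z, continuous (vinv v : Cn R n -> X)}.
Proof. by move=> _; exact: vinv_continuous. Qed.

Definition mchart v : chart R n (qt_of_square R xi) :=
  @Chart R n (qt_of_square R xi) (vdom v) (vchart v) (vinv v)
    (@vdom_open R n xi v) (@vchart_img_open v) (@vchartK_in v)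
    (@vchart_continuous R n xi ubasis v) (@vinv_continuous_on v).

Definition matlas : set (chart R n (qt_of_square R xi)) := range mchart.

Lemma overlapE v w : vchart v @` (vdom v `&` vdom w : set X) =
  [set z | forall j, v j != w j -> ~~ Cn_zero z j].
Proof.
apply/seteqP; split=> [_ [x [dv dw] <-]|z hz].
  by apply/(@vinv_dom R n xi); rewrite (vchartK ubasis dv).
by exists (vinv v z); [split; [exact: vinv_vdom | exact/vinv_dom] | exact: vinvK].
Qed.

Lemma smooth_overlap v w : smooth (vchart w \o (vinv v : Cn R n -> X))
  (vchart v @` (vdom v `&` vdom w : set X)).
Proof.
rewrite overlapE; set U := [set z | _].
have oU : open U by apply: overlap_open => z; exact: cvg_id.
have H := @smooth_transition (Cn R n) U v w id (fun=> 0) oU.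
apply: smooth_ext (H _ _ _ _) => //.
- by move=> z _; rewrite torus_pi0 qt_model_act0.
- move=> j; apply: smooth_linear => //; first exact: (@Cn_re_continuous R n j).
  by move=> a x y; rewrite /= !mxE.
- move=> j; apply: smooth_linear => //; first exact: (@Cn_im_continuous R n j).
  by move=> a x y; rewrite /= !mxE.
- move=> j; apply: (smooth_ext oU (f := fun=> 0)) => [x _|]; first by rewrite mxE.
  exact: smooth_cst.
Qed.

Lemma mchart_img v z : chart_img (mchart v) z.
Proof. by exists (vinv v z); [exact: vinv_vdom | exact: vinvK]. Qed.

Lemma mchart_compatible v w : compatible (mchart v) (mchart w).
Proof. by split; [exact: smooth_overlap | rewrite /= setIC; exact: smooth_overlap]. Qed.

Lemma matlas_smooth : smooth_atlas matlas.
Proof.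
split=> [x|_ _ [v _ <-] [w _ <-]]; last exact: mchart_compatible.
have [v dx] := vdom_exists x; exists (mchart v) => //; by exists v.
Qed.

Lemma matlas_action : smooth_action matlas.
Proof.
move=> _ _ [v _ <-] [w _ <-].
have -> : [set p : 'rV[R]_n * Cn R n | chart_img (mchart v) p.2 /\
    chart_dom (mchart w) (tact (piT p.1) (chart_inv (mchart v) p.2))] =
    [set p | forall j, v j != w j -> ~~ Cn_zero p.2 j].
  apply/seteqP; split=> p /=.
    move=> [_]; rewrite /vdom /= model_pos_act => h; exact/(@vinv_dom R n xi).
  move=> h; split; first exact: mchart_img.
  by rewrite /vdom /= model_pos_act; exact/(@vinv_dom R n xi).
set U := [set p | _].
have c2 : continuous (fun p : 'rV[R]_n * Cn R n => p.2) by move=> p; exact: cvg_snd.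
have c1 : continuous (fun p : 'rV[R]_n * Cn R n => p.1) by move=> p; exact: cvg_fst.
have oU : open U by exact: overlap_open.
apply: (@smooth_transition _ U v w (fun p => p.2) (fun p => p.1) oU) => //.
- move=> j; apply: smooth_linear => //; last by move=> a x y; rewrite /= !mxE.
  exact: comp_continuous c2 (@Cn_re_continuous R n j).
- move=> j; apply: smooth_linear => //; last by move=> a x y; rewrite /= !mxE.
  exact: comp_continuous c2 (@Cn_im_continuous R n j).
- move=> j; apply: smooth_linear => //; last by move=> a x y; rewrite /= !mxE.
  exact: comp_continuous c1 (@coord_row_continuous R n j).
Qed.

Lemma mchart_standard v : standard_chart matlas (mchart v).
Proof.
split=> [t x|t z _|_ [w _ <-]|].
- exact: vdom_act.
- exact: mchart_img.
- exact: mchart_compatible.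
exists (tlin (vertex_dual xi v)); first by apply: tlin_aut; rewrite unitmx_inv.
by move=> t x; exact: vchart_act.
Qed.

Lemma matlas_locally_standard : locally_standard matlas.
Proof.
move=> x; have [v dx] := vdom_exists x; exists (mchart v) => //.
exact: mchart_standard.
Qed.

(** A standard chart carries isotropy groups to coordinate subtori, by a
    unimodular matrix. *)
Lemma standard_chart_stab (c : chart R n (qt_of_square R xi)) :
  standard_chart matlas c -> exists2 A : 'M[int]_n, A \in unitmx &
  forall x u, chart_dom c x -> tact (piT u) x = x <->
    forall j, j \notin [set j | Cn_zero (c x) j]%SET ->
      (u *m realmx R A) 0 j \is a Num.int.
Proof.
move=> [cdomT _ _ [psi /torus_aut_tlin[A uA psiE] cpsi]]; exists A => // x u dx.
have -> : (tact (piT u) x = x) <-> (std_act (piT (u *m realmx R A)) (c x) = c x).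
  split=> [/(congr1 c)|h]; first by rewrite cpsi // psiE tlinE.
  have dux := cdomT (piT u) x dx.
  rewrite -[LHS](@chart_mapK _ _ _ c) ?inE // cpsi // psiE tlinE h.
  by rewrite chart_mapK // inE.
rewrite std_act_fix; split=> h j; first by rewrite inE; exact: h.
by move=> nz; apply: h; rewrite inE.
Qed.

(** The isotropy group of x is a coordinate subtorus in both charts, and its
    dimension does not depend on the coordinates. *)
Lemma standard_charts_depth (c d : chart R n (qt_of_square R xi)) x :
  standard_chart matlas c -> standard_chart matlas d ->
  chart_dom c x -> chart_dom d x -> Cn_depth (c x) = Cn_depth (d x).
Proof.
move=> /standard_chart_stab[A uA cA] /standard_chart_stab[B uB dB] cx dx.
have E z : Cn_depth z = #|[set j | Cn_zero z j]%SET| by rewrite cardsE.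
rewrite !E; apply/eqP; rewrite eqn_leq; apply/andP; split.
  by apply: (@coordinate_card R n A B) => // u /(cA x u cx) h; exact/(dB x u dx).
by apply: (@coordinate_card R n B A) => // u /(dB x u dx) h; exact/(cA x u cx).
Qed.

Lemma vchart_depth v (x : X) : vdom v x -> Cn_depth (vchart v x) = cube_depth (model_pos x).
Proof.
rewrite -[x]reprK; case: (repr x) => t q; rewrite /vdom /= model_posE => nq.
pose Z := [set j | facet (vertex_facet v j) (set_val q)]%SET.
transitivity #|Z|.
  rewrite cardsE; apply: eq_card => j.
  rewrite !inE -/(Cn_zero (vchart v (piX (t, q))) j) -cabs_eq0 vchart_cabs //.
  by rewrite vradius_eq0 //; exact: set_valP.
rewrite -(card_imset _ (@vertex_facet_inj n v)); apply: eq_card => k.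
rewrite [RHS]inE; apply/imsetP/idP => [[j]|fk]; first by rewrite inE => fj ->.
by have [j kE] := near_vertex_facet nq fk; exists j; rewrite // inE -kE.
Qed.

Lemma model_proj_depth c : standard_chart matlas c -> forall x, chart_dom c x ->
  Cn_depth (c x) = cube_depth (set_val (model_proj x)).
Proof.
move=> sc x cx; have [v dx] := vdom_exists x.
rewrite (standard_charts_depth sc (mchart_standard v) cx dx) /=.
exact: vchart_depth.
Qed.

Lemma model_proj_surj (q : cube R n) : exists x : X, model_proj x = q.
Proof. by exists (piX (0, q)); rewrite model_projE. Qed.

Lemma model_proj_homeo : exists2 h : orbit_space (qt_of_square R xi) -> cube R n,
  homeo h & forall x, h (\pi_(orbit_space (qt_of_square R xi)) x) = model_proj x.
Proof.
pose O := orbit_space (qt_of_square R xi).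
pose h (o : O) : cube R n := model_proj (repr o).
have hE x : h (\pi_O x) = model_proj x.
  rewrite /h; case: piP => y /eqmodP/asboolP[t ->]; apply: val_inj.
  exact: model_pos_act.
exists h => //; split.
  apply/quotient_continuous.
  have -> : h \o \pi_O = @model_proj R n xi by apply/funext => x; exact: hE.
  exact: model_proj_continuous.
exists (fun q : cube R n => \pi_O (piX (0, q))); split.
- apply: (@comp_continuous _ _ _ (fun q : cube R n => piX (0, q)) (\pi_O)).
    apply: (@comp_continuous _ _ _ (fun q : cube R n => (0 : T, q)) piX).
      by move=> q; apply: continuous_pair; [exact: cst_continuous | exact: cvg_id].
    exact: pi_continuous.
  exact: pi_continuous.
- move=> z; rewrite -[z]reprK hE; apply/eqmodP/asboolP.
  set x : X := repr z; rewrite -[x]reprK; case: (repr x) => t q.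
  by exists t; rewrite /= qt_model_actE model_projE addr0.
- by move=> q; rewrite hE model_projE.
Qed.

Definition model_quasitoric : quasitoric R n :=
  @Quasitoric R n (qt_of_square R xi) (model_hausdorff ubasis)
    model_second_countable matlas matlas_smooth matlas_action
    matlas_locally_standard (@model_proj R n xi) (@model_proj_continuous R n xi)
    model_proj_surj model_proj_homeo model_proj_depth.
End ModelManifold.

(** * Quasitoric manifolds over the 3-cube *)

Lemma char_square_basis (R : realType) (n : nat) (xi : 'M[int]_n) v :
  char_square R n xi -> vertex_basis xi v \in unitmx.
Proof.
move=> [_ h]; have -> : vertex_basis xi v = (colsub (vertex_facet v) (char_mx xi))^T.
  by apply/matrixP => i j; rewrite !mxE.
rewrite unitmx_tr unitmxE; apply/int_unitP; apply: h; first exact: vertex_facet_inj.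
by exists (vertex R v); [exact: vertex_cube | exact: vertex_facetP].
Qed.

Theorem lemma4p10 (R : realType) :
  let A := A1 `|` A2 `|` A3 `|` [set chi1; chi5; chi6; chi10] in
  A `<=` char_square R 3 /\
  Mweh R 3 = (fun C => exists2 xi, A xi & C = phi R 3 xi).
Proof.
move=> A; split; first exact: listed_char_square.
apply/funext => C; apply/propext; split=> [[M ->]|[xi Axi ->]]; last first.
  have cx := @listed_char_square R xi Axi.
  by exists (@model_quasitoric R 3 xi (fun v => char_square_basis v cx)).
have [L [stabL uL]] := characteristic_vectors M.
have [xi Axi [gam [e [B [[gi [g [g' [cg gc gc' [gK g'K] gE]]]] uB e1 LB]]]]] :=
  unimodular_classified uL.
exists xi => //; apply: weh_class_eq; apply: weq_sym.
exact: (recognition stabL cg gc gc' gK g'K gi gE uB e1 LB).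
Qed.
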